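(* Fix any $\varepsilon>0$ and $K\in\mathbb N$, and for each $i=1,2$ let $c^i_\tau(r)$, $\tau\in(-\varepsilon,\varepsilon)$, be an admissible family of profiles with discontinuities at $r_k(\tau)$ for $k=1,\dots,K$ (the same radii for $i=1$ and $i=2$). Consider all periodic rays which are geodesics within each layer and satisfy the usual reflection or transmission conditions at interfaces, but which can change between the velocity profiles $c^1_\tau$ and $c^2_\tau$ at any reflection and transmission. Suppose that the length spectrum of this whole family of rays in the ball $\bar B(0,1)$, denoted by $\operatorname{lsp}(\tau)$, is countable. If $\operatorname{lsp}(\tau)=\operatorname{lsp}(0)$ for all $\tau\in(-\varepsilon,\varepsilon)$, then $c^i_\tau=c^i_0$ for both $i=1,2$ and $r_k(\tau)=r_k(0)$ for all $\tau\in(-\varepsilon,\varepsilon)$ and $k=1,\dots,K$.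
   Context: Annuli and metrics. For $0\le r'<r''$ let $A(r',r'')=\bar B(0,r'')\setminus B(0,r')$ (closed Euclidean annulus). A velocity profile $c$ on $[0,1]$ defines on the ball $\bar B(0,1)$ the (rough) Riemannian metric $g_c=c(|x|)^{-2}\,dx^2$. With $1=r_0>r_1>\dots>r_K>0$ the jump radii, the spheres $\{|x|=r_k\}$, $1\le k\le K$, are called interfaces, and together with the boundary $\{|x|=1\}$ they form $\Gamma$. Put $r_{K+1}=0$; the regions $A(r_k,r_{k-1})$, $k=1,\dots,K+1$, are called layers. By symmetry every ray lies in a two-dimensional plane through the origin, so the dimension is irrelevant. Smooth Herglotz condition: $\frac{d}{dr}\bigl(r/c(r)\bigr)>0$ at all points away from the discontinuities of $c$ (no condition is imposed on the sign of jumps). Countable conjugacy condition: a $C^{1,1}$ sound speed $c\colon(a,b]\to(0,\infty)$ on an annulus $A(a,b)$ satisfies it if there are only countably many (possibly finitely many or no) radii $r\in(a,b)$ such that the endpoints of the maximal geodesic $\gamma(r)$ (the geodesic, unique up to rotation, whose minimal distance to the origin is $r$, with endpoints on $|x|=b$) are conjugate along that geodesic. Admissible family of profiles: a collection of functions $c_\tau\colon[0,1]\to(0,\infty)$, $\tau\in(-\varepsilon,\varepsilon)$, such that (i) there are radii $r_k(\tau)\in(0,1)$, $k=1,\dots,K$, depending $C^1$-smoothly on $\tau$, with $1=:r_0(\tau)>r_1(\tau)>\dots>r_K(\tau)>0$ for all $\tau$; (ii) for every $\tau$, $c_\tau$ is piecewise $C^{1,1}$ and satisfies the smooth Herglotz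 condition; (iii) the only singular points of each $c_\tau$ are the radii $r_k(\tau)$, $k=1,\dots,K$, where it has a jump discontinuity; (iv) within each layer $A(r_k(\tau),r_{k-1}(\tau))$ the profile $c_\tau$ satisfies the countable conjugacy condition, for all $\tau$; (v) $(r,\tau)\mapsto c_\tau(r)$ is $C^1$ at all points where $r\notin\{r_1(\tau),\dots,r_K(\tau)\}$. Rays with two speeds. A ray is a continuous path which is a concatenation of legs in the complement of $\Gamma$, each leg being a unit-speed geodesic for either $g_{c^1_\tau}$ or $g_{c^2_\tau}$ (so length means travel time, each leg being measured in its own metric), such that at each meeting with $\Gamma$ (reflection or transmission, possibly with a change of metric) Snell's law holds: the tangential component of the covector, equivalently the angular momentum, is preserved. Legs gliding along an interface (arising at critical incidence) are also allowed. It is periodic if it closes up with this condition satisfied at the closing point. The length spectrum is the set of lengths of all such periodic rays. *)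

(* Defs.v *)
From HB Require Import structures.
From mathcomp Require Import all_boot all_order all_algebra.
From mathcomp Require Import all_classical all_reals all_analysis.
Set Implicit Arguments.
Unset Strict Implicit.
Unset Printing Implicit Defensive.
Import Order.TTheory GRing.Theory Num.Theory.
Import numFieldNormedType.Exports.
Local Open Scope classical_set_scope.
Local Open Scope ring_scope.

(** [f] has derivative [l] at [x] relative to [A]; this is the one-sided
    derivative when [x] is an endpoint of the interval [A]. *)
Definition has_derive_within {R : realType} (A : set R) (f : R -> R)
    (x l : R) : Prop :=
  (fun y => (f y - f x) / (y - x)) @ within A x^' --> l.

(** [C^{1,1}] on an interval: differentiable with Lipschitz derivative.  The
    Lipschitz bound is uniform, so on a half-open interval [f] extends as a
    [C^{1,1}] function to the closed one. *)
Definition C11_on {R : realType} (A : set R) (f : R -> R) : Prop :=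
  exists df : R -> R,
    (forall x, A x -> has_derive_within A f x (df x)) /\
    (exists M : R, forall x y, A x -> A y -> `|df x - df y| <= M * `|x - y|).

(** Every ray lies in a plane through the origin, so we work in R^2.  The base
    point is [(x1, x2)], the covector [(p1, p2)], and the parameter runs over
    [`[0, dur]].  Values outside this interval are irrelevant. *)
Record phase_curve (R : realType) := PhaseCurve {
  dur : R;
  x1 : R -> R;
  x2 : R -> R;
  p1 : R -> R;
  p2 : R -> R
}.

Section Curves.
Context {R : realType}.
Implicit Types (g : phase_curve R) (c J : R -> R).

Definition radius g (t : R) : R := Num.sqrt (x1 g t ^+ 2 + x2 g t ^+ 2).
Definition conorm g (t : R) : R := Num.sqrt (p1 g t ^+ 2 + p2 g t ^+ 2).
Definition angular_momentum g (t : R) : R :=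
  x1 g t * p2 g t - x2 g t * p1 g t.
Definition radial_momentum g (t : R) : R :=
  x1 g t * p1 g t + x2 g t * p2 g t.

Definition continuous_curve g : Prop :=
  [/\ {within `[0, dur g], continuous (x1 g)},
      {within `[0, dur g], continuous (x2 g)},
      {within `[0, dur g], continuous (p1 g)} &
      {within `[0, dur g], continuous (p2 g)}].

(** [x' = v^2 p]: [p] is the covector dual to [x'] for the metric
    [v^-2 dx^2]. *)
Definition velocity_eq (v : R) g (t : R) : Prop :=
  is_derive t 1 (x1 g) (v ^+ 2 * p1 g t) /\
  is_derive t 1 (x2 g) (v ^+ 2 * p2 g t).

(** Unit-speed geodesic of [g_c = c(|x|)^-2 dx^2], lifted to the cotangent
    bundle: Hamilton's equations of [H(x, p) = c(|x|)^2 |p|^2 / 2] on the level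
    [c(|x|) |p| = 1].  The profile [c(|x|)] is in general only Lipschitz at the
    origin, so there the equation for [p'] is not imposed; continuity of [p]
    forces a geodesic to pass straight through the origin. *)
Definition unit_geodesic c g : Prop :=
  [/\ 0 < dur g, continuous_curve g &
      forall t, 0 < t < dur g ->
        [/\ c (radius g t) * conorm g t = 1,
            velocity_eq (c (radius g t)) g t &
            radius g t != 0 ->
            let h := - (c (radius g t) * derive1 c (radius g t)
                        * conorm g t ^+ 2 / radius g t) in
            is_derive t 1 (p1 g) (h * x1 g t) /\
            is_derive t 1 (p2 g) (h * x2 g t)]].

(** The geodesic [gamma(r)] of the annulus [A(a, b)], up to an isometry. *)
Definition maximal_geodesic c (b r : R) g : Prop :=
  [/\ unit_geodesic c g,
      radius g 0 = b, radius g (dur g) = b,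
      (forall t, 0 < t < dur g -> r <= radius g t < b) &
      exists2 t, 0 < t < dur g & radius g t = r].

(** Gaussian curvature [c^2 Laplacian(log c)] of [c(|x|)^-2 dx^2] at [|x| = s].
    For a [C^{1,1}] profile the second derivative exists almost everywhere. *)
Definition gauss_curvature c (s : R) : R :=
  c s * derive1 (derive1 c) s - derive1 c s ^+ 2 + c s * derive1 c s / s.

(** [J] is the component along the unit normal of a normal Jacobi field.  The
    curvature is only defined almost everywhere and bounded, hence [J'] is
    Lipschitz and [J'' + K J = 0] holds almost everywhere. *)
Definition normal_jacobi_field c g J : Prop :=
  {within `[0, dur g], continuous J} /\
  exists dJ : R -> R,
    [/\ forall t, 0 < t < dur g -> is_derive t 1 J (dJ t),
        (exists M : R, forall s t, 0 <= s <= dur g -> 0 <= t <= dur g ->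
           `|dJ s - dJ t| <= M * `|s - t|) &
        {ae (@lebesgue_measure R), forall t, 0 < t < dur g ->
           is_derive t 1 dJ (- (gauss_curvature c (radius g t) * J t))}].

(** A tangential Jacobi field is affine in [t], so in dimension two any Jacobi
    field that vanishes at two points is normal. *)
Definition conjugate_endpoints c g : Prop :=
  exists J, [/\ normal_jacobi_field c g J, J 0 = 0, J (dur g) = 0 &
                exists2 t, 0 <= t <= dur g & J t != 0].

Definition countable_conjugacy c (a b : R) : Prop :=
  countable [set r | a < r < b /\
    exists2 g, maximal_geodesic c b r g & conjugate_endpoints c g].

End Curves.

Section Admissible.
Context {R : realType}.

(** The radii [1 = r_0 > r_1 > ... > r_K > r_{K+1} = 0]; only the values of
    [rk] at [1, ..., K] are used. *)
Definition rad (K : nat) (rk : nat -> R) (k : nat) : R :=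
  if k == 0%N then 1 else if (k <= K)%N then rk k else 0.

(** Radii of the spheres that form [Gamma] (interfaces and boundary). *)
Definition Gamma_radii (K : nat) (rk : nat -> R) : set R :=
  [set s | exists2 k, (k <= K)%N & s = rad K rk k].

Definition jump_radii (K : nat) (rk : nat -> R) : set R :=
  [set s | exists2 k, (1 <= k <= K)%N & s = rk k].

(** For [0 <= k <= K], the radii on which the restriction of a profile to the
    layer [A(r_{k+1}, r_k)] is given: [(r_{k+1}, r_k]], and [[0, r_K]] for the
    innermost one.  So at a jump radius a profile takes its limit from
    below. *)
Definition layer (K : nat) (rk : nat -> R) (k : nat) : set R :=
  if (k < K)%N then [set s | rad K rk k.+1 < s <= rad K rk k]
  else [set s | 0 <= s <= rad K rk k].

Definition smooth_herglotz (K : nat) (rk : nat -> R) (c : R -> R) : Prop :=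
  forall s, 0 <= s <= 1 -> ~ jump_radii K rk s ->
    exists2 l, 0 < l &
      has_derive_within [set u | 0 <= u <= 1] (fun u => u / c u) s l.

Definition has_jump (c : R -> R) (s : R) : Prop :=
  exists l l' : R, [/\ c @ s^'- --> l, c @ s^'+ --> l' & l != l'].

(** [(s, tau) |-> c tau s] is [C^1] off the jump radii: both partial derivatives
    exist (one-sided in [s] at [s = 0] and [s = 1]) and are jointly
    continuous. *)
Definition C1_off_jumps (eps : R) (K : nat) (r : nat -> R -> R)
    (c : R -> R -> R) : Prop :=
  let D := [set z : R * R | [/\ 0 <= z.1 <= 1, - eps < z.2 < eps &
                                ~ jump_radii K (r^~ z.2) z.1]] in
  exists ds dt : R * R -> R,
    [/\ forall z, D z ->
          has_derive_within [set u | 0 <= u <= 1] (c z.2) z.1 (ds z),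
        forall z, D z -> is_derive z.2 1 (c^~ z.1) (dt z),
        {within D, continuous ds} &
        {within D, continuous dt}].

(** [r k tau] is the radius [r_k(tau)] and [c tau s] is [c_tau(s)]. *)
Record admissible_family (eps : R) (K : nat) (r : nat -> R -> R)
    (c : R -> R -> R) : Prop := AdmissibleFamily {
  adm_pos : forall tau s, - eps < tau < eps -> 0 <= s <= 1 -> 0 < c tau s;
  adm_radii_C1 : forall k tau, (1 <= k <= K)%N -> - eps < tau < eps ->
    derivable (r k) tau 1 /\ {for tau, continuous (derive1 (r k))};
  adm_radii_lt : forall k tau, (k <= K)%N -> - eps < tau < eps ->
    rad K (r^~ tau) k.+1 < rad K (r^~ tau) k;
  adm_C11 : forall k tau, (k <= K)%N -> - eps < tau < eps ->
    C11_on (layer K (r^~ tau) k) (c tau);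
  adm_herglotz : forall tau, - eps < tau < eps ->
    smooth_herglotz K (r^~ tau) (c tau);
  adm_jump : forall k tau, (1 <= k <= K)%N -> - eps < tau < eps ->
    has_jump (c tau) (r k tau);
  adm_conj : forall k tau, (k <= K)%N -> - eps < tau < eps ->
    countable_conjugacy (c tau) (rad K (r^~ tau) k.+1) (rad K (r^~ tau) k);
  adm_C1 : C1_off_jumps eps K r c
}.

End Admissible.

Section Rays.
Context {R : realType}.
Variables (K : nat) (rk : nat -> R) (c : 'I_2 -> R -> R).

Definition geodesic_leg (g : phase_curve R) : Prop :=
  [/\ exists i, unit_geodesic (c i) g,
      Gamma_radii K rk (radius g 0), Gamma_radii K rk (radius g (dur g)) &
      forall t, 0 < t < dur g ->
        radius g t < 1 /\ ~ Gamma_radii K rk (radius g t)].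

(** [v] ranges over the one-sided limits of the two profiles at the
    interface. *)
Definition gliding_leg (g : phase_curve R) : Prop :=
  exists (k : nat) (i : 'I_2) (v : R),
    [/\ (1 <= k <= K)%N,
        c i @ (rk k)^'- --> v \/ c i @ (rk k)^'+ --> v,
        0 < dur g /\ continuous_curve g,
        forall t, 0 <= t <= dur g ->
          [/\ radius g t = rk k, v * conorm g t = 1 & radial_momentum g t = 0] &
        forall t, 0 < t < dur g -> velocity_eq v g t].

(** [h] starts where [g] ends and Snell's law holds there. *)
Definition snell_joint (g h : phase_curve R) : Prop :=
  [/\ x1 g (dur g) = x1 h 0, x2 g (dur g) = x2 h 0 &
      angular_momentum g (dur g) = angular_momentum h 0].

(** A gliding leg is initiated by a geodesic leg that hits the interface
    non-tangentially; by [snell_joint] the angle of incidence is then critical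
    for the speed of the gliding leg. *)
Definition periodic_ray (n : nat) (leg : 'I_n.+1 -> phase_curve R) : Prop :=
  forall j,
    snell_joint (leg j) (leg (ordS j)) /\
    (geodesic_leg (leg j) \/
     [/\ gliding_leg (leg j), geodesic_leg (leg (ord_pred j)) &
         radial_momentum (leg (ord_pred j)) (dur (leg (ord_pred j))) != 0]).

Definition length_spectrum : set R :=
  [set L | exists n (leg : 'I_n.+1 -> phase_curve R),
     periodic_ray leg /\ L = \sum_j dur (leg j)].

End Rays.

Definition lsp {R : realType} (K : nat) (r : nat -> R -> R)
    (c : 'I_2 -> R -> R -> R) (tau : R) : set R :=
  length_spectrum K (r^~ tau) (fun i => c i tau).

(* Main.v *)
Require Import Defs.
From HB Require Import structures.
From mathcomp Require Import all_boot all_order all_algebra.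
From mathcomp Require Import all_classical all_reals all_analysis.
From mathcomp Require Import ring lra.
Set Implicit Arguments.
Unset Strict Implicit.
Unset Printing Implicit Defensive.
Import Order.TTheory GRing.Theory Num.Theory.
Import numFieldNormedType.Exports.
Local Open Scope classical_set_scope.
Local Open Scope ring_scope.

(** The proof uses rays that keep to one of the two profiles and to one layer.
    In the coordinate [u = ln |x|] such a profile is the squared
    slowness [f u = (e^u / c(e^u))^2]; the Herglotz condition says that [f] is
    increasing, and a ray of angular momentum [p] moves in the region
    [f u >= p^2].  Let [b = e^B] be the radius of the top of the layer.  A ray
    that leaves the top sphere, turns at the point [x] with [f x = p^2] and
    comes back advances by an angle [alpha(p)], takes the time
    [I(p) + p alpha(p)] with [I(p) = 2 int sqrt((f - p^2)_+) du], and
    [I' = - alpha].  If [n alpha(p) = 2 pi m], then [n] copies close up, so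
    [n (I(p) + q p)] with [q = 2 pi m / n = alpha(p)] is in the length spectrum
    (lemma [dive_in_lsp]): up to the factor [n] the critical values of
    [I_tau + q p] lie, for a dense set of slopes [q], in a countable set that
    is the same for all [tau].

    This forces [alpha_tau] to be independent of [tau]
    ([slope_rigidity]).  Near a momentum where [alpha_tau' <> 0], the maximum
    of [p |-> I_tau p + q p] over a small interval, minus the same maximum for
    another slope, is continuous in [tau] with countably many values, hence
    constant; by Legendre duality [I_tau] is then constant up to an additive
    constant.  The derivative [alpha_tau'] does not vanish identically on an
    interval: with the variable of integration [v], [u = x + (B - x) v^2], the
    normal Jacobi field along the ray is explicit, it vanishes at both ends
    exactly when [alpha' = 0], and the conjugacy condition allows this only
    for countably many rays.  Since the curvature exists only almost
    everywhere, this step needs that Lipschitz functions are differentiable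
    almost everywhere ([lipschitz_ae_derivable], [dive_conjugate]).

    The top momentum [W_tau = sqrt (f_tau B)] bounds the interval of momenta on
    which [I_tau] is positive.  It need not be continuous in [tau], but if it
    took two values, then on the way between them it would attain every
    momentum [p2] in an interval, and each time the action would be [I - I(p2)]
    for a fixed function [I]; so the countable set would contain an interval
    ([top_momentum_noninc]).  So [W_tau] and [I_tau] are both static, and Abel
    inversion ([abel_le]) recovers the profile from the action: down to any
    given radius in the layer, the profile is static for [tau] close to a given
    value ([local_static]).

    Finally the interfaces are treated from the boundary inwards.  If the
    upper radius of a layer is static and the lower one moves with nonzero
    speed, then the profile is static where it is defined and a radial ray
    crosses the layer in a time that is strictly monotone in [tau]
    ([time_lt]), while twice this time is in the countable length spectrum
    ([radial_in_lsp]).  Hence the lower radius is static, then the profile in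
    the whole layer, and so on by induction. *)

(** * Real calculus in epsilon-delta form *)

Section EpsDelta.
Context {R : realType}.
Implicit Types (f g : R -> R) (x l : R).

Lemma continuousP_eps f x :
  {for x, continuous f} <->
  (forall e, 0 < e -> exists2 d, 0 < d &
     forall y, `|y - x| < d -> `|f y - f x| < e).
Proof.
split => [/cvgrPdist_lt cf e e0|H].
  have /nbhs_ballP[d /= d0 Hd] := cf _ e0.
  exists d => // y yx; rewrite distrC; apply: Hd.
  by rewrite /ball/= distrC.
apply/cvgrPdist_lt => e e0; have [d d0 Hd] := H _ e0.
near=> y; rewrite distrC; apply: Hd; rewrite distrC.
by near: y; exact: cvgr_dist_lt.
Unshelve. all: by end_near. Qed.

Lemma is_derive_continuous f x l : is_derive x 1 f l -> {for x, continuous f}.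
Proof. by case=> df _; apply/differentiable_continuous/derivable1_diffP. Qed.

Lemma is_deriveP_eps f x l :
  is_derive x 1 f l <->
  (forall e, 0 < e -> exists2 d, 0 < d &
     forall y, `|y - x| < d -> `|f y - f x - l * (y - x)| <= e * `|y - x|).
Proof.
split.
  move=> /is_derive1_caratheodory[g [fE cg <-]] e e0.
  have [d d0 Hd] := (continuousP_eps _ _).1 cg _ e0.
  exists d => // y yx; rewrite fE -mulrBl normrM.
  by rewrite ler_wpM2r// ltW// Hd.
move=> H; apply/is_derive1_caratheodory.
exists (fun y => if y == x then l else (f y - f x) / (y - x)); split.
- move=> y; case: eqP => [->|/eqP yx]; first by rewrite !subrr mulr0.
  by rewrite divfK// subr_eq0.
- apply/continuousP_eps => e e0.
  have e20 : 0 < e / 2 by rewrite divr_gt0.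
  have [d d0 Hd] := H _ e20; exists d => // y yx.
  rewrite eqxx; case: eqP => [_|/eqP yxN]; first by rewrite subrr normr0.
  have yx0 : 0 < `|y - x| by rewrite normr_gt0 subr_eq0.
  rewrite -(ltr_pM2r yx0) -normrM mulrBl divfK ?subr_eq0//.
  by rewrite (le_lt_trans (Hd _ yx))// ltr_pM2r// ltr_pdivrMr// ltr_pMr// ltr1n.
- by rewrite eqxx.
Qed.

Lemma is_derive_unique f x l l' :
  is_derive x 1 f l -> is_derive x 1 f l' -> l = l'.
Proof. by move=> fl fl'; rewrite -(@derive_val _ _ _ _ _ _ _ fl) (@derive_val _ _ _ _ _ _ _ fl'). Qed.

Lemma is_derive1E f x l : is_derive x 1 f l -> derive1 f x = l.
Proof. by move=> fl; rewrite derive1E; exact: (@derive_val _ _ _ _ _ _ _ fl). Qed.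

Lemma derivable_is_derive1 f x : derivable f x 1 -> is_derive x 1 f (derive1 f x).
Proof. by move=> df; rewrite derive1E; exact: derivableP. Qed.

Lemma is_derive_near f g x l d : 0 < d ->
  (forall y, `|y - x| < d -> f y = g y) -> is_derive x 1 f l -> is_derive x 1 g l.
Proof.
move=> d0 fg /is_deriveP_eps H; apply/is_deriveP_eps => e e0.
have [d' d'0 Hd'] := H _ e0; exists (Num.min d d'); first by rewrite lt_min d0.
move=> y; rewrite lt_min => /andP[yd yd'].
by rewrite -fg// -fg ?subrr ?normr0//; exact: Hd'.
Qed.

Lemma der_cst (a : R) x : is_derive x 1 (fun=> a) 0.
Proof. exact: is_derive_cst. Qed.
Lemma der_id x : is_derive x 1 (fun y : R => y) 1.
Proof. exact: is_derive_id. Qed.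
Lemma der_add f g x a b : is_derive x 1 f a -> is_derive x 1 g b ->
  is_derive x 1 (fun y => f y + g y) (a + b).
Proof. by move=> *; exact: is_deriveD. Qed.
Lemma der_opp f x a : is_derive x 1 f a -> is_derive x 1 (fun y => - f y) (- a).
Proof. by move=> *; exact: is_deriveN. Qed.
Lemma der_mul f g x a b : is_derive x 1 f a -> is_derive x 1 g b ->
  is_derive x 1 (fun y => f y * g y) (a * g x + f x * b).
Proof.
move=> fa gb; have := @is_deriveM _ _ f g x 1 a b fa gb.
by rewrite /GRing.scale /= addrC (mulrC _ a).
Qed.
Lemma der_pow f x a n : is_derive x 1 f a ->
  is_derive x 1 (fun y => f y ^+ n) (n%:R * f x ^+ n.-1 * a).
Proof.
move=> fa; have := @is_deriveX _ _ f n x 1 a fa.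
by rewrite /GRing.scale /= exprfctE.
Qed.
Lemma der_comp f g x a b : is_derive (g x) 1 f a -> is_derive x 1 g b ->
  is_derive x 1 (fun y => f (g y)) (a * b).
Proof.
move=> fa gb; have := @is_derive1_comp _ f g x a b fa gb.
by [].
Qed.
Lemma der_inv f x a : f x != 0 -> is_derive x 1 f a ->
  is_derive x 1 (fun y => (f y)^-1) (- a / f x ^+ 2).
Proof.
move=> f0 fa; have := @is_deriveV _ f x a _ f0 fa.
by move=> H; apply: (is_derive_eq H); rewrite /GRing.scale /=; ring.
Qed.
Lemma der_sqrt f x a : 0 < f x -> is_derive x 1 f a ->
  is_derive x 1 (fun y => Num.sqrt (f y)) (a / (2 * Num.sqrt (f x))).
Proof.
move=> f0 fa; rewrite mulrC; apply: der_comp => //.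
exact: is_derive1_sqrt.
Qed.
Lemma der_expR f x a : is_derive x 1 f a ->
  is_derive x 1 (fun y => expR (f y)) (expR (f x) * a).
Proof. by move=> fa; apply: der_comp => //; exact: is_derive_expR. Qed.
Lemma der_cos f x a : is_derive x 1 f a ->
  is_derive x 1 (fun y => cos (f y)) (- sin (f x) * a).
Proof. by move=> fa; apply: der_comp => //; exact: is_derive_cos. Qed.
Lemma der_sin f x a : is_derive x 1 f a ->
  is_derive x 1 (fun y => sin (f y)) (cos (f x) * a).
Proof. by move=> fa; apply: der_comp => //; exact: is_derive_sin. Qed.

End EpsDelta.

(** The arithmetic tactics become slow in large contexts: [keep h1 h2] clears
    the hypotheses introduced after the marker [mark : True], except [h1] and
    [h2]. *)
Ltac clean_to_mark :=
  lazymatch goal with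
  | H : ?T |- _ => lazymatch T with
      | True => idtac
      | _ => first [clear H | revert H]; clean_to_mark end
  | _ => idtac end.
Tactic Notation "keep" hyp_list(hs) := revert hs; clean_to_mark; intros.
Tactic Notation "keep0" := clean_to_mark; intros.

Ltac der_step :=
  first [ eassumption | exact: der_cst | exact: der_id | eapply der_pow | eapply der_add
        | eapply der_opp | eapply der_mul | eapply der_sqrt | eapply der_expR
        | eapply der_cos | eapply der_sin | eapply der_inv ].
Ltac der := repeat der_step.

Section Ctn.
Context {R : realType}.
Implicit Types (f g : R -> R) (v : R).

(** Pointwise continuity under a name of its own, so that a tactic can follow
    the syntax of the function. *)
Definition ctn v f : Prop := {for v, continuous f}.

Lemma ctnP v f : ctn v f -> {for v, continuous f}. Proof. by []. Qed.
Lemma ctnC v (k : R) : ctn v (fun=> k). Proof. exact: cvg_cst. Qed.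
Lemma ctnI v : ctn v (fun y => y). Proof. exact: is_derive_continuous (der_id v). Qed.
Lemma ctnD v f g : ctn v f -> ctn v g -> ctn v (fun y => f y + g y).
Proof. by move=> cf cg; apply: continuousD. Qed.
Lemma ctnN v f : ctn v f -> ctn v (fun y => - f y).
Proof. by move=> cf; apply: continuousN. Qed.
Lemma ctnM v f g : ctn v f -> ctn v g -> ctn v (fun y => f y * g y).
Proof. by move=> cf cg; apply: continuousM. Qed.
Lemma ctnX v f n : ctn v f -> ctn v (fun y => f y ^+ n).
Proof.
move=> cf; apply: (@continuous_comp _ _ _ f (fun z => z ^+ n)) => //.
exact: exprn_continuous.
Qed.
Lemma ctn_comp v f g : ctn (g v) f -> ctn v g -> ctn v (fun y => f (g y)).
Proof. by move=> cf cg; apply: (@continuous_comp _ _ _ g f). Qed.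
Lemma ctnV v f : f v != 0 -> ctn v f -> ctn v (fun y => (f y)^-1).
Proof. by move=> f0 cf; apply: continuousV. Qed.
Lemma ctn_sqrt v f : ctn v f -> ctn v (fun y => Num.sqrt (f y)).
Proof. by move=> cf; apply: ctn_comp => //; exact: sqrt_continuous. Qed.
Lemma ctn_norm v f : ctn v f -> ctn v (fun y => `|f y|).
Proof. by move=> cf; apply: (@continuous_comp _ _ _ f Num.norm) => //; exact: norm_continuous. Qed.
Lemma ctn_max v f g : ctn v f -> ctn v g -> ctn v (fun y => Num.max (f y) (g y)).
Proof. by move=> cf cg; apply: continuous_max. Qed.
Lemma ctn_min v f g : ctn v f -> ctn v g -> ctn v (fun y => Num.min (f y) (g y)).
Proof. by move=> cf cg; apply: continuous_min. Qed.

End Ctn.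

(* the continuity facts not decided by syntax are looked up in the context or
   left as goals *)
Ltac ctn_step :=
  lazymatch goal with
  | |- ctn _ (fun _ => ?c) => exact: ctnC
  | |- ctn _ (fun y => y) => exact: ctnI
  | |- ctn _ (fun y => (@?a y + @?b y)%R) => apply: (@ctnD _ _ a b)
  | |- ctn _ (fun y => (- @?a y)%R) => apply: (@ctnN _ _ a)
  | |- ctn _ (fun y => (@?a y * @?b y)%R) => apply: (@ctnM _ _ a b)
  | |- ctn _ (fun y => (@?a y ^+ ?n)%R) => apply: (@ctnX _ _ a n)
  | |- ctn _ (fun y => Num.sqrt (@?a y)) => apply: (@ctn_sqrt _ _ a)
  | |- ctn _ (fun y => Num.norm (@?a y)) => apply: (@ctn_norm _ _ a)
  end.
Ltac cts := try apply: ctnP; repeat (cbv beta; first [eassumption | ctn_step]).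

Section RealCalculus.
Context {R : realType}.
Implicit Types (f g F : R -> R) (x l a b : R).

(** A limit of derivatives is a derivative, by the mean value theorem; this
    handles the turning point and the ends of a glued function. *)
Lemma is_derive_extend f g x d : 0 < d -> {for x, continuous f} ->
  {for x, continuous g} ->
  (forall y, 0 < `|y - x| < d -> is_derive y 1 f (g y)) ->
  is_derive x 1 f (g x).
Proof.
move=> d0 cf /continuousP_eps cg fg; apply/is_deriveP_eps => e e0.
have [d' d'0 Hd'] := cg _ e0; exists (Num.min d d'); first by rewrite lt_min d0.
move=> y; rewrite lt_min => /andP[yd yd'].
have mvt u v : u < v -> (forall z, u <= z <= v -> `|z - x| < d) ->
    (forall z, u < z < v -> z != x) ->
    exists2 z, u < z < v & f v - f u = g z * (v - u).
  move=> uv Hd0 Hx.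
  have H z : z \in `]u, v[ -> is_derive z 1 f (g z).
    rewrite in_itv/= => zuv; apply: fg.
    rewrite normr_gt0 subr_eq0 Hx//= Hd0//.
    by case/andP: zuv => *; rewrite !ltW.
  have c z : `|z - x| < d -> {for z, continuous f}.
    move=> zx; have [->//|zNx] := eqVneq z x.
    by apply: is_derive_continuous (fg z _); rewrite normr_gt0 subr_eq0 zNx.
  have [|z zuv E] := MVT uv H.
    apply: continuous_in_subspaceT => z; rewrite inE/= in_itv/= => zuv.
    by apply: c; exact: Hd0.
  by exists z => //; move: zuv; rewrite in_itv.
have [yx|xy|->] := ltgtP y x; last by rewrite !subrr mulr0 subrr normr0 mulr0.
- have [||z /andP[yz zx] E] := mvt _ _ yx.
  + by move=> z zyx; move: yd; rewrite !ltr_norml; lra.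
  + by move=> z /andP[_ zx]; rewrite lt_eqF.
  + rewrite (_ : _ - _ - _ = - ((g z - g x) * (x - y))); last first.
      by rewrite mulrBl -E; ring.
    rewrite normrN normrM distrC (distrC x) ler_wpM2r// distrC ltW//.
    by apply: Hd'; move: yd'; rewrite !ltr_norml; lra.
- have [||z /andP[xz zy] E] := mvt _ _ xy.
  + by move=> z zxy; move: yd; rewrite !ltr_norml; lra.
  + by move=> z /andP[xz _]; rewrite gt_eqF.
  + rewrite E -mulrBl normrM ler_wpM2r// ltW//.
    by apply: Hd'; move: yd'; rewrite !ltr_norml; lra.
Qed.

Lemma mvt_lin f f' a b : a < b ->
  (forall z, a <= z <= b -> {for z, continuous f}) ->
  (forall z, a < z < b -> is_derive z 1 f (f' z)) ->
  exists2 z, a < z < b & f b - f a = f' z * (b - a).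
Proof.
move=> ab cf df.
have H z : z \in `]a, b[ -> is_derive z 1 f (f' z).
  by rewrite in_itv/=; exact: df.
have [|z] := MVT ab H; last by rewrite in_itv/= => *; exists z.
by apply: continuous_in_subspaceT => z; rewrite inE/= in_itv/=; exact: cf.
Qed.

Lemma ivt_lt f a b v : a <= b -> (forall z, a <= z <= b -> {for z, continuous f}) ->
  f a <= v <= f b -> exists2 z, a <= z <= b & f z = v.
Proof.
move=> ab cf /andP[av vb].
have [||z] := @IVT _ f a b v ab.
- by apply: continuous_in_subspaceT => z; rewrite inE/= in_itv/=; exact: cf.
- by rewrite minEle maxEle (le_trans av vb) av vb.
- by rewrite in_itv/= => *; exists z.
Qed.

End RealCalculus.

Definition Rint {R : realType} (a b : R) (f : R -> R) : R :=
  (\int[lebesgue_measure]_(x in `[a, b]) f x)%R.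

Section Rint.
Context {R : realType}.
Implicit Types (f g F : R -> R) (x l a b : R).
Local Notation mu := (@lebesgue_measure R).

Definition cont_itv a b f := forall z, a <= z <= b -> {for z, continuous f}.

Lemma cont_itv_within a b f : cont_itv a b f -> {within `[a, b], continuous f}.
Proof.
by move=> cf; apply: continuous_in_subspaceT => z; rewrite inE/= in_itv/=; exact: cf.
Qed.

Lemma cont_itvS a b c d f : c <= a -> b <= d -> cont_itv c d f -> cont_itv a b f.
Proof. by move=> ca bd cf z zab; apply: cf; lra. Qed.

Lemma Rint_integrable a b f : cont_itv a b f -> mu.-integrable `[a, b] (EFin \o f).
Proof.
move=> cf; apply: continuous_compact_integrable; first exact: segment_compact.
exact: cont_itv_within.
Qed.

Lemma Rint_ext a b f g : (forall x, a <= x <= b -> f x = g x) ->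
  Rint a b f = Rint a b g.
Proof.
by move=> fg; apply: eq_Rintegral => x; rewrite inE/= in_itv/=; exact: fg.
Qed.

Lemma Rint_le a b f g : cont_itv a b f -> cont_itv a b g ->
  (forall x, a <= x <= b -> f x <= g x) -> Rint a b f <= Rint a b g.
Proof.
move=> cf cg fg; apply: le_Rintegral; [by []|exact: Rint_integrable..|].
by move=> x; rewrite /= in_itv/=; exact: fg.
Qed.

Lemma Rint_cst a b (C : R) : a <= b -> Rint a b (fun=> C) = C * (b - a).
Proof.
move=> ab; rewrite /Rint Rintegral_cst//= lebesgue_measure_itv/= lte_fin.
by case: ltgtP ab => //= ->; rewrite subrr.
Qed.

Lemma Rint_abs a b f C : a <= b -> cont_itv a b f ->
  (forall x, a <= x <= b -> `|f x| <= C) -> `|Rint a b f| <= C * (b - a).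
Proof.
move=> ab cf fC; rewrite ler_norml -mulNr -!Rint_cst//.
have c (D : R) : cont_itv a b (fun=> D) by move=> z _; exact: cvg_cst.
by apply/andP; split; apply: Rint_le => // x /fC; rewrite ler_norml => /andP[].
Qed.

Lemma Rint_ge0 a b f : (forall x, a <= x <= b -> 0 <= f x) -> 0 <= Rint a b f.
Proof. by move=> f0; apply: Rintegral_ge0 => x /=; rewrite in_itv/=; exact: f0. Qed.

Lemma Rint_B a b f g : cont_itv a b f -> cont_itv a b g ->
  Rint a b (fun x => f x - g x) = Rint a b f - Rint a b g.
Proof. by move=> cf cg; apply: RintegralB => //; exact: Rint_integrable. Qed.

Lemma Rint_D a b f g : cont_itv a b f -> cont_itv a b g ->
  Rint a b (fun x => f x + g x) = Rint a b f + Rint a b g.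
Proof. by move=> cf cg; apply: RintegralD => //; exact: Rint_integrable. Qed.

Lemma Rint_Z a b (k : R) f : cont_itv a b f ->
  Rint a b (fun x => k * f x) = k * Rint a b f.
Proof. by move=> cf; apply: RintegralZl => //; exact: Rint_integrable. Qed.

Lemma Rint_point a f : Rint a a f = 0.
Proof. by rewrite /Rint set_itv1 Rintegral_set1. Qed.

Lemma Rint_split a c b f : a <= c -> c <= b -> cont_itv a b f ->
  Rint a b f = Rint a c f + Rint c b f.
Proof.
move=> ac cb cf; have fab := Rint_integrable cf.
have := @Rintegral_itvB _ f (BLeft a) (BRight b) c fab.
rewrite !bnd_simp => /(_ ac cb) E.
have E' : Rint c b f = (\int[mu]_(x in `]c, b]) f x)%R.
  rewrite Rintegral_itv_obnd_cbnd//.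
  apply: (integrableS _ _ _ fab) => //.
  by apply: subset_itvScc; rewrite bnd_simp.
by rewrite E' -E /Rint; ring.
Qed.

Lemma Rint_FTC1 a u x f : a < x -> x < u -> cont_itv a u f ->
  is_derive x 1 (fun y => Rint a y f) (f x).
Proof.
move=> ax xu cf.
have [] := @continuous_FTC1_closed _ f a x u xu (Rint_integrable cf) ax.
  by apply: cf; lra.
by move=> d <-; exact: derivable_is_derive1.
Qed.

Lemma Rint_FTC2 a b f F : a < b -> cont_itv a b f -> cont_itv a b F ->
  (forall z, a < z < b -> is_derive z 1 F (f z)) -> Rint a b f = F b - F a.
Proof.
move=> ab cf cF dF; rewrite /Rint /Rintegral.
rewrite (@continuous_FTC2 _ f F a b ab) //=.
- exact: cont_itv_within.
- split.
  + by move=> z; rewrite in_itv/= => zab; case: (dF z zab).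
  + by apply: cvg_at_right_filter; apply: cF; lra.
  + by apply: cvg_at_left_filter; apply: cF; lra.
- by move=> z; rewrite in_itv/= => zab; exact: is_derive1E (dF z zab).
Qed.

Lemma Rint_gt0 a b f : a < b -> cont_itv a b f ->
  (forall x, a < x < b -> 0 < f x) -> 0 < Rint a b f.
Proof.
move=> ab cf f0.
pose c := (a + 2 * b) / 3; pose d := (2 * a + b) / 3.
have [ad dc cb] : [/\ a < d, d < c & c < b] by rewrite /c /d; split; lra.
have f0c x : a <= x <= b -> 0 <= f x.
  move=> xab; rewrite leNgt; apply/negP => fx0.
  have /continuousP_eps/(_ (- f x)) [|e e0 He] := cf x xab; first lra.
  have H y : a < y < b -> `|y - x| < e -> False.
    by move=> yab /He; have := f0 y yab; rewrite ltr_norml; lra.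
  have [xd|xd] := leP x d.
    pose y := Num.min (x + e / 2) c.
    have xc : x < c by lra.
    apply: (H y); rewrite ?ltr_norml /y minEle; case: ifPn; rewrite -?ltNge => ?; lra.
  pose y := Num.max (x - e / 2) d.
  apply: (H y); rewrite ?ltr_norml /y maxEle; case: ifPn; rewrite -?ltNge => ?; lra.
have sub p q : a <= p -> q <= b -> cont_itv p q f.
  by move=> ap qb; apply: cont_itvS cf.
have -> : Rint a b f = Rint a d f + Rint d b f.
  by apply: Rint_split => //; lra.
have -> : Rint d b f = Rint d c f + Rint c b f.
  by apply: Rint_split; [lra|lra|apply: sub; lra].
have h1 : 0 <= Rint a d f by apply: Rint_ge0 => x xx; apply: f0c; lra.
have h3 : 0 <= Rint c b f by apply: Rint_ge0 => x xx; apply: f0c; lra.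
have cdc : {within `[d, c], continuous f} by apply: cont_itv_within; apply: sub; lra.
have [m mI fm] := EVT_min (ltW dc) cdc.
suff : 0 < Rint d c f by lra.
apply: (@lt_le_trans _ _ (Rint d c (fun=> f m))).
  rewrite Rint_cst ?(ltW dc)// mulr_gt0 ?subr_gt0//.
  by apply: f0; move: mI; rewrite in_itv/=; lra.
apply: Rint_le; first by move=> z _; exact: cvg_cst.
  by apply: sub; lra.
by move=> x xI; apply: fm; rewrite in_itv.
Qed.

End Rint.

(** * Actions whose critical values are countable *)

Section Continuum.
Context {R : realType}.
Implicit Types (T S : set R) (g : R -> R).

(** Continuity relative to [T], spelled out because [T] is an interval of
    parameters that need not be open. *)
Definition rel_cont T g := forall x, T x -> forall e, 0 < e ->
  exists2 d, 0 < d & forall y, T y -> `|y - x| < d -> `|g y - g x| < e.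

Lemma rel_contS T T' g : T `<=` T' -> rel_cont T' g -> rel_cont T g.
Proof.
move=> TT' cg x Tx e e0; have [d d0 H] := cg _ (TT' _ Tx) _ e0.
by exists d => // y /TT'; exact: H.
Qed.

Lemma rel_cont_within (T : set R) g : rel_cont T g -> {within T, continuous g}.
Proof.
move=> cg; apply/subspace_continuousP => x Tx.
apply/cvgrPdist_lt => e e0; have [d d0 H] := cg x Tx e e0.
rewrite near_withinE; apply/nbhs_ballP; exists d => //= y.
by rewrite /ball/= distrC => yx Ty; rewrite distrC; exact: H.
Qed.

Lemma countable_itv_false S a b : countable S -> a < b -> `[a, b] `<=` S -> False.
Proof.
move=> cS ab abS.
have : countable [set` `[a, b]] by apply: sub_countable cS; exact: subset_card_le.
move=> /countable_lebesgue_measure0; rewrite lebesgue_measure_itv/= lte_fin ab.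
by move=> /eqP; rewrite -EFinD eqe subr_eq0 gt_eqF.
Qed.

(** The image of an interval under a continuous function is an interval, and
    a nondegenerate interval has positive measure. *)
Lemma countable_cont_const T S g : countable S -> is_interval T -> rel_cont T g ->
  (forall x, T x -> S (g x)) -> forall x y, T x -> T y -> g x = g y.
Proof.
move=> cS iT cg gS.
suff H x y : T x -> T y -> x < y -> g x = g y.
  by move=> x y Tx Ty; case: (ltgtP x y) => [|yx|->//]; [exact: H|exact/esym/H].
move=> Tx Ty xy; apply/eqP/negP => /negP gxy.
have TT : [set` `[x, y]] `<=` T.
  by move=> z /=; rewrite in_itv/=; exact: iT Tx Ty z.
have c := rel_cont_within (rel_contS TT cg).
apply: (@countable_itv_false S (Num.min (g x) (g y)) (Num.max (g x) (g y)) cS).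
  by rewrite minEle maxEle; case: ifPn => h; move: gxy; rewrite neq_lt; lra.
move=> v /=; rewrite in_itv/= => vI.
by have [z zI <-] := IVT (ltW xy) c vI; apply: gS; apply: TT.
Qed.

(** A locally constant property on an interval is constant: apply
    [countable_cont_const] to its indicator function. *)
Lemma interval_clopen T (P : R -> Prop) : is_interval T ->
  (forall x, T x -> exists2 d, 0 < d &
     forall y, T y -> `|y - x| < d -> (P x <-> P y)) ->
  forall x y, T x -> T y -> P x -> P y.
Proof.
move=> iT loc x y Tx Ty Px.
pose g z : R := if pselect (P z) then 1 else 0.
have /(_ x y Tx Ty) : forall x y, T x -> T y -> g x = g y.
  apply: (@countable_cont_const T [set 0; 1]) => //.
  - by apply: finite_set_countable; rewrite finite_setU; split; exact: finite_set1.
  - move=> u Tu e e0; have [d d0 H] := loc _ Tu; exists d => // v Tv vu.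
    have Puv := H v Tv vu; rewrite /g.
    case: pselect => [Pv|nPv]; case: pselect => [Pu|nPu] /=.
    + by rewrite subrr normr0.
    + by case: nPu; apply/Puv.
    + by case: nPv; apply/Puv.
    + by rewrite subrr normr0.
  - by move=> u Tu; rewrite /g; case: pselect => /=; [right|left].
rewrite /g; case: (pselect (P x)) => // Px'.
by case: (pselect (P y)) => // Py' /eqP; rewrite oner_eq0.
Qed.

End Continuum.

Section Legendre.
Context {R : realType}.
Variables (T : set R) (P1 P2 : R) (Phi alp : R -> R -> R).
Hypothesis T_itv : is_interval T.
Hypothesis dPhi : forall t p, T t -> P1 < p < P2 ->
  is_derive p 1 (Phi t) (- alp t p).
Hypothesis Phi_cont : forall t0, T t0 -> forall e, 0 < e ->
  exists2 d, 0 < d & forall t, T t -> `|t - t0| < d ->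
  forall p p', P1 < p < P2 -> P1 < p' < P2 ->
  `|(Phi t p - Phi t p') - (Phi t0 p - Phi t0 p')| < e.
Hypothesis crit : forall x y, x < y -> exists2 q, x < q < y &
  exists2 S, countable S & forall t p, T t -> P1 < p < P2 -> alp t p = q ->
  S (Phi t p + q * p).

Let good q := exists2 S, countable S & forall t p, T t -> P1 < p < P2 ->
  alp t p = q -> S (Phi t p + q * p).

Section Argmax.
Variables (t0 k1 l1 l2 k2 : R).
Hypothesis Tt0 : T t0.
Hypothesis ord : [/\ P1 < k1, k1 < l1, l1 < l2, l2 < k2 & k2 < P2].
Hypothesis ca : forall p, k1 <= p <= k2 -> {for p, continuous (alp t0)}.
Hypothesis amono : forall p p', k1 <= p -> p < p' -> p' <= k2 ->
  alp t0 p < alp t0 p'.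

Definition slope_range q := alp t0 l1 <= q <= alp t0 l2.

(** [pm q t] is a maximizer of [p |-> Phi t p + q p] over [[k1, k2]], with the
    extra information that it is interior, hence a critical point. *)
Definition argmax d (pm : R -> R -> R) := forall q t,
  slope_range q -> T t -> `|t - t0| < d ->
  [/\ k1 < pm q t < k2,
      forall p, k1 <= p <= k2 -> Phi t p + q * p <= Phi t (pm q t) + q * pm q t &
      alp t (pm q t) = q].

(** At [t0] the slope [alp t0] is increasing, so for [q] between [alp t0 l1] and
    [alp t0 l2] the values at the ends [k1] and [k2] are smaller than those at
    [l1] and [l2] by fixed amounts; this persists for [t] near [t0]. *)
Lemma argmax_exists : exists2 d, 0 < d & exists pm, argmax d pm.
Proof.
have mark := I.
have [Pk1 kl1 l12 lk2 k2P] := ord.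
have Phic t p : T t -> P1 < p < P2 -> {for p, continuous (Phi t)}.
  by move=> Tt pP; exact: is_derive_continuous (dPhi Tt pP).
have mvt t a b : T t -> P1 < a -> a < b -> b < P2 ->
    exists2 z, a < z < b & Phi t b - Phi t a = - alp t z * (b - a).
  move=> Tt aP ab bP; apply: mvt_lin => // z zab; first by apply: Phic => //; lra.
  by apply: dPhi => //; lra.
have : 0 < Phi t0 l1 - Phi t0 k1 + alp t0 l1 * (l1 - k1).
  have [|z z1 ->] := mvt t0 k1 l1 Tt0 Pk1 kl1; first lra.
  have h : alp t0 z < alp t0 l1 by apply: amono; lra.
  by rewrite -mulrDl mulr_gt0//; lra.
move d1E : (Phi t0 l1 - _ + _) => d1 d1_gt0.
have : 0 < Phi t0 l2 - Phi t0 k2 - alp t0 l2 * (k2 - l2).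
  have [||z z1 E] := mvt t0 l2 k2 Tt0 _ lk2; [lra|lra|].
  have -> : Phi t0 l2 - Phi t0 k2 = alp t0 z * (k2 - l2) by move: E; lra.
  have h : alp t0 l2 < alp t0 z by apply: amono; lra.
  by rewrite -mulrBl mulr_gt0//; lra.
move d2E : (Phi t0 l2 - _ - _) => d2 d2_gt0.
have [d d0 Hd] := @Phi_cont t0 Tt0 (Num.min d1 d2) ltac:(by rewrite lt_min d1_gt0).
exists d => //.
suff H q t : slope_range q -> T t -> `|t - t0| < d -> exists z,
  [/\ k1 < z < k2,
      forall p, k1 <= p <= k2 -> Phi t p + q * p <= Phi t z + q * z &
      alp t z = q].
  exists (fun q t => get [set z | [/\ k1 < z < k2,
      forall p, k1 <= p <= k2 -> Phi t p + q * p <= Phi t z + q * z &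
      alp t z = q]]) => q t qr Tt td.
  exact: (getPex (H q t qr Tt td)).
move=> /andP[q1 q2] Tt tt0.
have H1 := Hd t Tt tt0 l1 k1 ltac:(lra) ltac:(lra).
have H2 := Hd t Tt tt0 l2 k2 ltac:(lra) ltac:(lra).
have G1 : Phi t k1 + q * k1 < Phi t l1 + q * l1.
  have h : alp t0 l1 * (l1 - k1) <= q * (l1 - k1) by rewrite ler_wpM2r//; lra.
  move: H1 h; rewrite lt_min !ltr_norml -d1E => /andP[h1 _] h2; keep h1 h2.
  by lra.
have G2 : Phi t k2 + q * k2 < Phi t l2 + q * l2.
  have h : q * (k2 - l2) <= alp t0 l2 * (k2 - l2) by rewrite ler_wpM2r//; lra.
  move: H2 h; rewrite lt_min !ltr_norml -d2E => /andP[_ h1] h2; keep h1 h2.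
  by lra.
clear d1 d2 d1_gt0 d2_gt0 d1E d2E d d0 Hd tt0 H1 H2.
have dF p : P1 < p < P2 -> is_derive p 1 (fun p => Phi t p + q * p) (q - alp t p).
  move=> pP; eapply is_derive_eq; first by eapply der_add; [exact: dPhi|der].
  by rewrite /=; ring.
have k12 : k1 <= k2 by lra.
have cF : cont_itv k1 k2 (fun p => Phi t p + q * p).
  by move=> z zk; apply: (is_derive_continuous (dF z _)); lra.
have [z zI Fz] := EVT_max k12 (cont_itv_within cF).
have Fz' p : k1 <= p <= k2 -> Phi t p + q * p <= Phi t z + q * z.
  by move=> pk; apply: Fz; rewrite in_itv.
have F1 := Fz' l1 ltac:(lra); have F2 := Fz' l2 ltac:(lra).
have zk : k1 < z < k2.
  move: zI; rewrite in_itv/= !le_eqVlt.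
  move=> /andP[/predU1P[zk|->] /predU1P[zk'|->]] //.
  - by move: G1 F1; rewrite zk; keep0; lra.
  - by move: G1 F1; rewrite zk; keep0; lra.
  - by move: G2 F2; rewrite zk'; keep0; lra.
exists z; split => //.
have D : is_derive z 1 (fun p => Phi t p + q * p) 0.
  apply: (@derive1_at_max _ _ k1 k2 z) => //.
  - by move=> p; rewrite in_itv/= => pI; case: (dF p ltac:(lra)).
  - by move=> p; rewrite in_itv/= => pI; apply: Fz'; lra.
by have := is_derive_unique D (dF z ltac:(lra)); lra.
Qed.

Section FixedArgmax.
Variables (d : R) (pm : R -> R -> R).
Hypotheses (d_gt0 : 0 < d) (pmP : argmax d pm).

Definition legmax q t := Phi t (pm q t) + q * pm q t.

(** The difference of two Legendre transforms is continuous in [t] and takes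
    values in a difference of countable sets.  The difference is taken because
    [Phi t] is only known to be continuous in [t] up to a constant. *)
Lemma legmax_const q q' t : slope_range q -> slope_range q' -> good q -> good q' ->
  T t -> `|t - t0| < d -> legmax q t - legmax q' t = legmax q t0 - legmax q' t0.
Proof.
have mark := I.
have [Pk1 kl1 l12 lk2 k2P] := ord.
move=> iq iq' [S cS HS] [S' cS' HS'] Tt tt0.
pose U := [set t | T t /\ `|t - t0| < d].
have Ut0 : U t0 by split => //; rewrite subrr normr0.
have Uint : is_interval U.
  move=> x y [Tx xt] [Ty yt] z xzy; split; first exact: T_itv Tx Ty z xzy.
  by move: xt yt; rewrite !ltr_norml; keep xzy; lra.
have MS q'' t' (S'' : set R) : (forall t p, T t -> P1 < p < P2 -> alp t p = q'' ->
    S'' (Phi t p + q'' * p)) -> slope_range q'' -> U t' -> S'' (legmax q'' t').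
  move=> H iq'' [Tt' tt']; have [h1 h2 h3] := pmP iq'' Tt' tt'.
  by apply: H => //; keep h1 Pk1 k2P; lra.
apply: (@countable_cont_const _ U ((fun z : R * R => z.1 - z.2) @` (S `*` S'))
  (fun t => legmax q t - legmax q' t)) => //.
- exact: (sub_countable (card_image_le _ _) (countableX cS cS')).
- move=> t1 [Tt1 tt1] e e0; have e20 : 0 < e / 2 by rewrite divr_gt0.
  have [d' d'0 Hd'] := Phi_cont Tt1 e20; exists d' => // t2 [Tt2 tt2] t21.
  have near1 q'' : slope_range q'' ->
      `|(legmax q'' t2 - Phi t2 k1) - (legmax q'' t1 - Phi t1 k1)| < e / 2.
    move=> iq''.
    have [z2 M2 _] := pmP iq'' Tt2 tt2.
    have [z1 M1 _] := pmP iq'' Tt1 tt1.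
    have k1P : P1 < k1 < P2 by keep Pk1 kl1 l12 lk2 k2P; lra.
    have A2 := M1 (pm q'' t2) ltac:(keep z2; lra).
    have A1 := M2 (pm q'' t1) ltac:(keep z1; lra).
    have B1 := Hd' t2 Tt2 t21 (pm q'' t1) k1 ltac:(keep z1 Pk1 k2P; lra) k1P.
    have B2 := Hd' t2 Tt2 t21 (pm q'' t2) k1 ltac:(keep z2 Pk1 k2P; lra) k1P.
    move: A1 A2 B1 B2; rewrite !ltr_norml /legmax; keep0; lra.
  have := near1 q iq; have := near1 q' iq'; rewrite !ltr_norml; keep0; lra.
- move=> t1 Ut1; exists (legmax q t1, legmax q' t1) => //; split => /=; exact: MS.
Qed.

Lemma slope_rangeP p : l1 <= p <= l2 -> slope_range (alp t0 p).
Proof.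
have mark := I.
have [Pk1 kl1 l12 lk2 k2P] := ord.
move=> pl; rewrite /slope_range; apply/andP; split.
  have [->//|pn] := eqVneq l1 p; apply/ltW/amono; first exact: ltW.
    by rewrite lt_neqAle pn; case/andP: pl.
  by keep pl lk2; lra.
have [->//|pn] := eqVneq p l2; apply/ltW/amono; last exact: ltW.
  by keep pl kl1; lra.
by rewrite lt_neqAle pn; case/andP: pl.
Qed.

Lemma alp_inv q : slope_range q -> exists2 p, l1 <= p <= l2 & alp t0 p = q.
Proof.
have mark := I.
have [Pk1 kl1 l12 lk2 k2P] := ord.
move=> iq; apply: ivt_lt => //; first exact: ltW.
by move=> z zl; apply: ca; keep zl kl1 lk2; lra.
Qed.

Lemma alp_lt_inv p p' : k1 <= p <= k2 -> k1 <= p' <= k2 ->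
  alp t0 p < alp t0 p' -> p < p'.
Proof.
have mark := I.
have [Pk1 kl1 l12 lk2 k2P] := ord.
move=> /andP[p1 p2] /andP[p'1 p'2] h; rewrite ltNge le_eqVlt.
apply/negP => /predU1P[pp'|p'p]; first by move: h; rewrite pp' ltxx.
by have := lt_trans h (amono p'1 p'p p2); rewrite ltxx.
Qed.

Lemma argmax_t0 p : l1 <= p <= l2 -> pm (alp t0 p) t0 = p.
Proof.
have mark := I.
have [Pk1 kl1 l12 lk2 k2P] := ord.
move=> pl; have iq := slope_rangeP pl.
have tt : `|t0 - t0| < d by rewrite subrr normr0.
have [zI _ E] := pmP iq Tt0 tt.
have pk : k1 <= p <= k2 by keep pl kl1 lk2; lra.
case: (ltgtP (pm (alp t0 p) t0) p) => // h.
  have h1 : k1 <= pm (alp t0 p) t0 by apply: ltW; case/andP: zI.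
  by case/andP: pk => _ /(amono h1 h); rewrite E ltxx.
have h1 : pm (alp t0 p) t0 <= k2 by apply: ltW; case/andP: zI.
by case/andP: pk => k1p _; have := amono k1p h h1; rewrite E ltxx.
Qed.

(** The Legendre transform at [t] is, up to a constant, that at [t0]; so [pm q t]
    is a subgradient of the latter at the good slope [q]. *)
Lemma argmax_slope p q' t : l1 < p < l2 -> good (alp t0 p) ->
  slope_range q' -> good q' -> T t -> `|t - t0| < d ->
  (q' - alp t0 p) * pm (alp t0 p) t <= (q' - alp t0 p) * pm q' t0.
Proof.
have mark := I.
have [Pk1 kl1 l12 lk2 k2P] := ord.
move=> pl gp iq' gq' Tt tt0; set q := alp t0 p.
have iq : slope_range q by apply: slope_rangeP; keep pl; lra.
have t00 : `|t0 - t0| < d by rewrite subrr normr0.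
have [z1 _ _] := pmP iq Tt tt0.
have [_ M1 _] := pmP iq' Tt tt0.
have [z2 _ _] := pmP iq' Tt0 t00.
have [_ M2 _] := pmP iq Tt0 t00.
have h1 := M1 (pm q t) ltac:(keep z1; lra).
have h2 := M2 (pm q' t0) ltac:(keep z2; lra).
have h3 := legmax_const iq iq' gp gq' Tt tt0.
move: h1 h2 h3; rewrite /legmax; keep0; lra.
Qed.

(** The inequality [argmax_slope] for good slopes [q'] on both sides of
    [alp t0 p] squeezes the maximizer, because the good slopes are dense and the
    maximizer at [t0] is the inverse function of [alp t0]. *)
Lemma argmaxE p t : l1 < p < l2 -> good (alp t0 p) -> T t -> `|t - t0| < d ->
  pm (alp t0 p) t = p.
Proof.
have mark := I.
have [Pk1 kl1 l12 lk2 k2P] := ord.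
move=> pl gp Tt tt0; set q := alp t0 p.
have pl' : l1 <= p <= l2 by keep pl; lra.
have iq : slope_range q := slope_rangeP pl'.
have [z1 _ _] := pmP iq Tt tt0.
have slope := fun q' => @argmax_slope p q' t pl gp.
have key p' : l1 <= p' <= l2 -> good (alp t0 p') ->
    (alp t0 p' - q) * (pm q t - p') <= 0.
  move=> pl2 gp'; have := slope _ (slope_rangeP pl2) gp' Tt tt0.
  by rewrite (argmax_t0 pl2) -subr_le0 -mulrBr.
have inner y p' : l1 <= y <= l2 -> l1 <= p' <= l2 -> alp t0 y < alp t0 p' -> y < p'.
  by move=> yl p'l; apply: alp_lt_inv; [keep yl kl1 lk2|keep p'l kl1 lk2]; lra.
have [h|h|//] := ltgtP (pm q t) p.
  have [y [y1 y2 y3]] : exists y, [/\ y < p, l1 <= y & pm q t <= y].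
    exists (Num.max (pm q t) l1); keep h pl.
    rewrite maxEle; case: ifPn; rewrite -?ltNge => ?; split; lra.
  have yl : l1 <= y <= l2 by keep y1 y2 pl'; lra.
  have yp : alp t0 y < alp t0 p by apply: amono => //; keep y2 pl' kl1 lk2; lra.
  have [q' /andP[q'1 q'2] gq'] := crit yp.
  have [|p' p'l E] := @alp_inv q'.
    by have := slope_rangeP yl; have := iq; rewrite /slope_range /q; keep q'1 q'2; lra.
  have := key p' p'l; rewrite E => /(_ gq').
  have : y < p' by apply: inner => //; rewrite E.
  keep q'2 y3; rewrite -/q in q'2 *; nra.
have [y [y1 y2 y3]] : exists y, [/\ p < y, y <= l2 & y <= pm q t].
  exists (Num.min (pm q t) l2); keep h pl.
  rewrite minEle; case: ifPn; rewrite -?ltNge => ?; split; lra.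
have yl : l1 <= y <= l2 by keep y1 y2 pl'; lra.
have yp : alp t0 p < alp t0 y by apply: amono => //; keep y2 pl' kl1 lk2; lra.
have [q' /andP[q'1 q'2] gq'] := crit yp.
have [|p' p'l E] := @alp_inv q'.
  by have := slope_rangeP yl; have := iq; rewrite /slope_range /q; keep q'1 q'2; lra.
have := key p' p'l; rewrite E => /(_ gq').
have : p' < y by apply: inner => //; rewrite E.
keep q'1 y3; rewrite -/q in q'1 *; nra.
Qed.

(** For good slopes the maximizers at [t] and [t0] agree, so [legmax_const]
    compares [Phi t] and [Phi t0] on a dense set of momenta. *)
Lemma static_of_argmax t : T t -> `|t - t0| < d ->
  forall p p', l1 <= p <= l2 -> l1 <= p' <= l2 ->
  Phi t p - Phi t p' = Phi t0 p - Phi t0 p'.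
Proof.
have mark := I.
have [Pk1 kl1 l12 lk2 k2P] := ord.
move=> Tt tt0.
have kl a b : l1 <= a -> a < b -> b <= l2 -> alp t0 a < alp t0 b.
  by move=> la ab bl; apply: amono => //; [keep la kl1|keep bl lk2]; lra.
have [q0 q0I gq0] := crit (kl _ _ (lexx _) l12 (lexx _)).
have iq0 : slope_range q0 by rewrite /slope_range; keep q0I; lra.
pose C := legmax q0 t - legmax q0 t0.
have goodE p : l1 < p < l2 -> good (alp t0 p) -> Phi t p - Phi t0 p = C.
  move=> pl gp; have pl' : l1 <= p <= l2 by keep pl; lra.
  have := legmax_const (slope_rangeP pl') iq0 gp gq0 Tt tt0.
  rewrite /C {1 3}/legmax (argmaxE pl gp Tt tt0) (argmax_t0 pl'); keep0; lra.
have allE p : l1 <= p <= l2 -> Phi t p - Phi t0 p = C.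
  move=> pl; apply/eqP/negP => /negP ne.
  have e0 : 0 < `|Phi t p - Phi t0 p - C| by rewrite normr_gt0 subr_eq0.
  have pP : P1 < p < P2 by keep pl Pk1 kl1 lk2 k2P; lra.
  have cD : {for p, continuous (fun p => Phi t p - Phi t0 p)}.
    by apply: continuousB; exact: is_derive_continuous (dPhi _ pP).
  have [d' d'0 Hd'] := (continuousP_eps _ _).1 cD _ e0.
  have [a [b [ab al bl]]] : exists a b, [/\ a < b, l1 <= a /\ p - d' / 2 <= a &
      b <= l2 /\ b <= p + d' / 2].
    exists (Num.max l1 (p - d' / 2)), (Num.min l2 (p + d' / 2)).
    keep d'0 pl l12.
    rewrite maxEle minEle; do 2 case: ifPn; rewrite -?ltNge => ? ?; split; lra.
  have [q' /andP[q'1 q'2] gq'] := crit (kl _ _ al.1 ab bl.1).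
  have al' : l1 <= a <= l2 by keep al bl ab; lra.
  have bl' : l1 <= b <= l2 by keep al bl ab; lra.
  have [|p' p'l E] := @alp_inv q'.
    by have := slope_rangeP al'; have := slope_rangeP bl'; rewrite /slope_range; keep q'1 q'2; lra.
  have lk z : l1 <= z <= l2 -> k1 <= z <= k2 by keep kl1 lk2; lra.
  have ap' : a < p' by apply: alp_lt_inv; rewrite ?E//; exact: lk.
  have bp' : p' < b by apply: alp_lt_inv; rewrite ?E//; exact: lk.
  have gE : Phi t p' - Phi t0 p' = C.
    by apply: goodE; [keep ap' bp' al bl; lra|rewrite E].
  have pp' : `|p' - p| < d' by rewrite ltr_norml; keep ap' bp' al bl d'0; lra.
  by have := Hd' p' pp'; rewrite gE distrC ltxx.
by move=> p p' pl pl'; have := allE p pl; have := allE p' pl'; keep0; lra.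
Qed.

End FixedArgmax.

Lemma legendre_static : exists2 d, 0 < d & forall t, T t -> `|t - t0| < d ->
  forall p p', l1 <= p <= l2 -> l1 <= p' <= l2 ->
  Phi t p - Phi t p' = Phi t0 p - Phi t0 p'.
Proof.
have mark := I.
have [Pk1 kl1 l12 lk2 k2P] := ord.
have [d d0 [pm pmP]] := argmax_exists.
by exists d => // t; exact: static_of_argmax d0 pmP t.
Qed.

End Argmax.

End Legendre.

Section Rigidity.
Context {R : realType}.
Variables (T : set R) (P1 P2 : R).
Hypothesis T_itv : is_interval T.

(** [Phi t] stands for the action of the profile at time [t] and [alp t] for the
    opening angle.  The last condition says that the critical values of
    [Phi t p + q p] lie in a countable set independent of [t], for a dense set
    of slopes [q]. *)
Definition slope_family (Phi alp dalp : R -> R -> R) :=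
  [/\ forall t p, T t -> P1 < p < P2 -> is_derive p 1 (Phi t) (- alp t p),
      forall t p, T t -> P1 < p < P2 -> is_derive p 1 (alp t) (dalp t p),
      forall t p, T t -> P1 < p < P2 -> {for p, continuous (dalp t)},
      forall t0, T t0 -> forall e, 0 < e ->
        exists2 d, 0 < d & forall t, T t -> `|t - t0| < d ->
        forall p p', P1 < p < P2 -> P1 < p' < P2 ->
        `|(Phi t p - Phi t p') - (Phi t0 p - Phi t0 p')| < e &
      forall x y, x < y -> exists2 q, x < q < y &
        exists2 S, countable S & forall t p, T t -> P1 < p < P2 ->
        alp t p = q -> S (Phi t p + q * p)].

Lemma slope_familyN Phi alp dalp : slope_family Phi alp dalp ->
  slope_family (fun t p => - Phi t p) (fun t p => - alp t p) (fun t p => - dalp t p).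
Proof.
move=> [h1 h2 h3 h4 h5]; split.
- by move=> t p Tt pP; apply: der_opp; exact: h1.
- by move=> t p Tt pP; apply: der_opp; exact: h2.
- by move=> t p Tt pP; apply: continuousN; exact: h3.
- move=> t0 Tt0 e e0; have [d d0 H] := h4 t0 Tt0 e e0; exists d => //.
  move=> t Tt tt0 p p' pP pP'; have := H t Tt tt0 p p' pP pP'.
  by rewrite !ltr_norml; lra.
- move=> x y xy; have [q qxy [S cS HS]] := h5 (- y) (- x) ltac:(lra).
  exists (- q); first lra.
  exists (-%R @` S); first exact: (sub_countable (card_image_le _ _) cS).
  move=> t p Tt pP E; exists (Phi t p + q * p); last by ring.
  by apply: HS => //; move: E; lra.
Qed.

(** Where [alp t0] is increasing, [legendre_static] applies at [t0].  The set of
    [t] for which [Phi t - Phi t0] is constant on [[a, b]] is closed by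
    continuity, and open because the slope is again increasing at each of its
    points. *)
Lemma static_pos Phi alp dalp : slope_family Phi alp dalp ->
  forall t0 a b, T t0 -> P1 < a -> a < b -> b < P2 ->
  (forall p, a <= p <= b -> 0 < dalp t0 p) ->
  forall t, T t -> forall p, a < p < b -> alp t p = alp t0 p.
Proof.
have mark := I.
move=> [h1 h2 h3 h4 h5] t0 a b Tt0 Pa ab bP dpos.
pose P t := forall p p', a <= p <= b -> a <= p' <= b ->
  Phi t p - Phi t p' = Phi t0 p - Phi t0 p'.
have alpE t p : T t -> P t -> a < p < b -> alp t p = alp t0 p.
  move=> Tt Pt pab.
  have pP : P1 < p < P2 by keep pab Pa bP; lra.
  have D := h1 t p Tt pP.
  have D0 := h1 t0 p Tt0 pP.
  have D' : is_derive p 1 (Phi t) (- alp t0 p).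
    apply: (@is_derive_near _ (fun y => Phi t0 y + (Phi t a - Phi t0 a)) _ _ _
      (Num.min (p - a) (b - p))).
    - by rewrite lt_min; keep pab; lra.
    - move=> y; rewrite lt_min !ltr_norml => yI.
      have := Pt y a ltac:(keep yI; lra) ltac:(keep ab; lra).
      by keep0; lra.
    - by eapply is_derive_eq; [der|rewrite addr0].
  by have := is_derive_unique D D'; keep0; lra.
have dalpE t p : T t -> P t -> a < p < b -> dalp t p = dalp t0 p.
  move=> Tt Pt pab; apply: (@is_derive_unique _ (alp t) p); first by apply: h2 => //; keep pab Pa bP; lra.
  apply: (@is_derive_near _ (alp t0) _ _ _ (Num.min (p - a) (b - p))).
  - by rewrite lt_min; keep pab; lra.
  - by move=> y; rewrite lt_min !ltr_norml => yI; rewrite alpE//; keep yI; lra.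
  - by apply: h2 => //; keep pab Pa bP; lra.
have dpos_end t c : T t -> P t -> a <= c <= b -> 0 < dalp t c.
  move=> Tt Pt cab; rewrite ltNge; apply/negP => le0.
  have c0 := dpos c cab.
  have cP : P1 < c < P2 by keep cab Pa bP; lra.
  have [d d0 Hd] := (continuousP_eps _ _).1 (h3 t0 c Tt0 cP) _
    (ltac:(by apply: divr_gt0; [exact: c0|]) : 0 < dalp t0 c / 2).
  have [d' d'0 Hd'] := (continuousP_eps _ _).1 (h3 t c Tt cP) _
    (ltac:(by apply: divr_gt0; [exact: c0|]) : 0 < dalp t0 c / 2).
  have [y yab /andP[yd yd']] : exists2 y, a < y < b & (`|y - c| < d) && (`|y - c| < d').
    have [m [m0 md md' mab]] : exists m, [/\ 0 < m, m <= d, m <= d' & m <= b - a].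
      exists (Num.min (Num.min d d') (b - a)).
      split; first by rewrite !lt_min d0 d'0; keep ab; lra.
      - by rewrite !ge_min lexx.
      - by rewrite !ge_min lexx orbT.
      - by rewrite !ge_min lexx !orbT.
    have [cm|cm] := leP c ((a + b) / 2).
      by exists (c + m / 3); rewrite ?ltr_norml; keep m0 md md' mab cm cab; lra.
    by exists (c - m / 3); rewrite ?ltr_norml; keep m0 md md' mab cm cab; lra.
  have := Hd y yd; have := Hd' y yd'; rewrite (dalpE t y)// !ltr_norml.
  by keep c0 le0; lra.
suff Pall t : T t -> P t by move=> t Tt p pab; apply: alpE => //; exact: Pall.
move=> Tt; apply: (@interval_clopen _ T P T_itv _ t0 t) => //.
move=> x Tx; have [Px|nPx] := pselect (P x).
  have ca p : P1 < p < P2 -> {for p, continuous (alp x)}.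
    by move=> pP; apply: is_derive_continuous (h2 x p Tx pP).
  have aI : a <= a <= b by keep ab; lra.
  have bI : a <= b <= b by keep ab; lra.
  have aP : P1 < a < P2 by keep Pa ab bP; lra.
  have bP' : P1 < b < P2 by keep Pa ab bP; lra.
  have [da da0 Hda] := (continuousP_eps _ _).1 (h3 x a Tx aP) _ (dpos_end x a Tx Px aI).
  have [db db0 Hdb] := (continuousP_eps _ _).1 (h3 x b Tx bP') _ (dpos_end x b Tx Px bI).
  have [k1 [k11 k12 k13]] : exists k1, [/\ P1 < k1, k1 < a & a - da < k1].
    exists (Num.max ((P1 + a) / 2) (a - da / 2)); keep aP da0.
    by rewrite maxEle; case: ifPn; rewrite -?ltNge => ?; split; lra.
  have [k2 [k21 k22 k23]] : exists k2, [/\ k2 < P2, b < k2 & k2 < b + db].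
    exists (Num.min ((P2 + b) / 2) (b + db / 2)); keep bP' db0.
    by rewrite minEle; case: ifPn; rewrite -?ltNge => ?; split; lra.
  have kpos p : k1 <= p <= k2 -> 0 < dalp x p.
    move=> pk; have [pa|pa] := ltP p a.
      by have := Hda p; rewrite !ltr_norml; keep pa pk k13 da0; lra.
    have [pb|pb] := ltP b p.
      by have := Hdb p; rewrite !ltr_norml; keep pb pk k23 db0; lra.
    by apply: dpos_end => //; keep pa pb; lra.
  have amono p p' : k1 <= p -> p < p' -> p' <= k2 -> alp x p < alp x p'.
    move=> kp pp' p'k.
    have [|z|z zI E] := @mvt_lin _ (alp x) (dalp x) p p' pp'.
    - by move=> z zI; apply: ca; keep zI kp p'k k11 k21; lra.
    - by move=> zI; apply: h2 => //; keep zI kp p'k k11 k21; lra.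
    - have dz := kpos z ltac:(keep zI kp p'k; lra).
      by rewrite -subr_gt0 E mulr_gt0// subr_gt0.
  have ck p : k1 <= p <= k2 -> {for p, continuous (alp x)}.
    by move=> pk; apply: ca; keep pk k11 k21; lra.
  have [d d0 Hd] := legendre_static T_itv h1 h4 h5 Tx
    (And5 k11 k12 ab k22 k21) ck amono.
  exists d => // y Ty yx; split => // _ p p' pab p'ab.
  by rewrite (Hd y Ty yx p p')//; exact: Px.
have [p [p' [pab p'ab ne]]] : exists p p', [/\ a <= p <= b, a <= p' <= b &
    Phi x p - Phi x p' != Phi t0 p - Phi t0 p'].
  apply: contrapT => H; apply: nPx => p p' pab p'ab.
  by apply/eqP/negP => /negP ne; apply: H; exists p, p'.
have e0 : 0 < `|(Phi x p - Phi x p') - (Phi t0 p - Phi t0 p')|.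
  by rewrite normr_gt0 subr_eq0.
have [d d0 Hd] := h4 x Tx _ e0.
exists d => // y Ty yx; split=> // Py.
have := Hd y Ty yx p p' ltac:(keep pab Pa bP; lra) ltac:(keep p'ab Pa bP; lra).
by rewrite (Py p p')// distrC ltxx.
Qed.

(** The momenta at which [alp t0] has nonzero derivative are dense, and there
    the sign of the derivative reduces to [static_pos] for the family or its
    opposite. *)
Lemma slope_rigidity Phi alp dalp : slope_family Phi alp dalp ->
  (forall t a b, T t -> P1 < a -> a < b -> b < P2 ->
    exists2 p, a < p < b & dalp t p != 0) ->
  forall t t0 p, T t -> T t0 -> P1 < p < P2 -> alp t p = alp t0 p.
Proof.
have mark := I.
move=> H nz t t0 p Tt Tt0 pP; apply/eqP/negP => /negP ne.
have [h1 h2 h3 _ _] := H.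
have ca x y : T x -> P1 < y < P2 -> {for y, continuous (alp x)}.
  by move=> Tx yP; apply: is_derive_continuous (h2 x y Tx yP).
have cD : {for p, continuous (fun y => alp t y - alp t0 y)}.
  by apply: continuousB; exact: ca.
have e0 : 0 < `|alp t p - alp t0 p| by rewrite normr_gt0 subr_eq0.
have [d d0 Hd] := (continuousP_eps _ _).1 cD _ e0.
have [a [a1 a2 a3]] : exists a, [/\ P1 < a, a < p & p - d < a].
  exists (Num.max ((P1 + p) / 2) (p - d / 2)); keep pP d0.
  by rewrite maxEle; case: ifPn; rewrite -?ltNge => ?; split; lra.
have [b [b1 b2 b3]] : exists b, [/\ b < P2, p < b & b < p + d].
  exists (Num.min ((P2 + p) / 2) (p + d / 2)); keep pP d0.
  by rewrite minEle; case: ifPn; rewrite -?ltNge => ?; split; lra.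
have [p1 p1ab ne1] := nz t0 a b Tt0 a1 (lt_trans a2 b2) b1.
have p1P : P1 < p1 < P2 by keep p1ab a1 b1; lra.
have e1 : 0 < `|dalp t0 p1| by rewrite normr_gt0.
have [d' d'0 Hd'] := (continuousP_eps _ _).1 (h3 t0 p1 Tt0 p1P) _ e1.
have [m [m0 md ma mb]] : exists m, [/\ 0 < m, m < d', m < p1 - a & m < b - p1].
  exists (Num.min d' (Num.min (p1 - a) (b - p1)) / 2); keep d'0 p1ab.
  do 2 rewrite minEle; do 2 case: ifPn; rewrite -?ltNge => ? ?; split; lra.
suff E : alp t p1 = alp t0 p1.
  have pp : `|p1 - p| < d by rewrite ltr_norml; keep p1ab a3 b3; lra.
  by have := Hd p1 pp; rewrite E subrr sub0r normrN ltxx.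
have Pa : P1 < p1 - m by keep ma a1; lra.
have bP : p1 + m < P2 by keep mb b1; lra.
have ab : p1 - m < p1 + m by keep m0; lra.
have p1I : p1 - m < p1 < p1 + m by keep m0; lra.
have near1 y : p1 - m <= y <= p1 + m -> `|y - p1| < d'.
  by rewrite ltr_norml => yI; keep yI md; lra.
move: ne1; rewrite neq_lt => /orP[neg|pos].
  apply: oppr_inj; apply: (static_pos (slope_familyN H) Tt0 Pa ab bP _ Tt p1I).
  move=> y yI; have := Hd' y (near1 y yI).
  by rewrite (ltr0_norm neg) ltr_norml; keep0; lra.
apply: (static_pos H Tt0 Pa ab bP _ Tt p1I) => y yI.
by have := Hd' y (near1 y yI); rewrite (gtr0_norm pos) ltr_norml; keep0; lra.
Qed.

End Rigidity.

(** * Integrals over the unit interval that depend on a parameter *)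

Section Int01.
Context {R : realType}.
Local Notation mu := (@lebesgue_measure R).
Implicit Types (g h : R -> R).

(** Integrands are continuous off [0] and bounded; at [v = 0], which is the
    turning point, the quotients below have no limit in general. *)
Definition bdd_cont01 g := (forall y, 0 < y <= 1 -> {for y, continuous g}) /\
  exists C : R, forall y, 0 < y <= 1 -> `|g y| <= C.

Lemma bdd_cont01_integrable g : bdd_cont01 g -> mu.-integrable `]0, 1] (EFin \o g).
Proof.
move=> [cg [C gC]]; apply: measurable_bounded_integrable => //.
- by rewrite /= lebesgue_measure_itv/= lte_fin ltr01 -EFinD ltry.
- apply: measurable_realfun.subspace_continuous_measurable_fun => //.
  by apply: continuous_in_subspaceT => z; rewrite inE/= in_itv/=; exact: cg.
- exists C; split; first exact: num_real.
  move=> D CD y /=; rewrite in_itv/= => yI.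
  exact: le_trans (gC y yI) (ltW CD).
Qed.

Lemma Rint01E g : bdd_cont01 g -> Rint 0 1 g = (\int[mu]_(x in `]0%R, 1%R]) g x)%R.
Proof. by move=> /bdd_cont01_integrable ig; rewrite Rintegral_itv_obnd_cbnd. Qed.

Lemma cont_bdd_cont01 g : cont_itv 0 1 g -> bdd_cont01 g.
Proof.
move=> cg; split; first by move=> y yI; apply: cg; lra.
have cn : cont_itv 0 1 (fun x => `|g x|).
  by move=> z zI; apply: cvg_norm; exact: cg.
have [c _ H] := EVT_max (@ler01 R) (cont_itv_within cn).
by exists `|g c| => y yI; apply: H; rewrite in_itv/=; lra.
Qed.

Lemma bdd_cont01D g h : bdd_cont01 g -> bdd_cont01 h -> bdd_cont01 (fun y => g y + h y).
Proof.
move=> [cg [C gC]] [ch [D hD]]; split.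
  by move=> y yI; apply: continuousD; [exact: cg|exact: ch].
exists (C + D) => y yI; rewrite (le_trans (ler_normD _ _))// lerD//.
  exact: gC.
exact: hD.
Qed.

Lemma bdd_cont01M g h : bdd_cont01 g -> bdd_cont01 h -> bdd_cont01 (fun y => g y * h y).
Proof.
move=> [cg [C gC]] [ch [D hD]]; split.
  by move=> y yI; apply: continuousM; [exact: cg|exact: ch].
by exists (C * D) => y yI; rewrite normrM ler_pM//; [exact: gC|exact: hD].
Qed.

Lemma bdd_cont01C (k : R) : bdd_cont01 (fun=> k).
Proof.
split; first by move=> y _; exact: cvg_cst.
by exists `|k|.
Qed.

Lemma Rint01D g h : bdd_cont01 g -> bdd_cont01 h ->
  Rint 0 1 (fun y => g y + h y) = Rint 0 1 g + Rint 0 1 h.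
Proof.
move=> bg bh; rewrite !Rint01E//; last exact: bdd_cont01D.
by apply: RintegralD => //; exact: bdd_cont01_integrable.
Qed.

Lemma Rint01Z (k : R) g : bdd_cont01 g -> Rint 0 1 (fun y => k * g y) = k * Rint 0 1 g.
Proof.
move=> bg; rewrite !Rint01E//; last by apply: bdd_cont01M => //; exact: bdd_cont01C.
by apply: RintegralZl => //; exact: bdd_cont01_integrable.
Qed.

Lemma Rint01_param_cont (g : R -> R -> R) (u v a C : R) : u < a < v ->
  (forall x y : R, u < x < v -> 0 < y <= 1 -> {for y, continuous (g x)}) ->
  (forall x y : R, u < x < v -> 0 < y <= 1 -> {for x, continuous (g^~ y)}) ->
  (forall x y : R, u < x < v -> 0 < y <= 1 -> `|g x y| <= C) ->
  {for a, continuous (fun x => Rint 0 1 (g x))}.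
Proof.
move=> auv cy cx gC.
have bc x : u < x < v -> bdd_cont01 (g x).
  move=> xuv; split; first by move=> y; exact: cy.
  by exists C => y; exact: gC.
have aI : a \in `]u, v[%classic by rewrite inE/= in_itv.
have := @continuity_under_integral R _ _ mu g `]0, 1]%classic (measurable_itv _) u v
  _ _ (fun=> C) _ _ a aI.
move=> H; apply/continuousP_eps => e e0.
have {H} /continuousP_eps H : {for a, continuous (fun l => (\int[mu]_(x in `]0%R, 1%R]) g l x)%R)}.
  apply: H.
  - by move=> x /=; rewrite in_itv/= => xI; apply: bdd_cont01_integrable; exact: bc.
  - apply: aeW => y /=; rewrite in_itv/= => yI x; rewrite inE/= in_itv/= => xI.
    exact: cx.
  - by apply: bdd_cont01_integrable; exact: bdd_cont01C.
  - by move=> x /=; rewrite in_itv/= => xI; apply: aeW => y /=; rewrite in_itv/=; exact: gC.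
have [d d0 Hd] := H _ e0.
exists (Num.min d (Num.min (a - u) (v - a))); first by rewrite !lt_min d0; lra.
move=> y; rewrite !lt_min => /andP[yd yI].
have by_ : bdd_cont01 (g y) by apply: bc; move: yI; rewrite !ltr_norml; lra.
by rewrite (Rint01E by_) (Rint01E (bc a auv)); exact: Hd.
Qed.

Lemma Rint01_param_derive (g gx : R -> R -> R) (u v a C : R) : u < a < v ->
  (forall x y : R, u < x < v -> 0 < y <= 1 -> {for y, continuous (g x)}) ->
  (forall x y : R, u < x < v -> 0 < y <= 1 -> `|g x y| <= C) ->
  (forall x y : R, u < x < v -> 0 < y <= 1 -> is_derive x 1 (g^~ y) (gx x y)) ->
  (forall x y : R, u < x < v -> 0 < y <= 1 -> `|gx x y| <= C) ->
  bdd_cont01 (gx a) ->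
  is_derive a 1 (fun x => Rint 0 1 (g x)) (Rint 0 1 (gx a)).
Proof.
move=> auv cy gC dx gxC bgx.
have C0 : 0 <= C by apply: (le_trans _ (gC a 1 auv _)); rewrite ?normr_ge0// ltr01 lexx.
have bc x : u < x < v -> bdd_cont01 (g x).
  move=> xuv; split; first by move=> y; exact: cy.
  by exists C => y; exact: gC.
have aI : `]u, v[%classic a by rewrite /= in_itv.
have pE x y : u < x < v -> 0 < y <= 1 -> partial1of2 g x y = gx x y.
  by move=> xI yI; apply: is_derive1E; exact: dx.
have h1 x : `]u, v[%classic x -> mu.-integrable `]0, 1]%classic (EFin \o g x).
  by rewrite /= in_itv/= => xI; apply: bdd_cont01_integrable; exact: bc.
have h2 x y : `]u, v[%classic x -> `]0, 1]%classic y -> derivable (g^~ y) x 1.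
  by rewrite /= !in_itv/= => xI yI; case: (dx x y xI yI).
have h3 x y : `]u, v[%classic x -> `]0, 1]%classic y -> `|partial1of2 g x y| <= (fun=> C) y.
  by rewrite /= !in_itv/= => xI yI; rewrite pE//; exact: gxC.
have h4 : mu.-integrable `]0, 1]%classic (EFin \o (fun=> C)).
  by apply: bdd_cont01_integrable; exact: bdd_cont01C.
have mI := @measurable_itv R `]0, 1].
have D := @derivable_under_integral R _ _ mu g _ mI a u v aI h1 h2 (fun=> C) (fun=> C0) h4 h3.
have E := @differentiation_under_integral R _ _ mu g _ mI a u v aI h1 h2 (fun=> C) (fun=> C0) h4 h3.
have := derivable_is_derive1 D; rewrite E => {}D.
have -> : Rint 0 1 (gx a) = (\int[mu]_(y in `]0%R, 1%R]) (partial1of2 g)^~ y a)%R.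
  rewrite Rint01E//; apply: eq_Rintegral => y; rewrite inE/= in_itv/= => yI.
  by rewrite pE.
apply: is_derive_near D; first by instantiate (1 := Num.min (a - u) (v - a)); rewrite lt_min; lra.
move=> y; rewrite lt_min !ltr_norml => yI.
have by_ : bdd_cont01 (g y) by apply: bc; lra.
by rewrite (Rint01E by_).
Qed.

End Int01.

(** * The neighbourhood of a turning point *)

(** The squared slowness in logarithmic coordinates, extended to a function on
    the line with Lipschitz derivative.  The derivative is allowed to vanish at
    [B]: a jump radius is not subject to the Herglotz condition. *)
Record profile {R : realType} (f df : R -> R) (A B M : R) : Prop := Profile {
  pf_AB : A < B;
  pf_d : forall u : R, is_derive u 1 f (df u);
  pf_lip : forall u v : R, `|df u - df v| <= M * `|u - v|;
  pf_df_gt0 : forall u : R, A <= u < B -> 0 < df u;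
  pf_df_ge0 : forall u : R, A <= u -> 0 <= df u;
  pf_gt0 : 0 < f A }.

Section ProfileCalculus.
Context {R : realType}.
Variables (f df : R -> R) (A B M : R).
Hypothesis pf : profile f df A B M.
Implicit Types x u v : R.

Lemma pf_cont u : {for u, continuous f}.
Proof. exact: is_derive_continuous (pf_d pf u). Qed.

Lemma pf_dcont u : {for u, continuous df}.
Proof.
apply/continuousP_eps => e e0.
have M0 : 0 <= M by have := pf_lip pf 1 0; rewrite subr0 normr1 mulr1; apply: le_trans.
exists (e / (M + 1)) => [|y yu]; first by rewrite divr_gt0//; lra.
rewrite (le_lt_trans (pf_lip pf y u))//.
rewrite (@le_lt_trans _ _ ((M + 1) * `|y - u|))//; first by rewrite ler_wpM2r//; lra.
by rewrite mulrC -ltr_pdivlMr//; lra.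
Qed.

Lemma pf_le u v : A <= u -> u <= v -> f u <= f v.
Proof.
move=> Au; rewrite le_eqVlt => /predU1P[->//|uv].
have [z _|z _|z zI E] := @mvt_lin _ f df u v uv.
- exact: pf_cont.
- exact: (pf_d pf).
- by rewrite -subr_ge0 E mulr_ge0//; [apply: (pf_df_ge0 pf); lra|lra].
Qed.

Lemma pf_lt u v : A <= u -> u < v -> u < B -> f u < f v.
Proof.
move=> Au uv uB.
pose w := Num.min v B.
have [uw wv wB] : [/\ u < w, w <= v & w <= B].
  by rewrite /w minEle; case: ifPn; rewrite -?ltNge => ?; split; lra.
apply: (@lt_le_trans _ _ (f w)); last by apply: pf_le => //; lra.
have [z _|z _|z zI E] := @mvt_lin _ f df u w uw.
- exact: pf_cont.
- exact: (pf_d pf).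
- by rewrite -subr_gt0 E mulr_gt0//; [apply: (pf_df_gt0 pf); lra|lra].
Qed.

Lemma pf_pos u : A <= u -> 0 < f u.
Proof. by move=> Au; exact: lt_le_trans (pf_gt0 pf) (pf_le (lexx A) Au). Qed.

(** With [u = x + (B - x) v^2] the integrand [1 / sqrt (f u - f x)], singular
    at the turning point [x], becomes a continuous function of [v]; negative [v]
    describe the descending half of the ray. *)
Definition log_radius x v := x + (B - x) * v ^+ 2.

Lemma log_radius_ge x v : x < B -> x <= log_radius x v.
Proof. by move=> xB; rewrite /log_radius lerDl mulr_ge0 ?sqr_ge0//; lra. Qed.

Lemma log_radius_leB x v : x < B -> 0 <= v <= 1 -> log_radius x v <= B.
Proof.
move=> xB /andP[v0 v1]; have : v ^+ 2 <= 1 by rewrite expr_le1.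
rewrite /log_radius => h; have : (B - x) * v ^+ 2 <= (B - x) * 1 by rewrite ler_pM2l//; lra.
by lra.
Qed.

Lemma log_radius0 x : log_radius x 0 = x. Proof. by rewrite /log_radius expr0n mulr0 addr0. Qed.
Lemma log_radius1 x : log_radius x 1 = B. Proof. by rewrite /log_radius expr1n mulr1; ring. Qed.
Lemma log_radiusN x v : log_radius x (- v) = log_radius x v. Proof. by rewrite /log_radius sqrrN. Qed.

Lemma der_log_radius_v x v : is_derive v 1 (log_radius x) (2 * (B - x) * v).
Proof. by rewrite /log_radius; eapply is_derive_eq; [der|rewrite /= expr1; ring]. Qed.
Lemma der_log_radius_x x v : is_derive x 1 (log_radius^~ v) (1 - v ^+ 2).
Proof. by rewrite /log_radius; eapply is_derive_eq; [der|rewrite /=; ring]. Qed.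

(** The value at [v = 0] is the limit, by definition of the derivative. *)
Definition slowness_quotient x v :=
  if v == 0 then (B - x) * df x else (f (log_radius x v) - f x) / v ^+ 2.

Lemma slowness_quotientN x v : slowness_quotient x (- v) = slowness_quotient x v.
Proof. by rewrite /slowness_quotient oppr_eq0 log_radiusN sqrrN. Qed.

Lemma slowness_quotientE x v : f (log_radius x v) = f x + slowness_quotient x v * v ^+ 2.
Proof.
rewrite /slowness_quotient; case: eqP => [->|/eqP v0]; first by rewrite log_radius0 expr0n mulr0 addr0.
by rewrite divfK ?expf_neq0//; ring.
Qed.

Lemma slowness_quotient_gt0 x v : A <= x < B -> 0 < slowness_quotient x v.
Proof.
move=> xI; rewrite /slowness_quotient; case: eqP => [_|/eqP v0].
  by rewrite mulr_gt0 ?(pf_df_gt0 pf)//; lra.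
rewrite divr_gt0 ?exprn_even_gt0// subr_gt0; apply: pf_lt; [lra| |lra].
by rewrite /log_radius ltrDl mulr_gt0 ?exprn_even_gt0//; lra.
Qed.

Lemma der_slowness_quotient_v x v : v != 0 ->
  is_derive v 1 (slowness_quotient x) (2 * ((B - x) * df (log_radius x v) - slowness_quotient x v) / v).
Proof.
move=> v0.
have D : is_derive v 1 (fun y => (f (log_radius x y) - f x) / y ^+ 2)
    (2 * ((B - x) * df (log_radius x v) - slowness_quotient x v) / v).
  have Df := der_comp (pf_d pf (log_radius x v)) (der_log_radius_v x v).
  have v20 : v ^+ 2 != 0 by rewrite expf_neq0.
  eapply is_derive_eq; first by der.
  by rewrite /slowness_quotient (negPf v0) /= expr1; field.
apply: (is_derive_near (d := `|v|)) D; first by rewrite normr_gt0.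
move=> y yv; rewrite /slowness_quotient; case: eqP => // y0.
by move: yv; rewrite y0 sub0r normrN ltxx.
Qed.

Lemma der_slowness_quotient_x x v : v != 0 ->
  is_derive x 1 (slowness_quotient^~ v) ((df (log_radius x v) * (1 - v ^+ 2) - df x) / v ^+ 2).
Proof.
move=> v0.
have -> : slowness_quotient^~ v = fun y => (f (log_radius y v) - f y) / v ^+ 2.
  by apply/funext => y; rewrite /slowness_quotient (negPf v0).
have Df := der_comp (g := log_radius^~ v) (pf_d pf (log_radius x v)) (der_log_radius_x x v).
have Dx := pf_d pf x.
eapply is_derive_eq; first by der.
by rewrite /=; ring.
Qed.

Lemma slowness_quotient_cont x v : x < B -> {for v, continuous (slowness_quotient x)}.
Proof.
move=> xB; have [->|v0] := eqVneq v 0; last exact: is_derive_continuous (der_slowness_quotient_v x v0).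
apply/continuousP_eps => e e0.
have L0 : 0 < B - x by lra.
have e1 : 0 < e / (2 * (B - x)) by rewrite divr_gt0// mulr_gt0.
have [d d0 Hd] := (is_deriveP_eps _ _ _).1 (pf_d pf x) _ e1.
exists (Num.min 1 (d / (B - x))); first by rewrite lt_min ltr01 divr_gt0.
move=> y; rewrite subr0 lt_min => /andP[y1 yd].
rewrite {2}/slowness_quotient eqxx /slowness_quotient; case: eqP => [_|/eqP y0]; first by rewrite subrr normr0.
have y20 : 0 < y ^+ 2 by rewrite exprn_even_gt0.
have y2 : y ^+ 2 <= `|y|.
  by rewrite -real_normK ?num_real// expr2 ler_piMl// ltW.
have Eu : log_radius x y - x = (B - x) * y ^+ 2 by rewrite /log_radius; ring.
have H : `|log_radius x y - x| < d.
  rewrite Eu normrM (gtr0_norm L0) (gtr0_norm y20).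
  by rewrite mulrC -ltr_pdivlMr//; exact: le_lt_trans yd.
have := Hd _ H; rewrite Eu (gtr0_norm (mulr_gt0 L0 y20)) => h.
have -> : (f (log_radius x y) - f x) / y ^+ 2 - (B - x) * df x =
    (f (log_radius x y) - f x - df x * ((B - x) * y ^+ 2)) / y ^+ 2 by field.
rewrite normrM normfV (gtr0_norm y20) ltr_pdivrMr//.
apply: (le_lt_trans h).
rewrite (_ : _ * (_ * _) = e * y ^+ 2 / 2); last by field; lra.
by have := mulr_gt0 e0 y20; lra.
Qed.

Definition radial_rate x v := Num.sqrt (slowness_quotient x v).

Lemma radial_rate_gt0 x v : A <= x < B -> 0 < radial_rate x v.
Proof. by move=> xI; rewrite sqrtr_gt0 slowness_quotient_gt0. Qed.

Lemma radial_rate_sqr x v : A <= x < B -> radial_rate x v ^+ 2 = slowness_quotient x v.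
Proof. by move=> xI; rewrite sqr_sqrtr// ltW// slowness_quotient_gt0. Qed.

Lemma radial_rateN x v : radial_rate x (- v) = radial_rate x v. Proof. by rewrite /radial_rate slowness_quotientN. Qed.

Lemma radial_rate_cont x v : x < B -> {for v, continuous (radial_rate x)}.
Proof.
move=> xB; apply: (@continuous_comp _ _ _ (slowness_quotient x) Num.sqrt); first exact: slowness_quotient_cont.
exact: sqrt_continuous.
Qed.

Lemma log_radius_cont x v : {for v, continuous (log_radius x)}.
Proof. exact: is_derive_continuous (der_log_radius_v x v). Qed.

Definition radial_rate_inv x v := (radial_rate x v)^-1.

Lemma radial_rate_inv_gt0 x v : A <= x < B -> 0 < radial_rate_inv x v.
Proof. by move=> xI; rewrite invr_gt0 radial_rate_gt0. Qed.

Lemma radial_rate_inv_cont x v : A <= x < B -> {for v, continuous (radial_rate_inv x)}.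
Proof.
move=> xI; apply: continuousV; first by rewrite gt_eqF// radial_rate_gt0.
by apply: radial_rate_cont; lra.
Qed.

Lemma der_radial_rate_v x v : A <= x < B -> v != 0 ->
  is_derive v 1 (radial_rate x) (((B - x) * df (log_radius x v) * radial_rate_inv x v - radial_rate x v) / v).
Proof.
move=> xI v0; have s0 := radial_rate_gt0 v xI.
eapply is_derive_eq; first by apply: der_sqrt; [exact: slowness_quotient_gt0|exact: der_slowness_quotient_v].
by rewrite -/(radial_rate x v) -(radial_rate_sqr v xI) /radial_rate_inv; field; rewrite v0 gt_eqF.
Qed.

(** [v * radial_rate x v] is the radial momentum [sqrt (f u - f x)] with its
    sign, so its square is [f u - f x]; at [v = 0] the derivative comes from
    the continuity of [radial_rate]. *)
Lemma der_radial_momentum_v x v : A <= x < B ->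
  is_derive v 1 (fun y => y * radial_rate x y) ((B - x) * df (log_radius x v) * radial_rate_inv x v).
Proof.
move=> xI; have [->|v0] := eqVneq v 0.
  apply/is_deriveP_eps => e e0.
  have xB : x < B by lra.
  have [d d0 Hd] := (continuousP_eps _ _).1 (radial_rate_cont (v := 0) xB) _ e0.
  exists d => // y yd; rewrite mul0r !subr0 log_radius0.
  have -> : (B - x) * df x * radial_rate_inv x 0 = radial_rate x 0.
    have -> : (B - x) * df x = radial_rate x 0 ^+ 2 by rewrite radial_rate_sqr// /slowness_quotient eqxx.
    by rewrite /radial_rate_inv expr2 mulfK// gt_eqF// radial_rate_gt0.
  rewrite [y * _]mulrC -mulrBl.
  rewrite normrM ler_wpM2r// ltW//; exact: Hd.
have Ds := der_radial_rate_v xI v0.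
eapply is_derive_eq; first by der.
by rewrite /=; field.
Qed.

Lemma der_radial_rate_inv_v x v : A <= x < B -> v != 0 ->
  is_derive v 1 (radial_rate_inv x) ((radial_rate_inv x v - (B - x) * df (log_radius x v) * radial_rate_inv x v ^+ 3) / v).
Proof.
move=> xI v0; have s0 := radial_rate_gt0 v xI.
have Ds := der_radial_rate_v xI v0.
eapply is_derive_eq; first by apply: der_inv Ds; rewrite gt_eqF.
by rewrite /radial_rate_inv; field; rewrite v0 gt_eqF.
Qed.

Lemma der_radial_rate_x x v : A <= x < B -> v != 0 -> is_derive x 1 (radial_rate^~ v)
  ((df (log_radius x v) * (1 - v ^+ 2) - df x) / v ^+ 2 * radial_rate_inv x v / 2).
Proof.
move=> xI v0; have s0 := radial_rate_gt0 v xI.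
eapply is_derive_eq; first by apply: der_sqrt; [exact: slowness_quotient_gt0|exact: der_slowness_quotient_x].
by rewrite /= -/(radial_rate x v) /radial_rate_inv; field; rewrite v0 gt_eqF.
Qed.

Lemma der_radial_rate_inv_x x v : A <= x < B -> v != 0 -> is_derive x 1 (radial_rate_inv^~ v)
  (- ((df (log_radius x v) * (1 - v ^+ 2) - df x) / v ^+ 2 * radial_rate_inv x v ^+ 3 / 2)).
Proof.
move=> xI v0; have s0 := radial_rate_gt0 v xI.
have Ds := der_radial_rate_x xI v0.
eapply is_derive_eq; first by apply: der_inv Ds; rewrite gt_eqF.
by rewrite /= /radial_rate_inv; field; rewrite v0 gt_eqF.
Qed.

(** Near [x] the quotient is bounded below by the minimum of [df] away from
    [B], and for larger [u] by the monotonicity of [f], since [df] may vanish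
    at [B]. *)
Lemma slowness_quotient_bounds x1 x2 : A <= x1 -> x1 <= x2 -> x2 < B ->
  exists k C, [/\ 0 < k, 0 < C,
    forall x v, x1 <= x <= x2 -> 0 < v <= 1 -> k <= slowness_quotient x v <= C &
    forall x v, x1 <= x <= x2 -> 0 <= v <= 1 -> 0 <= df (log_radius x v) <= C].
Proof.
move=> Ax1 x12 x2B.
pose u0 := (x2 + B) / 2.
have x1u0 : x1 <= u0 by rewrite /u0; lra.
have cdf a b : cont_itv a b df by move=> z _; exact: pf_dcont.
have [c1 c1I Hc1] := EVT_min x1u0 (cont_itv_within (cdf x1 u0)).
have x1B : x1 <= B by lra.
have [c2 c2I Hc2] := EVT_max x1B (cont_itv_within (cdf x1 B)).
have k1 : 0 < df c1.
  by apply: (pf_df_gt0 pf); move: c1I; rewrite in_itv/= /u0; lra.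
have c20 : 0 <= df c2 by apply: (pf_df_ge0 pf); move: c2I; rewrite in_itv/=; lra.
have dfle u : x1 <= u <= B -> 0 <= df u <= df c2.
  by move=> uI; rewrite Hc2 ?in_itv// andbT; apply: (pf_df_ge0 pf); lra.
have lowb a b : x1 <= a -> a <= b -> b <= u0 -> df c1 * (b - a) <= f b - f a.
  move=> xa; rewrite le_eqVlt => /predU1P[->|ab] bu; first by rewrite !subrr mulr0.
  have [z _|z _|z zI ->] := @mvt_lin _ f df a b ab.
  - exact: pf_cont.
  - exact: (pf_d pf).
  - by rewrite ler_wpM2r//; [lra|apply: Hc1; rewrite in_itv/=; lra].
exists (df c1 * ((B - x2) / 2)), (Num.max 1 (Num.max (df c2) (df c2 * (B - x1)))).
have C1 : df c2 <= Num.max 1 (Num.max (df c2) (df c2 * (B - x1))).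
  by rewrite !le_max lexx orbT.
have C2 : df c2 * (B - x1) <= Num.max 1 (Num.max (df c2) (df c2 * (B - x1))).
  by rewrite !le_max lexx !orbT.
split.
- by rewrite mulr_gt0//; lra.
- by rewrite lt_max ltr01.
- move=> x v xI vI; have v0 : v != 0 by rewrite gt_eqF//; lra.
  have v20 : 0 < v ^+ 2 by rewrite exprn_even_gt0.
  have xB : x < B by lra.
  have ux := log_radius_ge v xB; have uB : log_radius x v <= B by apply: log_radius_leB => //; lra.
  rewrite /slowness_quotient (negPf v0); apply/andP; split.
    rewrite ler_pdivlMr//.
    have [log_radius0|u0u] := leP (log_radius x v) u0.
      apply: le_trans (lowb x (log_radius x v) _ ux log_radius0); last lra.
      rewrite -mulrA ler_pM2l// [X in _ <= X](_ : _ = (B - x) * v ^+ 2); last by rewrite /log_radius; ring.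
      by rewrite ler_pM2r//; lra.
    have h : f u0 <= f (log_radius x v) by apply: pf_le; [rewrite /u0; lra|exact: ltW].
    apply: (@le_trans _ _ (f u0 - f x)); last by rewrite lerD2r.
    apply: le_trans (lowb x u0 _ _ _); rewrite ?lexx//; [|by lra|by rewrite /u0; lra].
    rewrite -mulrA ler_pM2l//.
    have v21 : v ^+ 2 <= 1 by rewrite expr_le1//; lra.
    apply: (@le_trans _ _ ((B - x2) / 2 * 1)); first by rewrite ler_wpM2l//; lra.
    by rewrite /u0; lra.
  rewrite ler_pdivrMr//; move: ux; rewrite le_eqVlt => /predU1P[<-|xu].
    by rewrite subrr mulr_ge0 ?sqr_ge0// (le_trans _ C1).
  have [z _|z _|z zI ->] := @mvt_lin _ f df x (log_radius x v) xu.
  - exact: pf_cont.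
  - exact: (pf_d pf).
  - have := dfle z ltac:(lra) => /andP[z0 zc].
    rewrite [X in _ * X](_ : _ = (B - x) * v ^+ 2); last by rewrite /log_radius; ring.
    rewrite mulrA ler_wpM2r ?sqr_ge0// (le_trans _ C2)//.
    by rewrite ler_pM//; lra.
- move=> x v xI vI; have xB : x < B by lra.
  have ux := log_radius_ge v xB; have uB : log_radius x v <= B by apply: log_radius_leB => //; lra.
  have /andP[h1 h2] := dfle (log_radius x v) ltac:(lra).
  by rewrite h1 (le_trans h2).
Qed.

End ProfileCalculus.

(** * Action and angle as functions of the turning point *)

Section Bdd2.
Context {R : realType}.
Variables a b : R.
Implicit Types g h : R -> R -> R.

Definition bdd2 g := exists C : R,
  forall x y : R, a < x < b -> 0 < y <= 1 -> `|g x y| <= C.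

Lemma bdd2D g h : bdd2 g -> bdd2 h -> bdd2 (fun x y => g x y + h x y).
Proof.
move=> [C gC] [D hD]; exists (C + D) => x y xI yI.
by rewrite (le_trans (ler_normD _ _))// lerD// ?gC ?hD.
Qed.

Lemma bdd2M g h : bdd2 g -> bdd2 h -> bdd2 (fun x y => g x y * h x y).
Proof.
move=> [C gC] [D hD]; exists (C * D) => x y xI yI.
by rewrite normrM ler_pM// ?gC ?hD.
Qed.

Lemma bdd2N g : bdd2 g -> bdd2 (fun x y => - g x y).
Proof. by move=> [C gC]; exists C => x y xI yI; rewrite normrN gC. Qed.

Lemma bdd2C (k : R) : bdd2 (fun _ _ => k).
Proof. by exists `|k|. Qed.

Lemma bdd2X g n : bdd2 g -> bdd2 (fun x y => g x y ^+ n).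
Proof.
move=> bg; elim: n => [|n ih]; first by under eq_fun do under eq_fun do rewrite expr0; exact: bdd2C.
by under eq_fun do under eq_fun do rewrite exprS; exact: bdd2M.
Qed.

Lemma bdd2_x : bdd2 (fun x _ => x).
Proof.
exists (`|a| + `|b|) => x y xI _; rewrite ler_norml.
have := ler_norm b; have := ler_norm (- a); rewrite normrN.
by have := normr_ge0 a; have := normr_ge0 b; lra.
Qed.

Lemma bdd2_y : bdd2 (fun _ y => y).
Proof. by exists 1 => x y _ /andP[y0 y1]; rewrite gtr0_norm. Qed.

Lemma Rint01_derive g gx x : a < x < b ->
  (forall x y : R, a < x < b -> 0 < y <= 1 -> {for y, continuous (g x)}) ->
  bdd2 g ->
  (forall x y : R, a < x < b -> 0 < y <= 1 -> is_derive x 1 (g^~ y) (gx x y)) ->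
  bdd2 gx -> (forall y : R, 0 < y <= 1 -> {for y, continuous (gx x)}) ->
  is_derive x 1 (fun x => Rint 0 1 (g x)) (Rint 0 1 (gx x)).
Proof.
move=> xI cy [C gC] dx [D gxD] cgx.
apply: (@Rint01_param_derive _ g gx a b x (Num.max C D) xI cy) => //.
- by move=> z y zI yI; rewrite le_max gC.
- by move=> z y zI yI; rewrite le_max gxD ?orbT.
- by split => //; exists D => y; exact: gxD.
Qed.

End Bdd2.

Section Actions.
Context {R : realType}.
Variables (f df : R -> R) (A B M : R).
Hypothesis pf : profile f df A B M.
Implicit Types x u v : R.
Local Notation uu := (log_radius B).
Local Notation mm := (slowness_quotient f df B).
Local Notation ss := (radial_rate f df B).
Local Notation ww := (radial_rate_inv f df B).

(** The integral of [du / sqrt (f u - f x)] from [x] to [B]: the angle swept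
    by half of the ray, divided by the momentum. *)
Definition half_angle_time x := Rint 0 1 (fun v => 2 * (B - x) * ww x v).
(** Twice the integral of [sqrt (f u - f x) du] from [x] to [B]. *)
Definition radial_action x := Rint 0 1 (fun v => 4 * (B - x) * v ^+ 2 * ss x v).
Definition slope_quotient x v := (df (uu x v) - df x) / v ^+ 2.
Definition d_half_angle_time x := - ww x 1 - (B - x) * Rint 0 1 (fun v => ww x v ^+ 3 * slope_quotient x v).

Lemma basic_bdd x1 x2 : A <= x1 -> x1 <= x2 -> x2 < B ->
  [/\ bdd2 x1 x2 ww, bdd2 x1 x2 ss, bdd2 x1 x2 (fun x v => df (uu x v)),
      bdd2 x1 x2 (fun x v => df x) & bdd2 x1 x2 slope_quotient].
Proof.
move=> Ax1 x12 x2B.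
have [k [C [k0 C0 mB dB]]] := slowness_quotient_bounds pf Ax1 x12 x2B.
have xB x : x1 < x < x2 -> A <= x < B by move=> xI; lra.
have M0 : 0 <= M by have := pf_lip pf 1 0; rewrite subr0 normr1 mulr1; apply: le_trans.
split.
- exists (Num.sqrt k)^-1 => x v xI vI.
  have xI' : x1 <= x <= x2 by lra.
  have /andP[kmm _] := mB x v xI' vI.
  have w0 : 0 < ww x v by apply: (radial_rate_inv_gt0 pf); exact: xB.
  have s0 : 0 < ss x v by apply: (radial_rate_gt0 pf); exact: xB.
  have k0' : 0 < Num.sqrt k by rewrite sqrtr_gt0.
  rewrite (gtr0_norm w0) /ww lef_pV2 ?posrE//.
  exact: ler_wsqrtr.
- exists (Num.sqrt C) => x v xI vI.
  have s0 : 0 < ss x v by apply: (radial_rate_gt0 pf); exact: xB.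
  have xI' : x1 <= x <= x2 by lra.
  rewrite (gtr0_norm s0); apply: ler_wsqrtr.
  by case/andP: (mB x v xI' vI).
- exists C => x v xI vI.
  have xI' : x1 <= x <= x2 by lra.
  have vI' : 0 <= v <= 1 by lra.
  by case/andP: (dB x v xI' vI') => h1 h2; rewrite ger0_norm.
- exists C => x v xI vI.
  have xI' : x1 <= x <= x2 by lra.
  have vI' : 0 <= (0 : R) <= 1 by lra.
  by case/andP: (dB x 0 xI' vI'); rewrite log_radius0 => h1 h2; rewrite ger0_norm.
- exists (M * (B - x1)) => x v xI vI.
  have v20 : 0 < v ^+ 2 by rewrite exprn_gt0//; lra.
  rewrite /slope_quotient normrM normfV (gtr0_norm v20) ler_pdivrMr// (le_trans (pf_lip pf _ _))//.
  rewrite -mulrA ler_wpM2l// /uu addrC addKr normrM (gtr0_norm v20) ler_pM2r//.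
  by rewrite gtr0_norm; lra.
Qed.

Lemma slope_quotient_cont x v : v != 0 -> {for v, continuous (slope_quotient x)}.
Proof.
move=> v0; apply: continuousM; last first.
  apply: continuousV; first by rewrite expf_neq0.
  by apply: (@is_derive_continuous _ _ _ (2 * v)); eapply is_derive_eq; [der|rewrite /= expr1; ring].
apply: continuousB; last exact: cvg_cst.
by apply: (@continuous_comp _ _ _ (uu x) df); [exact: log_radius_cont|exact: (pf_dcont pf)].
Qed.

Lemma log_radius_contx x v : {for x, continuous (uu^~ v)}.
Proof. exact: is_derive_continuous (der_log_radius_x B x v). Qed.

Lemma slope_quotient_contx x v : {for x, continuous (slope_quotient^~ v)}.
Proof.
apply: continuousM; last exact: cvg_cst.
apply: continuousB; last exact: (pf_dcont pf).
by apply: (@continuous_comp _ _ _ (uu^~ v) df); [exact: log_radius_contx|exact: (pf_dcont pf)].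
Qed.

Lemma continuous_pow (g : R -> R) v n : {for v, continuous g} -> {for v, continuous (fun y => g y ^+ n)}.
Proof.
move=> cg; apply: (@continuous_comp _ _ _ g (fun z => z ^+ n)) => //.
exact: exprn_continuous.
Qed.

Lemma df_log_radius_cont x v : {for v, continuous (fun y => df (uu x y))}.
Proof.
by apply: (@continuous_comp _ _ _ (uu x) df); [exact: log_radius_cont|exact: (pf_dcont pf)].
Qed.

Lemma nbhd_itv x : A < x < B -> exists x1 x2, [/\ A <= x1, x1 < x, x < x2 & x2 < B].
Proof. by move=> xI; exists ((A + x) / 2), ((x + B) / 2); split; lra. Qed.

Lemma radial_rate_ctn x v : A <= x < B -> ctn v (ss x).
Proof. by case/andP => _ xB; exact: (radial_rate_cont pf). Qed.

Ltac cts5 := cts; try solve [exact: (radial_rate_inv_cont pf)|exact: radial_rate_ctn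
  |exact: df_log_radius_cont|exact: slope_quotient_cont].

Lemma cont_itvM (k : R) a b g : cont_itv a b g -> cont_itv a b (fun y => k * g y).
Proof. by move=> cg z zI; apply: continuousM; [exact: cvg_cst|exact: cg]. Qed.

(** Differentiation under the integral sign; a part of the differentiated
    integrand is the derivative of [- v * radial_rate_inv x v] with respect to
    [v], and integrates to the boundary term. *)
Lemma der_half_angle_time x : A < x < B -> is_derive x 1 half_angle_time (d_half_angle_time x).
Proof.
move=> xI; have [x1 [x2 [Ax1 x1x xx2 x2B]]] := nbhd_itv xI.
have x12 : x1 <= x2 by lra.
have [bw bs bdu bdx be] := basic_bdd Ax1 x12 x2B.
have inAB z : x1 < z < x2 -> A <= z < B by move=> zI; lra.
pose gx z v := - (2 * ww z v - (B - z) * df (uu z v) * ww z v ^+ 3)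
   + - ((B - z) * (ww z v ^+ 3 * slope_quotient z v)).
have bB : bdd2 x1 x2 (fun z _ => B - z).
  by apply: bdd2D; [exact: bdd2C|apply: bdd2N; exact: bdd2_x].
have xI' : A <= x < B by lra.
have D : is_derive x 1 half_angle_time (Rint 0 1 (gx x)).
  apply: (@Rint01_derive _ x1 x2); first by rewrite x1x.
  - move=> z v /inAB zI vI; cts5.
  - by apply: bdd2M => //; apply: bdd2M => //; exact: bdd2C.
  - move=> z v /inAB zI vI.
    have v0 : v != 0 by rewrite gt_eqF//; lra.
    have Dw := der_radial_rate_inv_x pf zI v0.
    eapply is_derive_eq; first by der.
    by rewrite /gx /slope_quotient /=; field.
  - apply: bdd2D; apply: bdd2N.
      apply: bdd2D; first by apply: bdd2M => //; exact: bdd2C.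
      by apply: bdd2N; apply: bdd2M; [apply: bdd2M|apply: bdd2X].
    by apply: bdd2M => //; apply: bdd2M => //; exact: bdd2X.
  - move=> v vI; have v0 : v != 0 by rewrite gt_eqF//; lra.
    by rewrite /gx; cts5.
apply: (is_derive_eq D).
have c1 : cont_itv 0 1 (fun v => 2 * ww x v - (B - x) * df (uu x v) * ww x v ^+ 3).
  by move=> v _; cts5.
have E1 : Rint 0 1 (fun v => 2 * ww x v - (B - x) * df (uu x v) * ww x v ^+ 3) = ww x 1.
  have cF : cont_itv 0 1 (fun v => v * ww x v) by move=> v _; cts5.
  have dF v : 0 < v < 1 -> is_derive v 1 (fun v => v * ww x v)
      (2 * ww x v - (B - x) * df (uu x v) * ww x v ^+ 3).
    move=> vI; have v0 : v != 0 by rewrite gt_eqF//; lra.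
    have Dw := der_radial_rate_inv_v pf xI' v0.
    eapply is_derive_eq; first by der.
    by rewrite /=; field.
  by rewrite (Rint_FTC2 ltr01 c1 cF dF) mul1r mul0r subr0.
have bc3 : bdd_cont01 (fun v => ww x v ^+ 3 * slope_quotient x v).
  split; first by move=> v vI; have v0 : v != 0 by [rewrite gt_eqF//; lra]; cts5.
  have [C HC] := bdd2M (bdd2X 3 bw) be.
  by exists C => v vI; apply: HC => //; rewrite x1x.
rewrite /gx /d_half_angle_time -E1.
have -> : Rint 0 1 (fun v => - (2 * ww x v - (B - x) * df (uu x v) * ww x v ^+ 3)
   + - ((B - x) * (ww x v ^+ 3 * slope_quotient x v))) =
   Rint 0 1 (fun v => (-1) * (2 * ww x v - (B - x) * df (uu x v) * ww x v ^+ 3)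
   + (- (B - x)) * (ww x v ^+ 3 * slope_quotient x v)).
  by apply: Rint_ext => v _; ring.
rewrite Rint01D.
- by rewrite !Rint01Z//; [ring|exact: cont_bdd_cont01].
- by apply: bdd_cont01M; [exact: bdd_cont01C|exact: cont_bdd_cont01].
- by apply: bdd_cont01M => //; exact: bdd_cont01C.
Qed.

Lemma d_half_angle_time_cont x : A < x < B -> {for x, continuous d_half_angle_time}.
Proof.
move=> xI; have [x1 [x2 [Ax1 x1x xx2 x2B]]] := nbhd_itv xI.
have x12 : x1 <= x2 by lra.
have [bw bs bdu bdx be] := basic_bdd Ax1 x12 x2B.
have inAB z : x1 < z < x2 -> A <= z < B by move=> zI; lra.
have xI' : A <= x < B by lra.
have wc z v : A <= z < B -> v != 0 -> {for z, continuous (ww^~ v)}.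
  by move=> zI v0; exact: is_derive_continuous (der_radial_rate_inv_x pf zI v0).
apply: continuousB; first by apply: continuousN; apply: wc; rewrite ?oner_eq0.
apply: continuousM; first by cts5.
have [C HC] := bdd2M (bdd2X 3 bw) be.
apply: (@Rint01_param_cont _ _ x1 x2 x C) => //; first by rewrite x1x.
  move=> z v /inAB zI vI; have v0 : v != 0 by rewrite gt_eqF//; lra.
  by cts5.
move=> z v /inAB zI vI; have v0 : v != 0 by rewrite gt_eqF//; lra.
apply: continuousM; last exact: slope_quotient_contx.
by apply: continuous_pow; exact: wc.
Qed.

(** As for [der_half_angle_time]; here the boundary term
    [(1 - v^2) * v * radial_rate] vanishes at both ends. *)
Lemma der_radial_action x : A < x < B -> is_derive x 1 radial_action (- df x * half_angle_time x).
Proof.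
move=> xI; have [x1 [x2 [Ax1 x1x xx2 x2B]]] := nbhd_itv xI.
have x12 : x1 <= x2 by lra.
have [bw bs bdu bdx be] := basic_bdd Ax1 x12 x2B.
have inAB z : x1 < z < x2 -> A <= z < B by move=> zI; lra.
pose gx z v := 2 * (- (2 * v) * (v * ss z v) + (1 - v ^+ 2) * ((B - z) * df (uu z v) * ww z v))
  + - df z * (2 * (B - z) * ww z v).
have bB : bdd2 x1 x2 (fun z _ => B - z).
  by apply: bdd2D; [exact: bdd2C|apply: bdd2N; exact: bdd2_x].
have bv := bdd2_y x1 x2.
have bC := bdd2C x1 x2.
have xI' : A <= x < B by lra.
have D : is_derive x 1 radial_action (Rint 0 1 (gx x)).
  apply: (@Rint01_derive _ x1 x2); first by rewrite x1x.
  - by move=> z v /inAB zI vI; cts5.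
  - apply: bdd2M => //; apply: bdd2M; first by apply: bdd2M.
    exact: (bdd2X 2).
  - move=> z v /inAB zI vI.
    have v0 : v != 0 by rewrite gt_eqF//; lra.
    have Dw := der_radial_rate_x pf zI v0.
    eapply is_derive_eq; first by der.
    by rewrite /gx /=; field.
  - apply: bdd2D; last first.
      by apply: bdd2M; [exact: bdd2N|apply: bdd2M => //; exact: bdd2M].
    apply: bdd2M => //; apply: bdd2D.
      by apply: bdd2M; [apply: bdd2N; exact: bdd2M|exact: bdd2M].
    apply: bdd2M; last by apply: bdd2M => //; exact: bdd2M.
    by apply: bdd2D => //; apply: bdd2N; exact: (bdd2X 2).
  - by move=> v vI; rewrite /gx; cts5.
apply: (is_derive_eq D).
have c1 : cont_itv 0 1 (fun v => - (2 * v) * (v * ss x v) + (1 - v ^+ 2) * ((B - x) * df (uu x v) * ww x v)).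
  by move=> v _; cts5.
have E1 : Rint 0 1 (fun v => - (2 * v) * (v * ss x v) + (1 - v ^+ 2) * ((B - x) * df (uu x v) * ww x v)) = 0.
  have cF : cont_itv 0 1 (fun v => (1 - v ^+ 2) * (v * ss x v)).
    by move=> v _; cts5.
  have dF v : 0 < v < 1 -> is_derive v 1 (fun v => (1 - v ^+ 2) * (v * ss x v))
      (- (2 * v) * (v * ss x v) + (1 - v ^+ 2) * ((B - x) * df (uu x v) * ww x v)).
    move=> vI; have Ds := der_radial_momentum_v pf v xI'.
    have D1 : is_derive v 1 (fun v : R => 1 - v ^+ 2) (- (2 * v)).
      by eapply is_derive_eq; [der|rewrite /= expr1; ring].
    exact: (is_derive_eq (der_mul D1 Ds)).
  by rewrite (Rint_FTC2 ltr01 c1 cF dF) expr1n subrr !mul0r mulr0 subrr.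
have c2 : cont_itv 0 1 (fun v => 2 * (B - x) * ww x v) by move=> v _; cts5.
have c1' := cont_itvM (k := 2) c1; have c2' := cont_itvM (k := - df x) c2.
by rewrite /gx (Rint_D c1' c2') (Rint_Z 2 c1) (Rint_Z (- df x) c2) E1 mulr0 add0r.
Qed.

End Actions.

(** * Diving geodesics *)

Section Inverse.
Context {R : realType}.

Lemma inverse_fun (F F' : R -> R) (a b : R) : a < b ->
  (forall v, a <= v <= b -> is_derive v 1 F (F' v)) ->
  (forall v, a <= v <= b -> 0 < F' v) ->
  exists G : R -> R, [/\
    forall v, a <= v <= b -> G (F v) = v,
    forall v, a < v < b -> is_derive (F v) 1 G (F' v)^-1,
    forall t, F a <= t <= F b -> a <= G t <= b /\ F (G t) = t &
    forall u v, a <= u -> u < v -> v <= b -> F u < F v].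
Proof.
move=> ab dF F'0.
have cF : cont_itv a b F by move=> v vI; exact: is_derive_continuous (dF v vI).
have mono u v : a <= u -> u < v -> v <= b -> F u < F v.
  move=> au uv vb.
  have [z zI|z|z zI E] := @mvt_lin _ F F' u v uv.
  - by apply: cF; lra.
  - by move=> zI; apply: dF; lra.
  - by rewrite -subr_gt0 E mulr_gt0 ?F'0//; lra.
have inj u v : a <= u <= b -> a <= v <= b -> F u = F v -> u = v.
  move=> /andP[u1 u2] /andP[v1 v2] E; case: (ltgtP u v) => // h.
    by have := mono u v u1 h v2; rewrite E ltxx.
  by have := mono v u v1 h u2; rewrite E ltxx.
pose G t := get [set v | a <= v <= b /\ F v = t].
have GP t : F a <= t <= F b -> a <= G t <= b /\ F (G t) = t.
  move=> tI; have [z zI E] := ivt_lt (ltW ab) cF tI.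
  exact: (@getPex _ [set v | a <= v <= b /\ F v = t] (ex_intro _ z (conj zI E))).
have GK v : a <= v <= b -> G (F v) = v.
  move=> vI; have FI : F a <= F v <= F b.
    move: vI => /andP[av vb]; apply/andP; split.
      by move: av; rewrite le_eqVlt => /predU1P[->//|av]; apply/ltW/mono.
    by move: vb; rewrite le_eqVlt => /predU1P[->//|vb]; apply/ltW/mono.
  by have [GI E] := GP _ FI; exact: inj.
exists G; split => // v vI.
have vI' : a <= v <= b by lra.
have nearI : \forall z \near v, a <= z <= b.
  near=> z; apply/andP; split; apply: ltW.
    by near: z; apply: (cvgr_gt v) => //; case/andP: vI.
  by near: z; apply: (cvgr_lt v) => //; case/andP: vI.
apply: is_derive_inverse.
- by near=> z; apply: GK; near: z.
- by near=> z; apply: cF; near: z.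
- exact: dF.
- by rewrite gt_eqF// F'0.
Unshelve. all: by end_near. Qed.

Lemma inverse_range (F G : R -> R) (a b a' b' : R) : a <= a' -> a' < b' -> b' <= b ->
  (forall t, F a <= t <= F b -> a <= G t <= b /\ F (G t) = t) ->
  (forall u v, a <= u -> u < v -> v <= b -> F u < F v) ->
  (forall t, F a' <= t <= F b' -> a' <= G t <= b' /\ F (G t) = t) /\
  (forall t, F a' < t < F b' -> a' < G t < b').
Proof.
move=> aa' ab' b'b HG mono.
have Fa : F a <= F a'.
  move: aa'; rewrite le_eqVlt => /predU1P[->//|h].
  by apply/ltW/mono => //; rewrite (le_trans (ltW ab')).
have Fb : F b' <= F b.
  move: b'b; rewrite le_eqVlt => /predU1P[->//|h].
  by apply/ltW/mono => //; rewrite (le_trans aa' (ltW ab')).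
have H t : F a' <= t <= F b' -> a' <= G t <= b' /\ F (G t) = t.
  move=> /andP[t1 t2].
  have [/andP[g1 g2] E] := HG t ltac:(by rewrite (le_trans Fa t1) (le_trans t2 Fb)).
  split=> //; apply/andP; split; rewrite leNgt; apply/negP => h.
    by have := mono _ _ g1 h (le_trans (ltW ab') b'b); rewrite E ltNge t1.
  by have := mono _ _ (le_trans aa' (ltW ab')) h g2; rewrite E ltNge t2.
split=> // t /andP[t1 t2].
have [/andP[g1 g2] E] := H t ltac:(by rewrite !ltW).
rewrite !lt_neqAle g1 g2 !andbT; apply/andP; split; apply/eqP => h.
  by move: t1; rewrite h E ltxx.
by move: t2; rewrite -h E ltxx.
Qed.

End Inverse.

Section Dive.
Context {R : realType}.
Variables (f df : R -> R) (A B M : R).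
Hypothesis pf : profile f df A B M.
Variable x : R.
Hypothesis xI : A < x < B.
Implicit Types u v t y : R.
Local Notation uu := (log_radius B x).
Local Notation ss := (radial_rate f df B x).
Local Notation ww := (radial_rate_inv f df B x).
Local Notation SS := (half_angle_time f df B x).
Local Notation II := (radial_action f df B x).

Let xI' : A <= x < B. Proof. by case/andP: xI => /ltW -> ->. Qed.

Definition angle_density v := 2 * (B - x) * ww v.
Definition time_density v := f (uu v) * angle_density v.
(** Polar angle as a function of [v], from the turning point; the lower limit of
    integration lies below all values of [v] that occur on the ray. *)
Definition angle_prim v := Rint (-2) v angle_density - Rint (-2) 0 angle_density.
Definition time_prim v := Rint (-2) v time_density - Rint (-2) 0 time_density.

Lemma angle_density_ctn v : ctn v angle_density.
Proof. by rewrite /angle_density; cts; exact: (radial_rate_inv_cont pf). Qed.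

Lemma f_log_radius_ctn v : ctn v (fun y => f (uu y)).
Proof. by apply: ctn_comp; [exact: (pf_cont pf)|exact: log_radius_cont]. Qed.

Lemma time_density_ctn v : ctn v time_density.
Proof. by rewrite /time_density; cts; [exact: f_log_radius_ctn|exact: angle_density_ctn]. Qed.

Lemma angle_density_gt0 v : 0 < angle_density v.
Proof.
have h := xI; have w0 := radial_rate_inv_gt0 pf v xI'.
by rewrite /angle_density mulr_gt0//; lra.
Qed.

Lemma f_log_radius_gt0 v : 0 < f (uu v).
Proof.
have h := xI; have xB : x < B by lra.
by have := log_radius_ge v xB => ?; apply: (pf_pos pf); lra.
Qed.

Lemma time_density_gt0 v : 0 < time_density v.
Proof. by rewrite /time_density mulr_gt0 ?f_log_radius_gt0 ?angle_density_gt0. Qed.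

Lemma der_angle_prim v : -2 < v < 2 -> is_derive v 1 angle_prim (angle_density v).
Proof.
move=> vI; have [v1 v2] : -2 < v /\ v < 2 by lra.
have c : cont_itv (-2) 2 angle_density by move=> z _; exact: angle_density_ctn.
have D := Rint_FTC1 v1 v2 c.
exact: (is_derive_eq (der_add D (der_cst _ v)) (addr0 _)).
Qed.

Lemma der_time_prim v : -2 < v < 2 -> is_derive v 1 time_prim (time_density v).
Proof.
move=> vI; have [v1 v2] : -2 < v /\ v < 2 by lra.
have c : cont_itv (-2) 2 time_density by move=> z _; exact: time_density_ctn.
have D := Rint_FTC1 v1 v2 c.
exact: (is_derive_eq (der_add D (der_cst _ v)) (addr0 _)).
Qed.

(** The primitive of an even function that vanishes at [0] is odd: the ray is
    symmetric about its turning point. *)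
Lemma prim_odd (F g : R -> R) : (forall v : R, -2 < v < 2 -> is_derive v 1 F (g v)) ->
  (forall v, g (- v) = g v) -> F 0 = 0 -> forall v, 0 <= v < 2 -> F (- v) = - F v.
Proof.
move=> dF gN F0 v vI.
pose H y := F y + F (- y).
have dH y : -2 < y < 2 -> is_derive y 1 H 0.
  move=> yI.
  have D1 := dF y yI.
  have D2 : is_derive y 1 (fun y => F (- y)) (g (- y) * (- 1)).
    have D2 := dF (- y) ltac:(lra).
    exact: (der_comp (g := fun y => - y) D2 (der_opp (der_id y))).
  by rewrite /H; eapply is_derive_eq; [der|rewrite gN; ring].
have H0 : H 0 = 0 by rewrite /H oppr0 F0 addr0.
suff : H v = 0 by rewrite /H; lra.
move: vI => /andP[]; rewrite le_eqVlt => /predU1P[<-//|v0 v2].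
have [z zI|z|z zI] := @mvt_lin _ H (fun=> 0) 0 v v0.
- by apply: is_derive_continuous (dH z _); lra.
- by move=> zI; apply: dH; lra.
- by rewrite H0 mul0r; lra.
Qed.

Lemma angle_densityN v : angle_density (- v) = angle_density v.
Proof. by rewrite /angle_density /ww radial_rateN. Qed.

Lemma angle_primN1 : angle_prim (-1) = - angle_prim 1.
Proof.
apply: (prim_odd der_angle_prim angle_densityN); first by rewrite /angle_prim subrr.
by rewrite ler01 ltr1n.
Qed.

Lemma time_primN1 : time_prim (-1) = - time_prim 1.
Proof.
apply: (prim_odd der_time_prim); [by move=> v; rewrite /time_density angle_densityN log_radiusN|by rewrite /time_prim subrr|].
by rewrite ler01 ltr1n.
Qed.

Lemma angle_prim1 : angle_prim 1 = SS.
Proof.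
rewrite /angle_prim (@Rint_split _ (-2) 0 1); [by rewrite addrC addKr|lra|lra|].
by move=> z _; exact: angle_density_ctn.
Qed.

Lemma f_log_radiusE v : f (uu v) = f x + (v * ss v) ^+ 2.
Proof. by rewrite exprMn (radial_rate_sqr pf _ xI') mulrC; exact: slowness_quotientE. Qed.

(** Travel time is the integral of [f] and the action that of [f - p^2], both
    against [du / sqrt (f - p^2)]. *)
Lemma time_prim1 : 2 * time_prim 1 = II + 2 * f x * SS.
Proof.
have -> : time_prim 1 = Rint 0 1 time_density.
  rewrite /time_prim (@Rint_split _ (-2) 0 1); [by rewrite addrC addKr|lra|lra|].
  by move=> z _; exact: time_density_ctn.
have c1 : cont_itv 0 1 time_density by move=> z _; exact: time_density_ctn.
have c2 : cont_itv 0 1 angle_density by move=> z _; exact: angle_density_ctn.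
have c3 : cont_itv 0 1 (fun v => 4 * (B - x) * v ^+ 2 * ss v).
  by move=> z _; cts; apply: (radial_rate_cont pf); case/andP: xI.
have c4 : cont_itv 0 1 (fun v => 2 * f x * angle_density v) by move=> z _; cts; exact: angle_density_ctn.
rewrite -(Rint_Z _ c1) -(Rint_Z _ c2) -(Rint_D c3 c4).
apply: Rint_ext => v _; rewrite /time_density f_log_radiusE /angle_density /ww.
have s0 : ss v != 0 by rewrite gt_eqF// (radial_rate_gt0 pf).
by field.
Qed.

Definition dive_momentum := Num.sqrt (f x).

Lemma dive_momentum_gt0 : 0 < dive_momentum.
Proof. by rewrite sqrtr_gt0; apply: (pf_pos pf); case/andP: xI' => h _. Qed.

Lemma dive_momentum_sqr : dive_momentum ^+ 2 = f x.
Proof. by rewrite /dive_momentum sqr_sqrtr//; apply/ltW/(pf_pos pf); case/andP: xI'. Qed.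

(** The interval is larger than [[-1, 1]], so that the inverse is differentiable
    at both ends of the ray. *)
Lemma param_of_time_exists : exists G : R -> R, [/\
    forall v, -3/2 <= v <= 3/2 -> G (time_prim v) = v,
    forall v, -3/2 < v < 3/2 -> is_derive (time_prim v) 1 G (time_density v)^-1,
    forall t, time_prim (-3/2) <= t <= time_prim (3/2) -> -3/2 <= G t <= 3/2 /\ time_prim (G t) = t &
    forall u v, -3/2 <= u -> u < v -> v <= 3/2 -> time_prim u < time_prim v].
Proof.
apply: inverse_fun; first lra.
- by move=> v vI; apply: der_time_prim; lra.
- by move=> v _; exact: time_density_gt0.
Qed.

Definition param_of_time : R -> R := projT1 (cid param_of_time_exists).

(** The parameter [v] as a function of time; the ray starts at [v = -1] and its
    lowest point [v = 0] is at half of its duration. *)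
Definition dive_param t := param_of_time (t - time_prim 1).

Lemma dive_param0 : dive_param 0 = -1.
Proof.
by rewrite /dive_param sub0r -time_primN1 /param_of_time; case: (cid param_of_time_exists) => G /= [H _ _ _]; apply: H; lra.
Qed.

Lemma dive_param_end : dive_param (2 * time_prim 1) = 1.
Proof.
rewrite /dive_param (_ : _ - _ = time_prim 1); last by ring.
by rewrite /param_of_time; case: (cid param_of_time_exists) => G /= [H _ _ _]; apply: H; lra.
Qed.

Lemma time_prim1_gt0 : 0 < time_prim 1.
Proof.
have [G [_ _ _ H]] := param_of_time_exists.
by have := H (-1) 1 ltac:(lra) ltac:(lra) ltac:(lra); rewrite time_primN1; lra.
Qed.

Lemma dive_param_mid : dive_param (time_prim 1) = 0.
Proof.
have T0 : time_prim 0 = 0 by rewrite /time_prim subrr.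
rewrite /dive_param subrr -{1}T0.
by rewrite /param_of_time; case: (cid param_of_time_exists) => G /= [H _ _ _]; apply: H; lra.
Qed.

Lemma der_dive_param t : 0 <= t <= 2 * time_prim 1 -> -1 <= dive_param t <= 1 /\ is_derive t 1 dive_param (time_density (dive_param t))^-1.
Proof.
have [e1 e2 e3] : [/\ -3/2 <= -1 :> R, -1 < 1 :> R & 1 <= 3/2 :> R] by split; lra.
move=> tI; have tI' : time_prim (-1) <= t - time_prim 1 <= time_prim 1 by rewrite time_primN1; lra.
rewrite /dive_param /param_of_time; case: (cid param_of_time_exists) => G /= [H1 H2 H3 H4].
have [H _] := inverse_range e1 e2 e3 H3 H4.
have [GI E] := H _ tI'.
split => //.
have GI' : -3/2 < G (t - time_prim 1) < 3/2 by move: GI => /andP[GI1 GI2]; rewrite (lt_le_trans _ GI1) ?(le_lt_trans GI2)//; lra.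
have D := H2 _ GI'; rewrite E in D.
have D2 : is_derive t 1 (fun t => t - time_prim 1) 1.
  by eapply is_derive_eq; [der|rewrite addr0].
exact: (is_derive_eq (der_comp (g := fun t => t - time_prim 1) D D2) (mulr1 _)).
Qed.

Lemma dive_param_inner t : 0 < t < 2 * time_prim 1 -> -1 < dive_param t < 1.
Proof.
have [e1 e2 e3] : [/\ -3/2 <= -1 :> R, -1 < 1 :> R & 1 <= 3/2 :> R] by split; lra.
move=> tI; have tI' : time_prim (-1) < t - time_prim 1 < time_prim 1 by rewrite time_primN1; lra.
rewrite /dive_param /param_of_time; case: (cid param_of_time_exists) => G /= [H1 H2 H3 H4].
have [_ H] := inverse_range e1 e2 e3 H3 H4.
exact: H tI'.
Qed.

Definition dive_log_radius t := uu (dive_param t).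
Definition dive_radial_momentum t := dive_param t * ss (dive_param t).
Definition dive_angle phi0 t := phi0 + dive_momentum * (angle_prim (dive_param t) + angle_prim 1).

Lemma f_dive_log_radius t : f (dive_log_radius t) = dive_momentum ^+ 2 + dive_radial_momentum t ^+ 2.
Proof. by rewrite dive_momentum_sqr /dive_log_radius f_log_radiusE. Qed.

Lemma f_dive_log_radius_gt0 t : 0 < f (dive_log_radius t).
Proof. exact: f_log_radius_gt0. Qed.

Lemma der_dive_log_radius t : 0 <= t <= 2 * time_prim 1 -> is_derive t 1 dive_log_radius (dive_radial_momentum t / f (dive_log_radius t)).
Proof.
move=> /der_dive_param[vI D].
apply: (is_derive_eq (der_comp (der_log_radius_v B x (dive_param t)) D)).
have f0 := f_dive_log_radius_gt0 t; have s0 := radial_rate_gt0 pf (dive_param t) xI'.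
have B0 : 0 < B - x by case/andP: xI; lra.
rewrite /time_density /angle_density /ww -/(dive_log_radius t) /dive_radial_momentum; field.
by rewrite !gt_eqF.
Qed.

Lemma der_dive_radial_momentum t : 0 <= t <= 2 * time_prim 1 -> is_derive t 1 dive_radial_momentum (df (dive_log_radius t) / (2 * f (dive_log_radius t))).
Proof.
move=> /der_dive_param[vI D].
apply: (is_derive_eq (der_comp (g := dive_param) (der_radial_momentum_v pf (dive_param t) xI') D)).
have f0 := f_dive_log_radius_gt0 t; have s0 := radial_rate_gt0 pf (dive_param t) xI'.
have B0 : 0 < B - x by case/andP: xI; lra.
rewrite /time_density /angle_density /ww -/(dive_log_radius t); field.
by rewrite !gt_eqF.
Qed.

Lemma der_dive_angle phi0 t : 0 <= t <= 2 * time_prim 1 -> is_derive t 1 (dive_angle phi0) (dive_momentum / f (dive_log_radius t)).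
Proof.
move=> /der_dive_param[vI D].
have D1 : is_derive (dive_param t) 1 angle_prim (angle_density (dive_param t)) by apply: der_angle_prim; lra.
have D2 := der_comp (g := dive_param) D1 D.
rewrite /dive_angle; eapply is_derive_eq; first by der.
have f0 := f_dive_log_radius_gt0 t; have h0 := angle_density_gt0 (dive_param t).
rewrite /time_density -/(dive_log_radius t) /=; field.
by rewrite !gt_eqF.
Qed.

(** The ray in Cartesian coordinates: radius [e^u], polar angle, and the
    covector with radial part [v * radial_rate] and angular part the momentum,
    both divided by the radius. *)
Definition dive_leg phi0 : phase_curve R := PhaseCurve (2 * time_prim 1)
  (fun t => expR (dive_log_radius t) * cos (dive_angle phi0 t))
  (fun t => expR (dive_log_radius t) * sin (dive_angle phi0 t))
  (fun t => expR (- dive_log_radius t) * (dive_radial_momentum t * cos (dive_angle phi0 t) - dive_momentum * sin (dive_angle phi0 t)))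
  (fun t => expR (- dive_log_radius t) * (dive_radial_momentum t * sin (dive_angle phi0 t) + dive_momentum * cos (dive_angle phi0 t))).

Let expNR u : expR (- u) = (expR u)^-1. Proof. exact: expRN. Qed.

Lemma dive_derive phi0 t : 0 <= t <= 2 * time_prim 1 ->
  let g := dive_leg phi0 in
  [/\ is_derive t 1 (x1 g) (expR (dive_log_radius t) ^+ 2 / f (dive_log_radius t) * p1 g t),
      is_derive t 1 (x2 g) (expR (dive_log_radius t) ^+ 2 / f (dive_log_radius t) * p2 g t),
      is_derive t 1 (p1 g) (expR (- dive_log_radius t) * (df (dive_log_radius t) / (2 * f (dive_log_radius t)) - 1) * cos (dive_angle phi0 t)) &
      is_derive t 1 (p2 g) (expR (- dive_log_radius t) * (df (dive_log_radius t) / (2 * f (dive_log_radius t)) - 1) * sin (dive_angle phi0 t))].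
Proof.
move=> tI g.
have Du := der_dive_log_radius tI; have Ds := der_dive_radial_momentum tI; have Df := der_dive_angle phi0 tI.
have e0 := expR_gt0 (dive_log_radius t); have f0 := f_dive_log_radius_gt0 t.
have P0 : dive_momentum != 0 by rewrite gt_eqF// dive_momentum_gt0.
rewrite /g /=; split; eapply is_derive_eq; try by der.
- by rewrite /= !expNR; field; rewrite !gt_eqF.
- by rewrite /= !expNR; field; rewrite !gt_eqF.
- rewrite /= !expNR.
  have E : (dive_radial_momentum t ^+ 2 + dive_momentum ^+ 2) / f (dive_log_radius t) = 1 by rewrite addrC -f_dive_log_radius divff// gt_eqF.
  transitivity ((expR (dive_log_radius t))^-1 * (df (dive_log_radius t) / (2 * f (dive_log_radius t)) - (dive_radial_momentum t ^+ 2 + dive_momentum ^+ 2) / f (dive_log_radius t)) * cos (dive_angle phi0 t)).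
    by field; rewrite !gt_eqF.
  by rewrite E.
- rewrite /= !expNR.
  have E : (dive_radial_momentum t ^+ 2 + dive_momentum ^+ 2) / f (dive_log_radius t) = 1 by rewrite addrC -f_dive_log_radius divff// gt_eqF.
  transitivity ((expR (dive_log_radius t))^-1 * (df (dive_log_radius t) / (2 * f (dive_log_radius t)) - (dive_radial_momentum t ^+ 2 + dive_momentum ^+ 2) / f (dive_log_radius t)) * sin (dive_angle phi0 t)).
    by field; rewrite !gt_eqF.
  by rewrite E.
Qed.

Lemma sqrt_sqr_gt0 y : 0 < y -> Num.sqrt (y ^+ 2) = y.
Proof. by move=> y0; rewrite sqrtr_sqr gtr0_norm. Qed.

Lemma dive_radius phi0 t : Defs.radius (dive_leg phi0) t = expR (dive_log_radius t).
Proof.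
rewrite /Defs.radius /= !exprMn -mulrDr cos2Dsin2 mulr1 sqrt_sqr_gt0//.
exact: expR_gt0.
Qed.

Lemma dive_conorm phi0 t :
  conorm (dive_leg phi0) t = expR (- dive_log_radius t) * Num.sqrt (f (dive_log_radius t)).
Proof.
rewrite /conorm /= !exprMn -mulrDr.
rewrite (_ : _ + _ = f (dive_log_radius t)); last first.
  rewrite f_dive_log_radius -[dive_momentum ^+ 2]mulr1 -[dive_radial_momentum t ^+ 2]mulr1 -(cos2Dsin2 (dive_angle phi0 t)); ring.
by rewrite sqrtrM ?sqr_ge0// sqrt_sqr_gt0// expR_gt0.
Qed.

Lemma dive_angular phi0 t : angular_momentum (dive_leg phi0) t = dive_momentum.
Proof.
rewrite /angular_momentum /= expNR.
have e0 : expR (dive_log_radius t) != 0 by rewrite gt_eqF// expR_gt0.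
transitivity (dive_momentum * (cos (dive_angle phi0 t) ^+ 2 + sin (dive_angle phi0 t) ^+ 2)); last by rewrite cos2Dsin2 mulr1.
by field.
Qed.

Lemma dive_log_radius_inner t : 0 < t < 2 * time_prim 1 -> x <= dive_log_radius t < B.
Proof.
move=> /dive_param_inner vI; have xB : x < B by case/andP: xI.
rewrite /dive_log_radius log_radius_ge//=.
have v2 : (dive_param t) ^+ 2 < 1.
  by rewrite -[dive_param t ^+ 2]real_normK ?num_real// expr_lt1// ltr_norml.
have h : (B - x) * dive_param t ^+ 2 < (B - x) * 1 by rewrite ltr_pM2l//; lra.
by rewrite /log_radius; lra.
Qed.

(** [f] and [df] come from the speed [c] by [f u = (e^u / c(e^u))^2]. *)
Definition adapted (c : R -> R) := forall u, A < u < B ->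
  [/\ 0 < c (expR u), f u = (expR u / c (expR u)) ^+ 2 &
      exists2 l, is_derive (expR u) 1 c l &
        df u = 2 * f u * (1 - expR u * l / c (expR u))].

Lemma dive_continuous phi0 : continuous_curve (dive_leg phi0).
Proof.
split; apply: cont_itv_within => t tI; have [D1 D2 D3 D4] := dive_derive phi0 tI.
- exact: is_derive_continuous D1.
- exact: is_derive_continuous D2.
- exact: is_derive_continuous D3.
- exact: is_derive_continuous D4.
Qed.

(** In logarithmic polar coordinates Hamilton's equations are
    [u' = sigma / f], [phi' = p / f], [sigma' = f' / (2 f)] with
    [sigma^2 = f - p^2], which is how the ray was defined. *)
Lemma dive_geodesic c phi0 : adapted c -> unit_geodesic c (dive_leg phi0).
Proof.
move=> ad; have T0 := time_prim1_gt0; split.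
- by rewrite /= mulr_gt0//.
- exact: dive_continuous.
- move=> t /= tI.
  have tI' : 0 <= t <= 2 * time_prim 1 by lra.
  have uI := dive_log_radius_inner tI.
  have [c0 fE [l Dc dfE]] := ad (dive_log_radius t) ltac:(by move: xI uI; lra).
  have e0 := expR_gt0 (dive_log_radius t).
  have [D1 D2 D3 D4] := dive_derive phi0 tI'.
  have cE : expR (dive_log_radius t) ^+ 2 / f (dive_log_radius t) = c (expR (dive_log_radius t)) ^+ 2.
    by rewrite fE; field; rewrite !gt_eqF.
  have nE : conorm (dive_leg phi0) t = (c (expR (dive_log_radius t)))^-1.
    rewrite dive_conorm fE sqrt_sqr_gt0 ?divr_gt0// expNR.
    by field; rewrite !gt_eqF.
  rewrite nE dive_radius; split.
  + by rewrite divff// gt_eqF.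
  + by split; [apply: (is_derive_eq D1)|apply: (is_derive_eq D2)]; rewrite cE.
  + move=> _ /=; rewrite (is_derive1E Dc).
    have f0 := f_dive_log_radius_gt0 t.
    have E : df (dive_log_radius t) / (2 * f (dive_log_radius t)) - 1 = - (expR (dive_log_radius t) * l / c (expR (dive_log_radius t))).
      by rewrite dfE; field; rewrite !gt_eqF.
    split; [apply: (is_derive_eq D3)|apply: (is_derive_eq D4)];
      by rewrite E expNR /=; field; rewrite !gt_eqF.
Qed.

Lemma dive_radius0 phi0 : Defs.radius (dive_leg phi0) 0 = expR B.
Proof. by rewrite dive_radius /dive_log_radius dive_param0 log_radiusN log_radius1. Qed.

Lemma dive_radius_end phi0 : Defs.radius (dive_leg phi0) (dur (dive_leg phi0)) = expR B.
Proof. by rewrite dive_radius /dive_log_radius /= dive_param_end log_radius1. Qed.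

Lemma dive_radius_inner phi0 t : 0 < t < dur (dive_leg phi0) ->
  expR x <= Defs.radius (dive_leg phi0) t < expR B.
Proof.
by move=> /dive_log_radius_inner /andP[h1 h2]; rewrite dive_radius ler_expR h1 ltr_expR.
Qed.

Lemma dive_maximal c phi0 : adapted c ->
  maximal_geodesic c (expR B) (expR x) (dive_leg phi0).
Proof.
move=> ad; have T0 := time_prim1_gt0; split.
- exact: dive_geodesic.
- exact: dive_radius0.
- exact: dive_radius_end.
- exact: dive_radius_inner.
- exists (time_prim 1); first by rewrite /=; lra.
  by rewrite dive_radius /dive_log_radius dive_param_mid log_radius0.
Qed.

Lemma dive_start phi0 : x1 (dive_leg phi0) 0 = expR B * cos phi0 /\
  x2 (dive_leg phi0) 0 = expR B * sin phi0.
Proof.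
rewrite /= /dive_log_radius /dive_angle dive_param0 log_radiusN log_radius1 angle_primN1.
by rewrite (_ : phi0 + _ = phi0)//; ring.
Qed.

Definition opening_angle := 2 * dive_momentum * SS.

Lemma dive_stop phi0 : let g := dive_leg phi0 in
  x1 g (dur g) = expR B * cos (phi0 + opening_angle) /\
  x2 g (dur g) = expR B * sin (phi0 + opening_angle).
Proof.
rewrite /= /dive_log_radius /dive_angle dive_param_end log_radius1 angle_prim1 /opening_angle.
by rewrite (_ : phi0 + dive_momentum * _ = phi0 + 2 * dive_momentum * SS)//; ring.
Qed.

Lemma dive_dur phi0 : dur (dive_leg phi0) = II + dive_momentum * opening_angle.
Proof. by rewrite /= time_prim1 /opening_angle -dive_momentum_sqr; ring. Qed.

End Dive.

(** * The normal Jacobi field of a diving geodesic *)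

Section Lip.
Context {R : realType}.
Implicit Types (g h F : R -> R) (a b : R).

Lemma cont_bdd a b g : a <= b -> cont_itv a b g ->
  exists2 C, 0 < C & forall z, a <= z <= b -> `|g z| <= C.
Proof.
move=> ab cg.
have cn : cont_itv a b (fun z => `|g z|).
  by move=> z zI; apply: ctn_norm; exact: cg.
have [c cI H] := EVT_max ab (cont_itv_within cn).
exists (1 + `|g c|); first by have := normr_ge0 (g c); lra.
by move=> z zI; have := H z; rewrite in_itv/= => /(_ zI); lra.
Qed.

Lemma cont_low a b g : a <= b -> cont_itv a b g ->
  (forall z, a <= z <= b -> 0 < g z) ->
  exists2 k, 0 < k & forall z, a <= z <= b -> k <= g z.
Proof.
move=> ab cg g0; have [c cI H] := EVT_min ab (cont_itv_within cg).
exists (g c); first by apply: g0; move: cI; rewrite in_itv.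
by move=> z zI; apply: H; rewrite in_itv.
Qed.

Definition lip a b g := exists2 C, 0 <= C & forall u v, a <= u -> u <= v -> v <= b ->
  `|g v - g u| <= C * (v - u).

Lemma lip_derive a b F (F' : R -> R) :
  (forall z, a <= z <= b -> is_derive z 1 F (F' z)) ->
  (exists C, forall z, a <= z <= b -> `|F' z| <= C) -> lip a b F.
Proof.
move=> dF [C HC].
exists `|C| => // u v au; rewrite le_eqVlt => /predU1P[->|uv] vb.
  by rewrite !subrr normr0 mulr0.
have [z zI|z|z zI ->] := @mvt_lin _ F F' u v uv.
- by apply: is_derive_continuous (dF z _); lra.
- by move=> zI; apply: dF; lra.
- rewrite normrM (gtr0_norm (x := v - u)) ?subr_gt0// ler_wpM2r//; first lra.
  by apply: le_trans (HC z _) (ler_norm _); lra.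
Qed.

Lemma lip_bdd a b g : a <= b -> lip a b g ->
  exists2 E, 0 < E & forall z, a <= z <= b -> `|g z| <= E.
Proof.
move=> ab [C C0 gC]; exists (1 + `|g a| + C * (b - a)).
  by rewrite ltr_wpDr ?ltr_wpDr// mulr_ge0// subr_ge0.
move=> z /andP[az zb].
have h := gC a z (lexx _) az zb.
have h2 : C * (z - a) <= C * (b - a) by rewrite ler_wpM2l// lerB.
have -> : g z = g a + (g z - g a) by ring.
by apply: (le_trans (ler_normD _ _)); move: h h2; lra.
Qed.

Lemma lipM a b g h : a <= b -> lip a b g -> lip a b h ->
  lip a b (fun z => g z * h z).
Proof.
move=> ab lg lh.
have [E E0 gE] := lip_bdd ab lg; have [G G0 hG] := lip_bdd ab lh.
have [C C0 gC] := lg; have [D D0 hD] := lh.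
exists (C * G + E * D) => [|u v au uv vb]; first by rewrite addr_ge0// mulr_ge0// ltW.
have -> : g v * h v - g u * h u = (g v - g u) * h v + g u * (h v - h u) by ring.
rewrite (le_trans (ler_normD _ _))// !normrM mulrDl lerD//.
  rewrite mulrAC ler_pM//; first exact: gC.
  by apply: hG; lra.
rewrite -mulrA ler_pM//; last exact: hD.
by apply: gE; lra.
Qed.

Lemma lipD a b g h : lip a b g -> lip a b h -> lip a b (fun z => g z + h z).
Proof.
move=> [C C0 gC] [D D0 hD]; exists (C + D) => [|u v au uv vb]; first exact: addr_ge0.
rewrite opprD addrACA mulrDl (le_trans (ler_normD _ _))// lerD//; first exact: gC.
exact: hD.
Qed.

Lemma lip_norm a b g : lip a b g -> exists2 C, 0 <= C &
  forall u v, a <= u <= b -> a <= v <= b -> `|g v - g u| <= C * `|v - u|.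
Proof.
move=> [C C0 H]; exists C => // u v /andP[au ub] /andP[av vb].
have [uv|/ltW vu] := leP u v.
  by rewrite (ger0_norm (x := v - u)) ?subr_ge0//; exact: H.
by rewrite distrC (distrC v) (ger0_norm (x := u - v)) ?subr_ge0//; exact: H.
Qed.

Lemma lip_comp a b a' b' g h : lip a' b' g -> lip a b h ->
  (forall z, a <= z <= b -> a' <= h z <= b') -> lip a b (fun z => g (h z)).
Proof.
move=> /lip_norm[C C0 HC] [D D0 HD] hI; exists (C * D) => [|u v au uv vb].
  exact: mulr_ge0.
apply: (le_trans (HC _ _ (hI u _) (hI v _))); [lra..|].
by rewrite -mulrA ler_wpM2l// HD.
Qed.

Definition clamp a b (t : R) := Num.max a (Num.min t b).

Lemma clampE a b t : a <= t <= b -> clamp a b t = t.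
Proof. by move=> /andP[at_ tb]; rewrite /clamp min_l// max_r. Qed.

Lemma clamp_itv a b t : a <= b -> a <= clamp a b t <= b.
Proof. by move=> ab; rewrite /clamp le_max lexx ge_max ab ge_min lexx orbT. Qed.

(** Composition with the projection on [[a, b]] turns a Lipschitz function on
    the interval into a global one. *)
Lemma lip_clamp a b g : a <= b -> lip a b g -> exists2 C, 0 <= C &
  forall s t, `|g (clamp a b s) - g (clamp a b t)| <= C * `|s - t|.
Proof.
move=> ab /lip_norm[C C0 HC]; exists C => // s t.
apply: (le_trans (HC _ _ (clamp_itv t ab) (clamp_itv s ab))).
rewrite ler_wpM2l//.
have h1 := ler_norm (s - t); have h2 := ler_norm (t - s); rewrite distrC in h2.
rewrite ler_norml /clamp.
clear -ab h1 h2; case: (lerP s b) => sb; case: (lerP t b) => tb;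
  rewrite ?(ltW sb) ?(ltW tb) ?sb ?tb;
  repeat match goal with |- context [Num.max ?p ?q] => case: (lerP p q) => ? end; lra.
Qed.

Lemma lip_within a b g : a <= b -> lip a b g -> {within `[a, b], continuous g}.
Proof.
move=> ab /(lip_clamp ab)[C C0 HC].
have cg : continuous (fun t => g (clamp a b t)).
  move=> t; apply/continuousP_eps => e e0; exists (e / (C + 1)).
    by rewrite divr_gt0//; lra.
  move=> y yd; apply: (le_lt_trans (HC y t)).
  move: yd; rewrite ltr_pdivlMr; last by lra.
  by have := normr_ge0 (y - t); lra.
apply: (@subspace_eq_continuous _ _ _ (fun t => g (clamp a b t))).
  by move=> t; rewrite inE/= in_itv/= => tI; rewrite clampE.
exact: continuous_subspaceT.
Qed.

Lemma odd_lip g C : 0 <= C -> (forall v, g (- v) = - g v) ->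
  (forall u v, 0 <= u -> u <= v -> v <= 1 -> `|g v - g u| <= C * (v - u)) ->
  forall u v, -1 <= u <= 1 -> -1 <= v <= 1 -> `|g v - g u| <= C * `|v - u|.
Proof.
move=> C0 gN H.
have g0 : g 0 = 0 by have := gN 0; rewrite oppr0; lra.
suff W u v : -1 <= u -> u <= v -> v <= 1 -> `|g v - g u| <= C * (v - u).
  move=> u v uI vI; have [uv|/ltW vu] := leP u v.
    by rewrite (ger0_norm (x := v - u)) ?subr_ge0//; apply: W; lra.
  by rewrite distrC (distrC v) (ger0_norm (x := u - v)) ?subr_ge0//; apply: W; lra.
move=> u1 uv v1; have [u0|u0] := leP 0 u; first exact: H.
have [v0|v0] := leP v 0.
  have := H (- v) (- u) ltac:(lra) ltac:(lra) ltac:(lra).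
  by rewrite !gN (_ : - g u - - g v = g v - g u); [move/le_trans; apply; lra|ring].
have := H 0 v (lexx _) (ltW v0) v1; have := H 0 (- u) (lexx _) ltac:(lra) ltac:(lra).
rewrite g0 !gN !subr0 normrN => h1 h2.
by apply: (le_trans (ler_normB _ _)); move: h1 h2; lra.
Qed.

(** Integrals over half-open intervals, for functions that are continuous and
    bounded off the left end. *)
Lemma oint_abs a b g C : a <= b -> (forall z, a < z <= b -> {for z, continuous g}) ->
  (forall z, a < z <= b -> `|g z| <= C) ->
  lebesgue_measure.-integrable `]a, b] (EFin \o g) /\
  `|\int[lebesgue_measure]_(z in `]a, b]) g z| <= C * (b - a).
Proof.
move=> ab cg gC.
have mab : (@lebesgue_measure R `]a, b]%classic < +oo)%E.
  by rewrite /= lebesgue_measure_itv/= lte_fin; case: ifPn => _; rewrite -?EFinB ltry.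
have ig : lebesgue_measure.-integrable `]a, b] (EFin \o g).
  apply: measurable_bounded_integrable => //.
  - apply: measurable_realfun.subspace_continuous_measurable_fun => //.
    by apply: continuous_in_subspaceT => z; rewrite inE/= in_itv/=; exact: cg.
  - exists C; split; first exact: num_real.
    move=> D CD y /=; rewrite in_itv/= => yI.
    exact: le_trans (gC y yI) (ltW CD).
split => //.
apply: (le_trans (le_normr_Rintegral _ ig)) => //.
have -> : C * (b - a) = (\int[lebesgue_measure]_(z in `]a, b]) (fun=> C) z)%R.
  rewrite Rintegral_cst//= lebesgue_measure_itv/= lte_fin.
  by case: ltgtP ab => //= ->; rewrite subrr.
apply: le_Rintegral => //.
- exact: (@integrable_norm _ _ _ (@lebesgue_measure R) `]a, b]%classic _ ig).
- by apply: measurable_bounded_integrable => //; exact: bounded_cst.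
Qed.

(** A bounded integrand continuous off [0] has a Lipschitz primitive, with the
    expected derivative off [0]. *)
Lemma prim0 (q : R -> R) (C : R) : (forall z : R, 0 < z <= 1 -> {for z, continuous q}) ->
  (forall z : R, 0 < z <= 1 -> `|q z| <= C) ->
  (forall u v : R, 0 <= u -> u <= v -> v <= 1 -> `|Rint 0 v q - Rint 0 u q| <= C * (v - u)) /\
  (forall v : R, 0 < v < 1 -> is_derive v 1 (fun y => Rint 0 y q) (q v)).
Proof.
move=> cq qC.
have [i01 _] := oint_abs ler01 cq qC.
have iI : lebesgue_measure.-integrable `[0, 1] (EFin \o q).
  apply: measurable_bounded_integrable => //.
  - by rewrite /= lebesgue_measure_itv/= lte_fin ltr01 -EFinB ltry.
  - apply/measurable_realfun.measurable_fun_itv_obnd_cbndP.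
    apply: measurable_realfun.subspace_continuous_measurable_fun => //.
    by apply: continuous_in_subspaceT => z; rewrite inE/= in_itv/=; exact: cq.
  - exists (Num.max C `|q 0|); split; first exact: num_real.
    move=> D CD y /=; rewrite in_itv/= => /andP[y0 y1].
    apply: le_trans (ltW CD); rewrite le_max.
    move: y0; rewrite le_eqVlt => /predU1P[<-|y0]; first by rewrite lexx orbT.
    by rewrite qC// y0.
split.
  move=> u v u0 uv v1.
  have iv : lebesgue_measure.-integrable `[0, v] (EFin \o q).
    by apply: integrableS iI => //; apply: subset_itvl; rewrite bnd_simp.
  have := @Rintegral_itvB _ q (BLeft 0) (BRight v) u iv.
  rewrite !bnd_simp => /(_ u0 uv); rewrite /Rint => ->.
  have c' z : u < z <= v -> {for z, continuous q} by move=> zI; apply: cq; lra.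
  have b' z : u < z <= v -> `|q z| <= C by move=> zI; apply: qC; lra.
  by have [_] := oint_abs uv c' b'.
move=> v /andP[v0 v1].
have [] := @continuous_FTC1_closed _ q 0 v 1 v1 iI v0.
  by apply: cq; lra.
by move=> d <-; exact: derivable_is_derive1.
Qed.

End Lip.

Section Jacobi.
Context {R : realType}.
Variables (f df : R -> R) (A B M : R).
Hypothesis pf : profile f df A B M.
Variable x : R.
Hypothesis xI : A < x < B.
Implicit Types u v t y : R.
Local Notation uu := (log_radius B x).
Local Notation ss := (radial_rate f df B x).
Local Notation ww := (radial_rate_inv f df B x).
Local Notation ee := (slope_quotient df B x).

Let xI' : A <= x < B. Proof. by case/andP: xI => /ltW -> ->. Qed.

(** Time derivative of the radial momentum. *)
Definition log_slope u := df u / (2 * f u).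
(** This is [(log_slope u - log_slope x) / sigma^2 * dt/dv] for the radial
    momentum [sigma = v * radial_rate v], in a form that is visibly bounded at
    the turning point; see [jacobi_densityE]. *)
Definition jacobi_density v := (B - x) * ww v ^+ 3 * ee v - (B - x) * (df x / f x) * ww v.
Definition jacobi_prim v := Rint 0 v jacobi_density.
(** The primitive of the even function [jacobi_density] that vanishes at [0];
    integrals over reversed intervals are zero, hence the case distinction. *)
Definition jacobi_odd v := if 0 <= v then jacobi_prim v else - jacobi_prim (- v).
Definition log_slope_diff v := log_slope (uu v) - log_slope x.
(** The radial momentum [sigma] is the normal component of the Killing field of
    rotations, so it solves the Jacobi equation.  Reduction of order gives the
    second solution [sigma * int dt / sigma^2], divergent at the turning point;
    the formula below is this solution after regularization, normalized to [1]
    at the turning point. *)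
Definition jacobi v := 1 + v * ss v * jacobi_odd v.
(** The time derivative of [jacobi].  The last term vanishes at [v = 0], where
    it is a division by zero. *)
Definition d_jacobi v := log_slope (uu v) * jacobi_odd v + log_slope_diff v / (v * ss v).

Lemma fx_gt0 : 0 < f x.
Proof. by apply: (pf_pos pf); case/andP: xI'. Qed.

Lemma jacobi_density_ctn v : v != 0 -> ctn v jacobi_density.
Proof.
by move=> v0; rewrite /jacobi_density; cts; [exact: (radial_rate_inv_cont pf)|exact: (slope_quotient_cont pf)|exact: (radial_rate_inv_cont pf)].
Qed.

Lemma jacobi_densityN v : jacobi_density (- v) = jacobi_density v.
Proof. by rewrite /jacobi_density /radial_rate_inv /slope_quotient radial_rateN log_radiusN sqrrN. Qed.

Lemma jacobi_density_bdd : exists C, forall v, 0 < v <= 1 -> `|jacobi_density v| <= C.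
Proof.
have [x1 [x2 [Ax1 x1x xx2 x2B]]] := nbhd_itv xI.
have x12 : x1 <= x2 by lra.
have [bw _ _ _ be] := basic_bdd pf Ax1 x12 x2B.
have [C HC] := bdd2D (bdd2M (bdd2M (bdd2C x1 x2 (B - x)) (bdd2X 3 bw)) be)
  (bdd2N (bdd2M (bdd2C x1 x2 ((B - x) * (df x / f x))) bw)).
by exists C => v vI; apply: HC => //; rewrite x1x.
Qed.

Lemma jacobi_prim_props : exists2 C, 0 <= C &
  (forall u v, 0 <= u -> u <= v -> v <= 1 -> `|jacobi_prim v - jacobi_prim u| <= C * (v - u)) /\
  (forall v, 0 < v < 1 -> is_derive v 1 jacobi_prim (jacobi_density v)).
Proof.
have [C HC] := jacobi_density_bdd.
have C0 : 0 <= C by apply: le_trans (HC 1 _); rewrite ?ltr01 ?lexx.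
exists C => //; apply: prim0 HC => z zI.
by apply: jacobi_density_ctn; rewrite gt_eqF//; lra.
Qed.

Lemma jacobi_prim0 : jacobi_prim 0 = 0. Proof. exact: Rint_point. Qed.

Lemma jacobi_oddN v : jacobi_odd (- v) = - jacobi_odd v.
Proof.
rewrite /jacobi_odd; case: (ltgtP 0 v) => [v0|v0|<-].
- by rewrite (_ : 0 <= - v = false) ?opprK//; apply/negbTE; rewrite -ltNge; lra.
- by rewrite (_ : 0 <= - v = true) ?opprK//; lra.
- by rewrite oppr0 lexx jacobi_prim0 oppr0.
Qed.

Lemma der_jacobi_odd v : -1 < v < 1 -> v != 0 -> is_derive v 1 jacobi_odd (jacobi_density v).
Proof.
have [C _ [_ H]] := jacobi_prim_props.
move=> vI v0; case: (ltgtP 0 v) => [vp|vn|E]; last by rewrite E eqxx in v0.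
  apply: (is_derive_near (f := jacobi_prim) (d := v)) => //; last by apply: H; lra.
  by move=> y; rewrite ltr_norml /jacobi_odd => yI; rewrite ifT//; lra.
apply: (is_derive_near (f := fun y => - jacobi_prim (- y)) (d := - v)); first lra.
  move=> y; rewrite ltr_norml /jacobi_odd => yI; rewrite ifF//; apply/negbTE.
  by rewrite -ltNge; lra.
have D := H (- v) ltac:(lra).
have D2 := der_opp (der_comp (g := fun y => - y) D (der_opp (der_id v))).
by apply: (is_derive_eq D2); rewrite jacobi_densityN; ring.
Qed.

Lemma jacobi_densityE v : v != 0 ->
  jacobi_density v = 2 * (B - x) * f (uu v) * ww v * log_slope_diff v / (v ^+ 2 * ss v ^+ 2).
Proof.
move=> v0; have s0 := radial_rate_gt0 pf v xI'; have fx0 := fx_gt0.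
have f0 := f_log_radius_gt0 pf xI v.
have E : f (uu v) = f x + ss v ^+ 2 * v ^+ 2 by rewrite (radial_rate_sqr pf _ xI') -slowness_quotientE.
rewrite /jacobi_density /ee /log_slope_diff /log_slope /radial_rate_inv.
move: f0; rewrite E => f0.
by field; rewrite v0 !gt_eqF// exprMn.
Qed.

(** At the turning point the derivative is read off from
    [|v * radial_rate * jacobi_odd v| <= C v^2]. *)
Lemma der_jacobi v : -1 < v < 1 -> is_derive v 1 jacobi (d_jacobi v * time_density f df B x v).
Proof.
move=> vI; have [->|v0] := eqVneq v 0; last first.
  have D1 := der_jacobi_odd vI v0; have D2 := der_radial_momentum_v pf v xI'.
  have D3 := der_mul D2 D1.
  apply: (is_derive_eq (der_add (der_cst 1 v) D3)).
  rewrite (jacobi_densityE v0) /d_jacobi /time_density /angle_density /log_slope_diff /log_slope /radial_rate_inv.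
  have s0 := radial_rate_gt0 pf v xI'; have fx0 := fx_gt0; have f0 := f_log_radius_gt0 pf xI v.
  by field; rewrite v0 !gt_eqF.
have [C C0 [HL _]] := jacobi_prim_props.
have [E E0 HE] := cont_bdd (a := -1) (b := 1) (g := ss) ltac:(lra)
  (fun z _ => radial_rate_ctn pf xI').
have QB y : `|y| <= 1 -> `|jacobi_odd y| <= C * `|y|.
  move=> y1; rewrite /jacobi_odd; case: ifPn => [y0|]; last rewrite -ltNge => y0.
    have := HL 0 y (lexx _) y0; rewrite jacobi_prim0 !subr0 => H.
    by rewrite (ger0_norm y0) in y1 *; exact: H.
  have := HL 0 (- y) (lexx _); rewrite jacobi_prim0 !subr0 normrN => H.
  by rewrite (ltr0_norm y0) in y1 *; apply: H; lra.
rewrite /d_jacobi /log_slope_diff log_radius0 subrr mul0r addr0 /jacobi_odd lexx jacobi_prim0 mulr0 mul0r.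
apply/is_deriveP_eps => e e0.
exists (Num.min 1 (e / (E * C + 1))).
  by rewrite lt_min ltr01 divr_gt0// ltr_wpDl// mulr_ge0// ltW.
move=> y; rewrite subr0 lt_min => /andP[y1 yd].
rewrite mul0r subr0 /jacobi mul0r mul0r addr0 [1 + _]addrC addrK.
have y1' : `|y| <= 1 by exact: ltW.
have h1 := QB y y1'; have h2 : `|ss y| <= E by apply: HE; rewrite -ler_norml.
rewrite !normrM -mulrA mulrC ler_wpM2r//.
have h3 : `|ss y| * `|jacobi_odd y| <= E * (C * `|y|) by rewrite ler_pM.
apply: (le_trans h3).
have h4 : (E * C + 1) * `|y| <= e.
  by rewrite mulrC -ler_pdivlMr ?ltW// ltr_wpDl// mulr_ge0// ltW.
by rewrite mulrA; have := normr_ge0 y; lra.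
Qed.

End Jacobi.

(** * Lipschitz functions are differentiable almost everywhere *)

Section Rademacher.
Context {R : realType}.
Local Notation mu := (@lebesgue_measure R).

(** The Stieltjes measure of a Lipschitz cumulative function is absolutely
    continuous, so the function is the integral of its Radon-Nikodym density,
    and an integral is differentiable at almost every point. *)
Lemma lipschitz_cumulative_derivable (F : R -> R) (C a : R) :
  (forall x y, x <= y -> 0 <= F y - F x <= C * (y - x)) ->
  (forall x, x <= a -> F x = 0) ->
  (exists b, forall x, b <= x -> F x = 1) ->
  {ae mu, forall x, a < x -> derivable F x 1}.
Proof.
move=> FL Fa [b Fb].
have nd : {homo F : x y / x <= y}.
  by move=> x y xy; have /andP[+ _] := FL x y xy; rewrite subr_ge0.
have C0 : 0 <= C.
  by have /andP[h1 h2] := FL 0 1 ler01; have := le_trans h1 h2; rewrite subr0 mulr1.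
have cF x : {for x, continuous F}.
  apply/continuousP_eps => e e0; exists (e / (C + 1)) => [|y yx].
    by rewrite divr_gt0//; lra.
  have h : `|F y - F x| <= C * `|y - x|.
    have [xy|/ltW yx'] := leP x y.
      by rewrite !ger0_norm ?subr_ge0 ?nd//; case/andP: (FL x y xy).
    by rewrite distrC (distrC y) !ger0_norm ?subr_ge0 ?nd//; case/andP: (FL y x yx').
  apply: (le_lt_trans h); move: yx; rewrite ltr_pdivlMr; last by lra.
  by have := normr_ge0 (y - x); nra.
have rc : right_continuous F by apply: right_continuousW => x; exact: cF.
have cNy : F @ -oo --> (0 : R).
  apply: cvg_near_cst; exists a; split; first exact: num_real.
  by move=> x xa; apply: Fa; exact: ltW.
have cy : F @ +oo --> (1 : R).
  apply: cvg_near_cst; exists b; split; first exact: num_real.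
  by move=> x xa; apply: Fb; exact: ltW.
pose Fc : cumulativeBounded (0 : R) (1 : R) := HB.pack F
  (isCumulative.Build R _ R F nd rc) (isCumulativeBounded.Build R 0 1 F cNy cy).
pose nu : probability _ R := lebesgue_stieltjes_measure Fc.
have wF : forall X, ocitv X -> (wlength F X <= C%:E * wlength idfun X)%E.
  move=> X [[x y] _ <-]/=.
  have [xy|yx] := leP x y; last first.
    have -> : (`]x, y] = set0)%classic by apply: set_itv_ge; rewrite bnd_simp -leNgt ltW.
    by rewrite !wlength0 mule0.
  by rewrite !wlength_itv_bnd// -EFinM lee_fin; case/andP: (FL x y xy).
have wF0 X : (0 <= wlength F X)%E by have := @wlength_ge0 R Fc X.
have wI0 X : (0 <= wlength (@idfun R) X)%E by have := @wlength_ge0 R (@idfun R) X.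
have dom : nu `<< mu.
  apply/null_content_dominatesP => X mX X0.
  apply/eqP; rewrite eq_le measure_ge0 andbT.
  apply/lee_addgt0Pr => e e0; rewrite add0e.
  have C1 : 0 < C + 1 by lra.
  have : (mu X < (e / (C + 1))%:E)%E by rewrite X0 lte_fin divr_gt0.
  rewrite /lebesgue_measure/= /lebesgue_stieltjes_measure/= /measure_extension/= /mu_ext.
  move=> /ereal_inf_lt[_ [D cD <-]] De.
  apply: (@le_trans _ _ (\sum_(k <oo) wlength F (D k))%E).
    by apply: ereal_inf_lbound; exists D.
  have mD k : ocitv (D k) by have := cover_measurable cD k.
  apply: (@le_trans _ _ (\sum_(k <oo) C%:E * wlength idfun (D k))%E).
    by apply: lee_nneseries => k *; [exact: wF0|exact: wF].
  rewrite nneseriesZl; last by move=> *; exact: wI0.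
  apply: (@le_trans _ _ (C%:E * (e / (C + 1))%:E)%E).
    by rewrite lee_wpmul2l ?lee_fin// ltW.
  rewrite -EFinM lee_fin mulrA ler_pdivrMr// mulrC.
  by have := e0; nra.
have dom' : charge_of_finite_measure nu `<< mu by [].
have iphi := Radon_Nikodym_integrable dom'.
have Ephi A := Radon_Nikodym_integral (A := A) dom'.
have fphi x := Radon_Nikodym_fin_num x dom'.
move: iphi Ephi fphi; set phi := Radon_Nikodym _ _ => iphi Ephi fphi.
pose g x := fine (phi x).
have gE : phi = EFin \o g by apply/funext => x; rewrite /g /= fineK.
have ig : mu.-integrable setT (EFin \o g) by rewrite -gE.
have FE x : a < x -> F x = (\int[mu]_(t in `]a, x]) g t)%R.
  move=> ax.
  have := Ephi `]a, x]%classic (measurable_itv _).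
  rewrite /charge_of_finite_measure /= /lebesgue_stieltjes_measure /measure_extension.
  rewrite measurable_mu_extE/=; last exact: is_ocitv.
  rewrite wlength_itv_bnd ?ltW// (Fa a (lexx a)) subr0 gE => E.
  by rewrite /Rintegral -E.
have i1 y : mu.-integrable [set` Interval (BRight a) (BRight y)] (EFin \o g).
  exact: (integrableS _ _ _ ig).
have i2 : locally_integrable [set: R] g.
  by apply: open_integrable_locally => //; exact: openT.
have H := FTC1 i1 i2.
move: H; apply: filterS; first exact: (ae_filter_ringOfSetsType mu).
move=> x /= H ax.
have {H} [H _] : derivable _ x 1 /\ _ := H ax.
have D := derivable_is_derive1 H.
suff : is_derive x 1 F (derive1 (fun y => (\int[mu]_(t in `]a, y]) g t)%R) x) by case.
apply: (is_derive_near (d := x - a)) D; first lra.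
by move=> y; rewrite ltr_norml => yI; rewrite FE//; lra.
Qed.

(** Adding a linear function makes [g] increasing, and truncation and scaling
    make it a cumulative distribution function; then
    [lipschitz_cumulative_derivable] applies. *)
Lemma lipschitz_ae_derivable (g : R -> R) (M a b : R) : a < b ->
  (forall x y, `|g x - g y| <= M * `|x - y|) ->
  {ae mu, forall x, a < x < b -> derivable g x 1}.
Proof.
move=> ab gL.
pose h x := g x + (M + 1) * x.
pose cl x := Num.max a (Num.min x b).
have h_inc x y : x <= y -> y - x <= h y - h x <= (2 * M + 1) * (y - x).
  move=> xy; have := gL y x; rewrite (ger0_norm (x := y - x)) ?subr_ge0//.
  by rewrite ler_norml /h; lra.
have hab : 0 < h b - h a by have := h_inc a b (ltW ab); lra.
pose F x := (h (cl x) - h a) / (h b - h a).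
have M1 : 0 <= 2 * M + 1.
  by have := h_inc a b (ltW ab) => /andP[h1 h2]; have := le_trans h1 h2; rewrite -subr_gt0 in ab; nra.
have clP x y : x <= y -> cl x <= cl y /\ cl y - cl x <= y - x.
  rewrite /cl !maxEle !minEle => xy; do 4 case: ifPn; rewrite -?ltNge => *; lra.
have H : {ae mu, forall x, a < x -> derivable F x 1}.
  apply: (@lipschitz_cumulative_derivable F ((2 * M + 1) / (h b - h a))).
  - move=> x y /clP[c1 c2]; rewrite /F -mulrBl.
    have -> : h (cl y) - h a - (h (cl x) - h a) = h (cl y) - h (cl x) by ring.
    have /andP[h1 h2] := h_inc _ _ c1.
    rewrite divr_ge0 ?(ltW hab)//=; last by lra.
    rewrite mulrAC ler_pM2r ?invr_gt0// (le_trans h2)//.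
    by rewrite ler_wpM2l.
  - move=> x xa; rewrite /F /cl (_ : Num.max _ _ = a) ?subrr ?mul0r//.
    by rewrite maxEle minEle; do 2 case: ifPn; rewrite -?ltNge => *; lra.
  - exists b => x bx; rewrite /F /cl (_ : Num.max _ _ = b) ?divff ?gt_eqF//.
    by rewrite maxEle minEle; do 2 case: ifPn; rewrite -?ltNge => *; lra.
move: H; apply: filterS; first exact: (ae_filter_ringOfSetsType mu).
move=> x /= H /andP[ax xb].
have D := derivable_is_derive1 (H ax).
have D1 : is_derive x 1 (fun y => F y * (h b - h a) - (M + 1) * y + h a)
  (derive1 F x * (h b - h a) - (M + 1)).
  by eapply is_derive_eq; [der|rewrite /=; ring].
suff : is_derive x 1 g (derive1 F x * (h b - h a) - (M + 1)) by case.
apply: (is_derive_near (d := Num.min (x - a) (b - x))) D1; first by rewrite lt_min; lra.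
move=> y; rewrite lt_min !ltr_norml => yI.
have clE : cl y = y.
  by rewrite /cl maxEle minEle; do 2 case: ifPn; rewrite -?ltNge => *; lra.
rewrite /F clE divfK ?gt_eqF// /h; ring.
Qed.

End Rademacher.

(** * The Jacobi equation and conjugate endpoints *)

Section ConjugateEndpoints.
Context {R : realType}.
Variables (f df : R -> R) (A B M : R).
Hypothesis pf : profile f df A B M.
Variable x : R.
Hypothesis xI : A < x < B.
Implicit Types u v t y : R.
Local Notation uu := (log_radius B x).
Local Notation ss := (radial_rate f df B x).
Local Notation ww := (radial_rate_inv f df B x).
Local Notation slope := (log_slope f df).
Local Notation Qo := (jacobi_odd f df B x).
Local Notation jac := (jacobi f df B x).
Local Notation jacd := (d_jacobi f df B x).
Local Notation slope_diff := (log_slope_diff f df B x).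
Local Notation kk := (time_density f df B x).
Local Notation vt := (dive_param pf xI).
Local Notation ut := (dive_log_radius pf xI).
Local Notation st := (dive_radial_momentum pf xI).
Local Notation T1 := (time_prim f df B x 1).

Let xI' : A <= x < B. Proof. by case/andP: xI => /ltW -> ->. Qed.

Lemma log_slope_lip : lip x B slope.
Proof.
have xB : x <= B by case/andP: xI' => _ /ltW.
have f0 z : x <= z <= B -> 0 < f z.
  by move=> zI; apply: (pf_pos pf); move: xI zI; lra.
apply: (@lipM _ x B df (fun u => (2 * f u)^-1) xB).
- have M0 : 0 <= M by have := pf_lip pf 1 0; rewrite subr0 normr1 mulr1; apply: le_trans.
  by exists M => // u v _ uv _; rewrite -[v - u]ger0_norm ?subr_ge0//; exact: (pf_lip pf).
- have D z : x <= z <= B -> is_derive z 1 (fun u => (2 * f u)^-1) (- (2 * df z) / (2 * f z) ^+ 2).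
    move=> zI; have D := pf_d pf z; have fz := f0 z zI.
    have n0 : 2 * f z != 0 by rewrite mulf_neq0// gt_eqF.
    have D2 := der_mul (der_cst 2 z) D.
    apply: (is_derive_eq (der_inv (f := fun u => 2 * f u) n0 D2)).
    by field; rewrite gt_eqF.
  apply: (lip_derive D).
  have cD : cont_itv x B (fun z => - (2 * df z) / (2 * f z) ^+ 2).
    move=> z zI; have fz := f0 z zI; cts.
    + exact: (pf_dcont pf).
    + apply: ctnV; first by rewrite expf_neq0// mulf_neq0// gt_eqF.
      by cts; exact: (pf_cont pf).
  by have [C _ HC] := cont_bdd xB cD; exists C.
Qed.

(** The estimate carries squares because [u] is quadratic in [v]; this is
    what makes the quotient in [d_jacobi] Lipschitz at the turning point. *)
Lemma log_slope_lip_sqr : exists2 C, 0 <= C & forall u v, 0 <= u -> u <= v -> v <= 1 ->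
  `|slope (uu v) - slope (uu u)| <= C * (v ^+ 2 - u ^+ 2).
Proof.
have [C C0 H] := log_slope_lip.
have xB : x < B by case/andP: xI'.
have L0 : 0 < B - x by lra.
exists (C * (B - x)) => [|u v u0 uv v1]; first by rewrite mulr_ge0// ltW.
have := H (uu u) (uu v) (log_radius_ge u xB).
have -> : uu v - uu u = (B - x) * (v ^+ 2 - u ^+ 2) by rewrite /log_radius; ring.
rewrite mulrA; apply; last by apply: log_radius_leB => //; lra.
by rewrite -subr_ge0 [_ - _](_ : _ = (B - x) * ((v - u) * (v + u))) ?mulr_ge0//;
  [lra..|rewrite /log_radius; ring].
Qed.

Lemma log_slope_diffN v : slope_diff (- v) = slope_diff v.
Proof. by rewrite /log_slope_diff log_radiusN. Qed.

Lemma d_jacobiN v : jacd (- v) = - jacd v.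
Proof. by rewrite /d_jacobi log_slope_diffN log_radiusN radial_rateN jacobi_oddN mulNr invrN; ring. Qed.

(** The quotient [log_slope_diff v / (v * radial_rate v)] has a numerator that
    is [O(v^2)] with increments [O(v^2 - w^2)], over a denominator comparable to
    [v]; so it is Lipschitz on [[0, 1]], and by oddness on [[-1, 1]]. *)
Lemma d_jacobi_lip : exists2 C, 0 <= C & forall u v, -1 <= u <= 1 -> -1 <= v <= 1 ->
  `|jacd v - jacd u| <= C * `|v - u|.
Proof.
have [Cq Cq0 [HQ _]] := jacobi_prim_props pf xI.
have [Cs Cs0 HS] := log_slope_lip_sqr.
have uE (v : R) : v ^+ 2 - 0 ^+ 2 = v ^+ 2 by rewrite expr0n subr0.
have cs : cont_itv 0 1 ss by move=> z _; exact: (radial_rate_ctn pf xI').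
have [k k0 ks] := cont_low ler01 cs (fun z _ => radial_rate_gt0 pf z xI').
have cvs : lip 0 1 (fun v => v * ss v).
  apply: (lip_derive (F' := fun v => (B - x) * df (uu v) * ww v)).
    by move=> z _; exact: (der_radial_momentum_v pf).
  have cD : cont_itv 0 1 (fun v => (B - x) * df (uu v) * ww v).
    by move=> z _; cts; [exact: (df_log_radius_cont pf)|exact: (radial_rate_inv_cont pf)].
  by have [C _ HC] := cont_bdd ler01 cD; exists C.
have [D D0 HD] := cvs.
have Cmu : lip 0 1 (fun v => slope (uu v)).
  exists (Cs * 2) => [|u v u0 uv v1]; first by rewrite mulr_ge0.
  apply: le_trans (HS u v u0 uv v1) _; rewrite -mulrA ler_wpM2l//.
  rewrite (_ : v ^+ 2 - u ^+ 2 = (v + u) * (v - u)); last by ring.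
  by rewrite ler_wpM2r ?subr_ge0//; lra.
have lR : lip 0 1 (fun v => slope_diff v / (v * ss v)).
  exists (2 * Cs / k + Cs * D / k ^+ 2) => [|w v w0].
    by rewrite addr_ge0// divr_ge0 ?sqr_ge0 ?mulr_ge0// ltW.
  rewrite le_eqVlt => /predU1P[->|wv] v1; first by rewrite !subrr normr0 mulr0.
  have v0 : 0 < v by exact: le_lt_trans wv.
  have sv := radial_rate_gt0 pf v xI'.
  have kv : k <= ss v by apply: ks; lra.
  have Nv : `|slope_diff v - slope_diff w| <= Cs * (v ^+ 2 - w ^+ 2).
    rewrite /log_slope_diff (_ : _ - _ - _ = slope (uu v) - slope (uu w)); last by ring.
    by apply: HS => //; exact: ltW.
  have h1 : `|(slope_diff v - slope_diff w) / (v * ss v)| <= 2 * Cs / k * (v - w).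
    rewrite normrM normfV (gtr0_norm (mulr_gt0 v0 sv)) ler_pdivrMr ?mulr_gt0//.
    apply: (le_trans Nv).
    have -> : Cs * (v ^+ 2 - w ^+ 2) = Cs * (v - w) * (v + w) by ring.
    rewrite (_ : 2 * Cs / k * (v - w) * (v * ss v) = Cs * (v - w) * (2 * v * (ss v / k))); last by field; rewrite gt_eqF.
    apply: ler_wpM2l; first by rewrite mulr_ge0// subr_ge0 ltW.
    apply: (@le_trans _ _ (2 * v * 1)); first lra.
    by rewrite ler_pM2l ?mulr_gt0// ler_pdivlMr// mul1r.
  move: w0; rewrite le_eqVlt => /predU1P[w0|w0].
    rewrite -w0 mul0r invr0 mulr0 subr0 subr0.
    have N0 : slope_diff w = 0 by rewrite -w0 /log_slope_diff log_radius0 subrr.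
    rewrite N0 -w0 !subr0 in h1.
    apply: (le_trans h1); rewrite ler_pM2r// lerDl.
    by rewrite divr_ge0 ?sqr_ge0 ?mulr_ge0.
  have sw := radial_rate_gt0 pf w xI'.
  have kw : k <= ss w by apply: ks; lra.
  have Nw : `|slope_diff w| <= Cs * w ^+ 2.
    by have := HS 0 w (lexx _) (ltW w0) ltac:(lra); rewrite uE log_radius0.
  have hD := HD w v (ltW w0) (ltW wv) v1.
  have h2 : `|slope_diff w * (w * ss w - v * ss v) / (v * ss v * (w * ss w))| <= Cs * D / k ^+ 2 * (v - w).
    have p0 : 0 < v * ss v * (w * ss w) by rewrite !mulr_gt0.
    rewrite normrM normfV (gtr0_norm p0) ler_pdivrMr// normrM [X in _ * X]distrC.
    apply: (@le_trans _ _ (Cs * w ^+ 2 * (D * (v - w)))); first by rewrite ler_pM.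
    have k20 : 0 < k ^+ 2 by rewrite exprn_gt0.
    rewrite (_ : Cs * D / k ^+ 2 * (v - w) * _ =
      Cs * D * (v - w) * (v * w * (ss v * ss w) / k ^+ 2)); last by field; rewrite gt_eqF.
    rewrite (_ : Cs * w ^+ 2 * (D * (v - w)) = Cs * D * (v - w) * w ^+ 2); last by ring.
    apply: ler_wpM2l; first by rewrite mulr_ge0 ?subr_ge0 ?(ltW wv)// mulr_ge0.
    apply: (@le_trans _ _ (v * w)); first by rewrite expr2 ler_pM2r// ltW.
    rewrite ler_pdivlMr//; apply: ler_wpM2l; first by rewrite mulr_ge0 ?ltW.
    by rewrite expr2 ler_pM// ltW.
  rewrite (_ : _ - _ = (slope_diff v - slope_diff w) / (v * ss v) +
    slope_diff w * (w * ss w - v * ss v) / (v * ss v * (w * ss w))).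
    by apply: (le_trans (ler_normD _ _)); rewrite [leRHS]mulrDl lerD.
  by field; rewrite !gt_eqF.
have lQ : lip 0 1 (jacobi_prim f df B x) by exists Cq.
have [C C0 HC] := lipD (lipM ler01 Cmu lQ) lR.
exists C => //; apply: odd_lip => //; first exact: d_jacobiN.
move=> u v u0 uv v1; have := HC u v u0 uv v1.
by rewrite /d_jacobi /jacobi_odd u0 (le_trans u0 uv).
Qed.

Lemma jacobi_lip : lip (-1) 1 jac.
Proof.
have [C C0 [HQ _]] := jacobi_prim_props pf xI.
have lo : lip (-1) 1 Qo.
  exists C => // u v u1 uv v1.
  have := @odd_lip _ Qo C C0 (jacobi_oddN f df B x) _ u v.
  rewrite (ger0_norm (x := v - u)) ?subr_ge0//; apply; [|lra|lra].
  move=> a b a0 ab b1; have := HQ a b a0 ab b1.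
  by rewrite /jacobi_odd a0 (le_trans a0 ab).
have lv : lip (-1) 1 (fun v => v * ss v).
  apply: (lip_derive (F' := fun v => (B - x) * df (uu v) * ww v)).
    by move=> z _; exact: (der_radial_momentum_v pf).
  have cD : cont_itv (-1) 1 (fun v => (B - x) * df (uu v) * ww v).
    by move=> z _; cts; [exact: (df_log_radius_cont pf)|exact: (radial_rate_inv_cont pf)].
  by have [D _ HD] := cont_bdd (a := -1) (b := 1) ltac:(lra) cD; exists D.
have l1 : lip (-1) 1 (fun=> 1 : R).
  by exists 0 => // u v _ _ _; rewrite subrr normr0 mul0r.
exact: lipD l1 (lipM (a := -1) (b := 1) ltac:(lra) lv lo).
Qed.

Lemma dive_param_lip : lip 0 (2 * T1) vt.
Proof.
have ckk : cont_itv (-1) 1 kk by move=> z _; exact: (time_density_ctn pf xI).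
have [k k0 Hk] := cont_low (a := -1) (b := 1) ltac:(lra) ckk (fun z _ => time_density_gt0 pf xI z).
apply: (lip_derive (F' := fun t => (kk (vt t))^-1)).
  by move=> z zI; have [_] := der_dive_param pf xI zI.
exists k^-1 => z zI; have [vI _] := der_dive_param pf xI zI.
have kv := Hk _ vI.
by rewrite normfV gtr0_norm ?(lt_le_trans k0)// lef_pV2 ?posrE ?(lt_le_trans k0).
Qed.

Let T0 : 0 <= 2 * T1. Proof. by have := time_prim1_gt0 pf xI; lra. Qed.

Lemma dive_param_itv t : 0 <= t <= 2 * T1 -> -1 <= vt t <= 1.
Proof. by move=> /(der_dive_param pf xI)[]. Qed.

Lemma time_prim_dive_param t : 0 <= t <= 2 * T1 -> time_prim f df B x (vt t) = t - T1.
Proof.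
move=> tI; rewrite /dive_param /param_of_time; case: (cid (param_of_time_exists pf xI)) => G /= [H1 H2 H3 H4].
have a1 := H4 (-3/2) (-1) ltac:(lra) ltac:(lra) ltac:(lra).
have a2 := H4 1 (3/2) ltac:(lra) ltac:(lra) ltac:(lra).
have TN := time_primN1 pf xI.
by have [] := H3 (t - T1) ltac:(lra).
Qed.

Lemma dive_param_time_prim v : -3/2 <= v <= 3/2 -> vt (T1 + time_prim f df B x v) = v.
Proof.
rewrite /dive_param [T1 + _]addrC addrK.
by rewrite /param_of_time; case: (cid (param_of_time_exists pf xI)) => G /= [H _ _ _]; exact: H.
Qed.

Lemma der_dive_jacobi t : 0 < t < 2 * T1 ->
  is_derive t 1 (fun t => jac (vt t)) (jacd (vt t)).
Proof.
move=> tI; have vI := dive_param_inner pf xI tI.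
have tI' : 0 <= t <= 2 * T1 by lra.
have [_ D] := der_dive_param pf xI tI'.
apply: (is_derive_eq (der_comp (g := vt) (der_jacobi pf xI vI) D)).
have k0 := time_density_gt0 pf xI (vt t).
by field; rewrite gt_eqF.
Qed.

(** [df] along the ray is only Lipschitz in time, so differentiability almost
    everywhere must be applied to this function of time; the clamping makes it
    globally Lipschitz. *)
Definition log_slope_time t := slope (ut (clamp 0 (2 * T1) t)).

Lemma log_slope_time_lip : exists C, forall s t,
  `|log_slope_time s - log_slope_time t| <= C * `|s - t|.
Proof.
have lu : lip 0 (2 * T1) ut.
  apply: (lip_derive (F' := fun t => st t / f (ut t))).
    by move=> t tI; exact: (der_dive_log_radius pf xI tI).
  have cD : cont_itv 0 (2 * T1) (fun t => st t / f (ut t)).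
    move=> t tI; have D1 := is_derive_continuous (der_dive_radial_momentum pf xI tI).
    have D2 := is_derive_continuous (der_dive_log_radius pf xI tI).
    apply: ctnM => //; apply: ctnV; first by rewrite gt_eqF// (f_dive_log_radius_gt0 pf xI).
    by apply: ctn_comp => //; exact: (pf_cont pf).
  by have [D _ HD] := cont_bdd T0 cD; exists D.
have xB : x < B by case/andP: xI'.
have uI t : 0 <= t <= 2 * T1 -> x <= ut t <= B.
  move=> tI; have vI := dive_param_itv tI; rewrite /dive_log_radius log_radius_ge//=.
  have [v0|v0] := leP 0 (vt t); first by apply: log_radius_leB => //; lra.
  by rewrite -log_radiusN; apply: log_radius_leB => //; lra.
have [C C0 HC] := lip_clamp T0 (lip_comp log_slope_lip lu uI).
by exists C => s t; exact: HC.
Qed.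

Lemma log_slope_timeE t : 0 < t < 2 * T1 -> log_slope_time t = slope (ut t).
Proof. by move=> tI; rewrite /log_slope_time clampE//; lra. Qed.

Lemma log_slope_time_near t m : 0 < t < 2 * T1 -> is_derive t 1 log_slope_time m ->
  is_derive t 1 (fun s => slope (ut s)) m.
Proof.
move=> tI; apply: (is_derive_near (d := Num.min t (2 * T1 - t))).
  by rewrite lt_min; lra.
move=> y; rewrite lt_min !ltr_norml => yI.
by rewrite log_slope_timeE//; lra.
Qed.

(** The part of the derivative of [log_slope * jacobi_odd] that comes from
    [jacobi_odd] cancels the derivative of [1 / sigma], and
    [m * (jacobi_odd + 1 / sigma)] remains. *)
Lemma der_d_jacobi t m : 0 < t < 2 * T1 -> t != T1 -> is_derive t 1 log_slope_time m ->
  is_derive t 1 (fun t => jacd (vt t)) (m / st t * jac (vt t)).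
Proof.
move=> tI tT Dm.
have Ds := log_slope_time_near tI Dm.
have tI' : 0 <= t <= 2 * T1 by lra.
have [_ Dv] := der_dive_param pf xI tI'.
have Dst := der_dive_radial_momentum pf xI tI'.
have v0 : vt t != 0.
  apply: contra_neq tT => E; have := time_prim_dive_param tI'; rewrite E /time_prim subrr.
  by move/eqP; rewrite eq_sym subr_eq0 => /eqP.
have DQ := der_comp (g := vt) (der_jacobi_odd pf xI (dive_param_inner pf xI tI) v0) Dv.
have s0 : st t != 0 by rewrite mulf_neq0// gt_eqF// (radial_rate_gt0 pf).
have DV := der_inv s0 Dst.
have D := der_add (der_mul Ds DQ) (der_mul (der_add Ds (der_cst (- slope x) t)) DV).
apply: (is_derive_eq D).
rewrite (jacobi_densityE pf xI v0) /jacobi /log_slope_diff /dive_radial_momentum /dive_log_radius /kk /angle_density /radial_rate_inv /log_slope.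
have sv := radial_rate_gt0 pf (vt t) xI'; have f0 := f_log_radius_gt0 pf xI (vt t).
have fx := fx_gt0 pf xI.
by field; rewrite v0 !gt_eqF//; move: xI; lra.
Qed.

Lemma jacobi_ends : jac (-1) = 1 + ss 1 * jacobi_prim f df B x 1 /\ jac 1 = 1 + ss 1 * jacobi_prim f df B x 1.
Proof.
have E1 : Qo 1 = jacobi_prim f df B x 1 by rewrite /jacobi_odd ler01.
split; rewrite /jacobi; last by rewrite mul1r E1.
by rewrite radial_rateN jacobi_oddN E1; ring.
Qed.

(** By definition of [d_half_angle_time] the left-hand side of the hypothesis is
    [- jacobi 1 / radial_rate 1]. *)
Lemma jacobi_end_eq0 : d_half_angle_time f df B x + df x / (2 * f x) * half_angle_time f df B x = 0 ->
  1 + ss 1 * jacobi_prim f df B x 1 = 0.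
Proof.
have [x1 [x2 [Ax1 x1x xx2 x2B]]] := nbhd_itv xI.
have x12 : x1 <= x2 by lra.
have [bw _ _ _ be] := basic_bdd pf Ax1 x12 x2B.
have bc3 : bdd_cont01 (fun v => ww v ^+ 3 * slope_quotient df B x v).
  split.
    move=> v vI; have v0 : v != 0 by rewrite gt_eqF//; lra.
    by cts; [exact: (radial_rate_inv_cont pf)|exact: (slope_quotient_cont pf)].
  have [C HC] := bdd2M (bdd2X 3 bw) be.
  by exists C => v vI; apply: HC => //; rewrite x1x.
have bcw : bdd_cont01 (fun v => ww v).
  by apply: cont_bdd_cont01 => z _; exact: (radial_rate_inv_cont pf).
have -> : jacobi_prim f df B x 1 = (B - x) * Rint 0 1 (fun v => ww v ^+ 3 * slope_quotient df B x v)
    - (df x / f x) / 2 * half_angle_time f df B x.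
  have -> : half_angle_time f df B x = 2 * (B - x) * Rint 0 1 ww by rewrite /half_angle_time Rint01Z.
  rewrite /jacobi_prim.
  have -> : Rint 0 1 (jacobi_density f df B x) = Rint 0 1 (fun v => (B - x) * (ww v ^+ 3 * slope_quotient df B x v)
     + (- ((B - x) * (df x / f x))) * ww v).
    by apply: Rint_ext => v _; rewrite /jacobi_density; ring.
  rewrite Rint01D; [|by apply: bdd_cont01M => //; exact: bdd_cont01C..].
  by rewrite !Rint01Z//; field; rewrite gt_eqF// (fx_gt0 pf xI).
rewrite /d_half_angle_time /radial_rate_inv => H.
have s0 := radial_rate_gt0 pf 1 xI'; have f0 := fx_gt0 pf xI.
have -> : (B - x) * Rint 0 1 (fun v => (ss v)^-1 ^+ 3 * slope_quotient df B x v) =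
   df x / (2 * f x) * half_angle_time f df B x - (ss 1)^-1.
  by apply/eqP; rewrite -subr_eq0 -oppr_eq0; apply/eqP; rewrite -[RHS]H; ring.
by field; rewrite !gt_eqF.
Qed.

Lemma ae_neq (t0 : R) : {ae (@lebesgue_measure R), forall t, t != t0}.
Proof.
exists [set t0]; split => //; first exact: lebesgue_measure_set1.
by move=> t /= /negP; rewrite negbK => /eqP.
Qed.

Lemma der_ln y : 0 < y -> is_derive y 1 (@ln R) y^-1.
Proof. exact: is_derive1_ln. Qed.

(** In terms of [log_slope] one has [c' = (1 - log_slope (ln s)) c / s], and
    then the curvature at [s] is [- c^2 / s] times the derivative of
    [log_slope (ln s)].  The latter is a derivative in time divided by the
    radial velocity, since the radius is a local coordinate on the ray off the
    turning point. *)
Lemma dive_curvature c t m : adapted f df A B c -> 0 < t < 2 * T1 -> t != T1 ->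
  is_derive t 1 log_slope_time m -> gauss_curvature c (expR (ut t)) = - (m / st t).
Proof.
move=> ad tI tT Dm.
have tI' : 0 <= t <= 2 * T1 by lra.
have v0 : vt t != 0.
  apply: contra_neq tT => E; have := time_prim_dive_param tI'; rewrite E /time_prim subrr.
  by move/eqP; rewrite eq_sym subr_eq0 => /eqP.
have vI := dive_param_inner pf xI tI.
have Ds := log_slope_time_near tI Dm.
have L0 : 0 < B - x by move: xI; lra.
pose s0 := expR (ut t).
have s0p : 0 < s0 by exact: expR_gt0.
have uI : A < ut t < B by have /andP[? ?] := xI; have := dive_log_radius_inner pf xI tI; lra.
(* the time at which the ray is at radius [s], on the branch of [t] *)
pose w s := Num.sg (vt t) * Num.sqrt ((ln s - x) / (B - x)).
have w2 : (ln s0 - x) / (B - x) = vt t ^+ 2.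
  by rewrite /s0 expRK /dive_log_radius /log_radius; field; rewrite gt_eqF.
have v2 : 0 < vt t ^+ 2 by rewrite exprn_even_gt0.
have w0 : w s0 = vt t by rewrite /w w2 sqrtr_sqr -numEsg.
have Dln := der_ln s0p.
have w2p : 0 < (ln s0 - x) / (B - x) by rewrite w2.
have Dw : is_derive s0 1 w (s0^-1 / (2 * (B - x) * vt t)).
  have D1 : is_derive s0 1 (fun s => (ln s - x) / (B - x)) (s0^-1 / (B - x)).
    by eapply is_derive_eq; [der|rewrite /=; ring].
  have D2 := der_mul (der_cst (Num.sg (vt t)) s0) (der_sqrt (f := fun s => (ln s - x) / (B - x)) w2p D1).
  apply: (is_derive_eq D2); rewrite mul0r add0r w2 sqrtr_sqr.
  rewrite normrEsg; field.
  by rewrite v0 sgr_eq0 v0 !gt_eqF.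
pose tau s := T1 + time_prim f df B x (w s).
have Dtau : is_derive s0 1 tau (kk (vt t) * (s0^-1 / (2 * (B - x) * vt t))).
  have D1 : is_derive (w s0) 1 (time_prim f df B x) (kk (w s0)) by apply: (der_time_prim pf xI); rewrite w0; lra.
  apply: (is_derive_eq (der_add (der_cst T1 s0) (der_comp (g := w) D1 Dw))).
  by rewrite add0r w0.
have tau0 : tau s0 = t by rewrite /tau w0 (time_prim_dive_param tI') addrC subrK.
have Dsl : is_derive s0 1 (fun s => slope (ln s)) (m * (kk (vt t) * (s0^-1 / (2 * (B - x) * vt t)))).
  have Dst : is_derive (tau s0) 1 (fun s => slope (ut s)) m by rewrite tau0.
  have Dc := der_comp (g := tau) Dst Dtau.
  have cw := is_derive_continuous Dw.
  have [d1 d10 Hd1] := (continuousP_eps _ _).1 cw _ (ltac:(by []) : 0 < 1/2 :> R).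
  have cl := is_derive_continuous Dln.
  have lx : 0 < ln s0 - x.
    by move: w2p; rewrite pmulr_lgt0// invr_gt0.
  have [d2 d20 Hd2] := (continuousP_eps _ _).1 cl _ lx.
  apply: (is_derive_near (d := Num.min d1 d2)) Dc; first by rewrite lt_min d10.
  move=> y; rewrite lt_min => /andP[/Hd1 y1 /Hd2 y2].
  rewrite /tau /dive_log_radius dive_param_time_prim.
    congr (slope _); rewrite /log_radius exprMn sqr_sqrtr; last first.
      by rewrite divr_ge0 ?(ltW L0)//; move: y2; rewrite ltr_norml; lra.
    have -> : Num.sg (vt t) ^+ 2 = 1 by rewrite sqr_sg v0.
    by field; rewrite gt_eqF.
  by move: y1; rewrite w0 ltr_norml; lra.
have [c0 fE [l Dc dfE]] := ad (ut t) uI.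
have cs0 : c s0 != 0 by rewrite gt_eqF.
have f0 := f_dive_log_radius_gt0 pf xI t.
have lE : l = (1 - slope (ut t)) * c s0 / s0.
  rewrite /log_slope dfE -/s0; field.
  by rewrite cs0 !gt_eqF.
have Dc' : is_derive s0 1 (derive1 c)
    (- (m * (kk (vt t) * (s0^-1 / (2 * (B - x) * vt t)))) * c s0 / s0 + (1 - slope (ut t)) * l / s0
     - (1 - slope (ut t)) * c s0 / s0 ^+ 2).
  have D0 : is_derive s0 1 (fun s => (1 - slope (ln s)) * c s / s)
      (- (m * (kk (vt t) * (s0^-1 / (2 * (B - x) * vt t)))) * c s0 / s0 + (1 - slope (ut t)) * l / s0
     - (1 - slope (ut t)) * c s0 / s0 ^+ 2).
    have s0n : s0 != 0 by rewrite gt_eqF.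
    have Di : is_derive s0 1 (fun s : R => s^-1) (- 1 / s0 ^+ 2) by exact: (der_inv (f := fun s => s)) s0n (der_id s0).
    have D1 := der_mul (der_mul (der_add (der_cst 1 s0) (der_opp Dsl)) Dc) Di.
    apply: (is_derive_eq D1); rewrite /s0 expRK -/s0; field; rewrite s0n v0 gt_eqF//.
  have lA : 0 < ln s0 - A by rewrite /s0 expRK; lra.
  have lB : 0 < B - ln s0 by rewrite /s0 expRK; lra.
  have cl := is_derive_continuous Dln.
  have [d2 d20 Hd2] := (continuousP_eps _ _).1 cl _ lA.
  have [d3 d30 Hd3] := (continuousP_eps _ _).1 cl _ lB.
  apply: (is_derive_near (d := Num.min s0 (Num.min d2 d3))) D0; first by rewrite !lt_min s0p d20.
  move=> y; rewrite !lt_min => /andP[y1 /andP[/Hd2 y2 /Hd3 y3]].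
  have y0 : 0 < y by move: y1; rewrite ltr_norml; lra.
  have yI : A < ln y < B by move: y2 y3; rewrite !ltr_norml; lra.
  have [cy0 fyE [ly Dy dyE]] := ad (ln y) yI.
  have f1 : 0 < f (ln y) by apply: (pf_pos pf); lra.
  rewrite lnK in cy0 fyE Dy dyE; last by rewrite posrE.
  rewrite (is_derive1E Dy) /log_slope dyE; field.
  by rewrite !gt_eqF.
rewrite /gauss_curvature (is_derive1E Dc') (is_derive1E Dc) lE /kk /angle_density /radial_rate_inv /dive_radial_momentum.
have -> : f (uu (vt t)) = s0 ^+ 2 / c s0 ^+ 2 by rewrite -expr_div_n -fE.
have sv := radial_rate_gt0 pf (vt t) xI'.
rewrite -/s0; field.
by rewrite cs0 v0 !gt_eqF.
Qed.

Lemma dive_normal_jacobi c phi0 : adapted f df A B c ->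
  normal_jacobi_field c (dive_leg pf xI phi0) (fun t => jac (vt t)).
Proof.
move=> ad; split.
  apply: lip_within => //.
  exact: lip_comp jacobi_lip dive_param_lip dive_param_itv.
exists (fun t => jacd (vt t)); split.
- exact: der_dive_jacobi.
- have [C C0 HC] := d_jacobi_lip; have [D D0 HD] := lip_norm dive_param_lip.
  exists (C * D) => s t sI tI; rewrite distrC [X in _ * X]distrC.
  apply: (le_trans (HC _ _ (dive_param_itv sI) (dive_param_itv tI))).
  by rewrite -mulrA ler_wpM2l// HD.
- have [C HC] := log_slope_time_lip.
  have T1p : 0 < 2 * T1 by have := time_prim1_gt0 pf xI; lra.
  have H1 := lipschitz_ae_derivable T1p HC.
  have H2 := ae_neq T1.
  have H : {ae (@lebesgue_measure R), forall t, (0 < t < 2 * T1 -> derivable log_slope_time t 1) /\ t != T1}.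
    by apply: (@filterI _ _ (ae_filter_ringOfSetsType (@lebesgue_measure R)) _ _ H1 H2).
  move: H; apply: filterS; first exact: (ae_filter_ringOfSetsType (@lebesgue_measure R)).
  move=> t [H tT] tI.
  have Dm := derivable_is_derive1 (H tI).
  rewrite dive_radius (dive_curvature ad tI tT Dm) mulNr opprK.
  exact: der_d_jacobi.
Qed.

(** The hypothesis says that the derivative of the opening angle in the
    turning point [x] vanishes: neighbouring rays from the initial point of the
    ray meet it again at its final point to first order. *)
Lemma dive_conjugate c phi0 : adapted f df A B c ->
  d_half_angle_time f df B x + df x / (2 * f x) * half_angle_time f df B x = 0 ->
  conjugate_endpoints c (dive_leg pf xI phi0).
Proof.
move=> ad H; have T1p := time_prim1_gt0 pf xI.
have J0 := jacobi_end_eq0 H; have [e1 e2] := jacobi_ends.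
exists (fun t => jac (vt t)); split.
- exact: dive_normal_jacobi.
- by rewrite (dive_param0 pf xI) e1.
- by rewrite /= (dive_param_end pf xI) e2.
- exists T1; first by rewrite /=; lra.
  by rewrite (dive_param_mid pf xI) /jacobi mul0r mul0r addr0 oner_neq0.
Qed.

End ConjugateEndpoints.

(** * Action and angle as functions of the momentum *)

Section SqrtSub.
Context {R : realType}.
Implicit Types a b : R.

Lemma sqrt_sub_le a b : `|Num.sqrt a - Num.sqrt b| <= Num.sqrt `|a - b|.
Proof.
wlog ab : a b / b <= a => [H|].
  have [/H//|/ltW /H] := leP b a.
  by rewrite distrC (distrC b).
rewrite !ger0_norm ?subr_ge0 ?ler_wsqrtr// lerBlDr.
have [b0|/ltW b0] := leP b 0.
  by rewrite (ler0_sqrtr b0) addr0 ler_wsqrtr//; lra.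
rewrite -[leRHS]ger0_norm ?addr_ge0 ?sqrtr_ge0// -sqrtr_sqr ler_wsqrtr//.
rewrite sqrrD !sqr_sqrtr ?subr_ge0//.
have : 0 <= Num.sqrt (a - b) * Num.sqrt b by rewrite mulr_ge0 ?sqrtr_ge0.
by rewrite -mulr_natr; lra.
Qed.

End SqrtSub.

(** The square root of a negative number is [0], so this is the integral of the
    positive part. *)
Definition ray_action {R : realType} (f : R -> R) (A B p : R) :=
  Rint A B (fun u => 2 * Num.sqrt (f u - p ^+ 2)).

Section ActionOfMomentum.
Context {R : realType}.
Variables (f df : R -> R) (A B M : R).
Hypothesis pf : profile f df A B M.
Implicit Types x u v p y : R.
Local Notation II := (radial_action f df B).
Local Notation SS := (half_angle_time f df B).
Local Notation Sd := (d_half_angle_time f df B).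
Local Notation Ip := (ray_action f A B).

Let AB : A < B. Proof. exact: (pf_AB pf). Qed.

Lemma integrand_ctn p u : ctn u (fun u => 2 * Num.sqrt (f u - p ^+ 2)).
Proof. by cts; exact: (pf_cont pf). Qed.

(** Substitution of [u = x + (B - x) v^2]. *)
Lemma ray_action_turning_point x : A < x < B -> Ip (Num.sqrt (f x)) = II x.
Proof.
move=> xI; have AB' := AB; have xI' : A <= x < B by lra.
have fx0 : 0 < f x by apply: (pf_pos pf); lra.
rewrite /ray_action sqr_sqrtr ?ltW//.
pose h u := 2 * Num.sqrt (f u - f x).
have ch u : ctn u h by rewrite /h; cts; exact: (pf_cont pf).
have ci a b : cont_itv a b h by move=> z _; exact: ch.
have dH y : A < y -> is_derive y 1 (fun y => Rint A y h) (h y).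
  by move=> Ay; apply: (@Rint_FTC1 _ A (y + 1)) => //; lra.
have -> : Rint A B h = Rint A B h - Rint A x h.
  rewrite [X in _ - X](_ : _ = 0) ?subr0//.
  rewrite (Rint_ext (g := fun=> 0)).
    by rewrite Rint_cst ?mul0r//; lra.
  move=> u uI; rewrite /h ler0_sqrtr ?mulr0//.
  by rewrite subr_le0; apply: (pf_le pf); lra.
pose F v := Rint A (log_radius B x v) h.
have uA v : A < log_radius B x v by have := @log_radius_ge _ B x v; lra.
have dF v : is_derive v 1 F (h (log_radius B x v) * (2 * (B - x) * v)).
  exact: (der_comp (g := log_radius B x) (dH _ (uA v)) (der_log_radius_v B x v)).
have E : Rint 0 1 (fun v => h (log_radius B x v) * (2 * (B - x) * v)) = F 1 - F 0.
  apply: Rint_FTC2 => //.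
  - move=> z _; apply: (ctnM (f := fun v => h (log_radius B x v)) (g := fun v => 2 * (B - x) * v)); last by cts.
    by apply: ctn_comp => //; exact: log_radius_cont.
  - by move=> z _; exact: is_derive_continuous (dF z).
rewrite /F log_radius1 log_radius0 in E; rewrite -E /radial_action; apply: Rint_ext => v vI.
rewrite /h (slowness_quotientE f df B x v) [f x + _]addrC addrK sqrtrM ?ltW ?(slowness_quotient_gt0 pf)//.
rewrite sqrtr_sqr ger0_norm; last by lra.
by rewrite /radial_rate; ring.
Qed.

Lemma ray_action_eq0 p : f B <= p ^+ 2 -> Ip p = 0.
Proof.
move=> h; rewrite /ray_action (Rint_ext (g := fun=> 0)) ?Rint_cst ?mul0r ?ltW//.
move=> u uI; rewrite ler0_sqrtr ?mulr0// subr_le0 (le_trans _ h)//.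
by apply: (pf_le pf); lra.
Qed.

Lemma ray_action_dist p p' : `|Ip p - Ip p'| <= 2 * (B - A) * Num.sqrt `|p ^+ 2 - p' ^+ 2|.
Proof.
have AB' := AB.
rewrite /ray_action -Rint_B; [|by move=> z _; exact: integrand_ctn..].
rewrite [leRHS](_ : _ = 2 * Num.sqrt `|p ^+ 2 - p' ^+ 2| * (B - A)); last by ring.
apply: Rint_abs; first exact: ltW.
  by move=> z _; apply: continuousB; exact: integrand_ctn.
move=> u _; rewrite -mulrBr normrM (gtr0_norm (x := 2))// ler_pM2l//.
apply: le_trans (sqrt_sub_le _ _) _.
by rewrite (_ : _ - _ = - (p ^+ 2 - p' ^+ 2)) ?normrN//; ring.
Qed.

Lemma ray_action_cont p : {for p, continuous Ip}.
Proof.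
apply/continuousP_eps => e e0; have AB' := AB.
have cs : ctn p (fun y => Num.sqrt `|y ^+ 2 - p ^+ 2|) by cts.
have L0 : 0 < 2 * (B - A) by lra.
have [d d0 Hd] := (continuousP_eps _ _).1 cs _ (divr_gt0 e0 L0).
exists d => // y /Hd; rewrite subrr normr0 sqrtr0 subr0 ger0_norm ?sqrtr_ge0// => h.
apply: (le_lt_trans (ray_action_dist y p)).
by rewrite mulrC -ltr_pdivlMr.
Qed.

Lemma half_angle_time_gt0 x : A < x < B -> 0 < SS x.
Proof.
move=> xI; have xI' : A <= x < B by lra.
apply: Rint_gt0 => //.
  by move=> z _; cts; exact: (radial_rate_inv_cont pf).
by move=> v _; rewrite mulr_gt0 ?(radial_rate_inv_gt0 pf)//; lra.
Qed.

Definition turning_point p := get [set x | A < x < B /\ Num.sqrt (f x) = p].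
Definition opening p := 2 * p * SS (turning_point p).
(** The derivative of [opening]; the last factor is the quantity in
    [dive_conjugate]. *)
Definition d_opening p := 4 * p ^+ 2 / df (turning_point p) *
  (Sd (turning_point p) + df (turning_point p) / (2 * f (turning_point p)) * SS (turning_point p)).

Lemma der_turning_momentum u : A <= u -> is_derive u 1 (fun u => Num.sqrt (f u)) (df u / (2 * Num.sqrt (f u))).
Proof. by move=> Au; apply: (der_sqrt (pf_pos pf Au)); exact: (pf_d pf). Qed.

Lemma turning_momentum_lt u v : A <= u -> u < v -> u < B -> Num.sqrt (f u) < Num.sqrt (f v).
Proof.
move=> Au uv uB; rewrite ltr_sqrt ?(pf_lt pf)//.
by apply: (pf_pos pf); lra.
Qed.

Lemma turning_pointP p : Num.sqrt (f A) < p < Num.sqrt (f B) ->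
  A < turning_point p < B /\ Num.sqrt (f (turning_point p)) = p.
Proof.
move=> pI; have AB' := AB.
have [z zI E] : exists2 z, A <= z <= B & Num.sqrt (f z) = p.
  apply: ivt_lt; [lra| |lra].
  by move=> z zI; apply: is_derive_continuous (der_turning_momentum _); lra.
have zI' : A < z < B.
  apply/andP; split; rewrite lt_neqAle; apply/andP; split; try lra.
    by apply/eqP => zA; move: E pI; rewrite -zA => ->; lra.
  by apply/eqP => zB; move: E pI; rewrite zB => ->; lra.
exact: (@getPex _ [set x | A < x < B /\ Num.sqrt (f x) = p] (ex_intro _ z (conj zI' E))).
Qed.

Lemma turning_momentum_range y : A < y < B -> Num.sqrt (f A) < Num.sqrt (f y) < Num.sqrt (f B).
Proof. by move=> yI; rewrite !turning_momentum_lt//; lra. Qed.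

Lemma turning_pointK y : A < y < B -> turning_point (Num.sqrt (f y)) = y.
Proof.
move=> yI; have [xI E] := turning_pointP (turning_momentum_range yI).
case: (ltgtP (turning_point (Num.sqrt (f y))) y) => // h.
  by have := @turning_momentum_lt (turning_point (Num.sqrt (f y))) y ltac:(lra) h ltac:(lra); rewrite E ltxx.
by have := @turning_momentum_lt y (turning_point (Num.sqrt (f y))) ltac:(lra) h ltac:(lra); rewrite E ltxx.
Qed.

Lemma der_turning_point p : Num.sqrt (f A) < p < Num.sqrt (f B) ->
  is_derive p 1 turning_point (2 * p / df (turning_point p)).
Proof.
move=> pI; have [xI E] := turning_pointP pI.
have p0 : 0 < p by have := sqrtr_ge0 (f A); lra.
have d0 : 0 < df (turning_point p) by apply: (pf_df_gt0 pf); lra.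
have D : is_derive (Num.sqrt (f (turning_point p))) 1 turning_point (df (turning_point p) / (2 * Num.sqrt (f (turning_point p))))^-1.
  have nearI : \forall z \near turning_point p, A < z < B.
    near=> z; apply/andP; split.
      by near: z; apply: (cvgr_gt (turning_point p)) => //; case/andP: xI.
    by near: z; apply: (cvgr_lt (turning_point p)) => //; case/andP: xI.
  apply: (@is_derive_inverse _ (fun u => Num.sqrt (f u)) turning_point).
  - by near=> z; apply: turning_pointK; near: z.
  - near=> z; apply: is_derive_continuous (der_turning_momentum _).
    by apply: ltW; have : A < z < B by [near: z]; case/andP.
  - by apply: der_turning_momentum; lra.
  - by rewrite mulf_neq0 ?invr_neq0 ?mulf_neq0 ?gt_eqF// E.
rewrite E in D; apply: (is_derive_eq D).
by field; rewrite !gt_eqF.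
Unshelve. all: by end_near. Qed.

Lemma momentum_range_near p : Num.sqrt (f A) < p < Num.sqrt (f B) ->
  exists2 d, 0 < d & forall y, `|y - p| < d -> Num.sqrt (f A) < y < Num.sqrt (f B).
Proof.
move=> pI; exists (Num.min (p - Num.sqrt (f A)) (Num.sqrt (f B) - p)).
  by rewrite lt_min; lra.
by move=> y; rewrite lt_min !ltr_norml; lra.
Qed.

Lemma der_ray_action p : Num.sqrt (f A) < p < Num.sqrt (f B) -> is_derive p 1 Ip (- opening p).
Proof.
move=> pI; have [xI E] := turning_pointP pI.
have p0 : 0 < p by have := sqrtr_ge0 (f A); lra.
have [d d0 Hd] := momentum_range_near pI.
have dx0 : 0 < df (turning_point p) by apply: (pf_df_gt0 pf); lra.
apply: (is_derive_near d0 (f := fun y => II (turning_point y))).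
  by move=> y /Hd yI; have [yxI {2}<-] := turning_pointP yI; rewrite -ray_action_turning_point.
apply: (is_derive_eq (der_comp (g := turning_point) (der_radial_action pf xI) (der_turning_point pI))).
by rewrite /opening; field; rewrite gt_eqF.
Qed.

Lemma der_opening p : Num.sqrt (f A) < p < Num.sqrt (f B) -> is_derive p 1 opening (d_opening p).
Proof.
move=> pI; have [xI E] := turning_pointP pI.
have p0 : 0 < p by have := sqrtr_ge0 (f A); lra.
have dx0 : 0 < df (turning_point p) by apply: (pf_df_gt0 pf); lra.
have D1 := der_comp (g := turning_point) (der_half_angle_time pf xI) (der_turning_point pI).
have D2 := der_mul (der_mul (der_cst 2 p) (der_id p)) D1.
apply: (is_derive_eq D2).
have f0 : 0 < f (turning_point p) by apply: (pf_pos pf); lra.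
have fE : f (turning_point p) = p ^+ 2 by rewrite -[in RHS]E sqr_sqrtr ?ltW.
rewrite /d_opening fE; field.
by rewrite !gt_eqF.
Qed.

Lemma d_opening_cont p : Num.sqrt (f A) < p < Num.sqrt (f B) -> {for p, continuous d_opening}.
Proof.
move=> pI; have [xI E] := turning_pointP pI.
have cx : ctn p turning_point := is_derive_continuous (der_turning_point pI).
have dx0 : 0 < df (turning_point p) by apply: (pf_df_gt0 pf); lra.
have f0 : 0 < f (turning_point p) by apply: (pf_pos pf); lra.
have cdf : ctn p (fun p => df (turning_point p)) by apply: ctn_comp cx; exact: (pf_dcont pf).
have cf : ctn p (fun p => f (turning_point p)) by apply: ctn_comp cx; exact: (pf_cont pf).
have cS : ctn p (fun p => SS (turning_point p)).
  by apply: ctn_comp cx; exact: is_derive_continuous (der_half_angle_time pf xI).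
have cSd : ctn p (fun p => Sd (turning_point p)) by apply: ctn_comp cx; exact: (d_half_angle_time_cont pf).
have v1 : ctn p (fun y => (df (turning_point y))^-1) by apply: ctnV => //; rewrite gt_eqF.
have v2 : ctn p (fun y => (2 * f (turning_point y))^-1).
  by apply: ctnV; [rewrite mulf_neq0// gt_eqF|cts].
by rewrite /d_opening; cts.
Qed.

Lemma ray_action_lt p p' : Num.sqrt (f A) < p -> p < p' -> p' <= Num.sqrt (f B) -> Ip p' < Ip p.
Proof.
move=> Ap pp' pB.
have [z zI|z|z zI EE] := @mvt_lin _ Ip (fun p => - opening p) p p' pp'.
- exact: ray_action_cont.
- by move=> zI; apply: der_ray_action; lra.
- have [xI E] := @turning_pointP z ltac:(lra).
  have z0 : 0 < z by have := sqrtr_ge0 (f A); lra.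
  have S0 := half_angle_time_gt0 xI.
  have a0 : 0 < opening z by rewrite /opening !mulr_gt0.
  rewrite -subr_lt0 EE mulNr oppr_lt0 mulr_gt0//; lra.
Qed.

End ActionOfMomentum.

(** * Abel inversion *)

Section Abel.
Context {R : realType}.
Implicit Types (f : R -> R) (A B q L y u v : R).

Definition beta : R := Rint 0 1 (fun w => Num.sqrt w * Num.sqrt (1 - w)).

Lemma beta_gt0 : 0 < beta.
Proof.
apply: Rint_gt0 => //; first by move=> z _; cts.
by move=> w wI; rewrite mulr_gt0// sqrtr_gt0; lra.
Qed.

(** Scaling [v = th * w]. *)
Lemma beta_scale (th : R) : th <= 1 ->
  Rint 0 1 (fun v => Num.sqrt v * Num.sqrt (th - v)) = beta * Num.max 0 th ^+ 2.
Proof.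
move=> th1; pose h (v : R) := Num.sqrt v * Num.sqrt (th - v).
have ch a b : cont_itv a b h by move=> z _; rewrite /h; cts.
have zero a : th <= a -> a <= 1 -> Rint a 1 h = 0.
  move=> tha a1; rewrite (Rint_ext (g := fun=> 0)) ?Rint_cst ?mul0r//.
  by move=> v vI; rewrite /h (ler0_sqrtr (_ : th - v <= 0)) ?mulr0//; lra.
have [th0|th0] := leP th 0.
  by rewrite -/h (zero 0)// expr0n mulr0.
rewrite -/h (@Rint_split _ 0 th 1) ?(zero th)// ?ltW// addr0.
pose F (w : R) := Rint (-1) (th * w) h.
have dF (w : R) : 0 <= w -> is_derive w 1 F (h (th * w) * th).
  move=> w0.
  have D1 : is_derive (th * w) 1 (fun y => Rint (-1) y h) (h (th * w)).
    apply: (@Rint_FTC1 _ (-1) (th * w + 1)) => //; last lra.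
    by have := mulr_ge0 (ltW th0) w0; lra.
  have D2 : is_derive w 1 (fun w => th * w) th.
    by eapply is_derive_eq; [der|rewrite /=; ring].
  exact: (der_comp (g := fun w => th * w) D1 D2).
have E : Rint 0 1 (fun w => h (th * w) * th) = F 1 - F 0.
  apply: Rint_FTC2 => //.
  - by move=> z _; rewrite /h; cts.
  - by move=> z zI; apply: is_derive_continuous (dF z _); lra.
  - by move=> z zI; apply: dF; lra.
have -> : Rint 0 th h = F 1 - F 0.
  rewrite /F mulr1 mulr0 (@Rint_split _ (-1) 0 th) ?(ltW th0)//; last lra.
rewrite -E mulrC -Rint_Z; last by move=> z _; cts.
apply: Rint_ext => w wI; rewrite /h.
have -> : th - th * w = th * (1 - w) by ring.
rewrite !sqrtrM ?ltW//.
have := sqr_sqrtr (ltW th0); rewrite expr2 => e.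
rewrite -[in RHS]e -[in X in _ * X = _]e; ring.
Qed.

(** Integrating [sqrt ((f u - s)_+)] over [s] against [sqrt (s - q)] gives a
    multiple of [(f u - q)_+ ^2].  The exchange of integrations holds because
    both sides, as functions of the upper limit [B], have the same derivative. *)
Lemma abel_moment f A B q L : A < B -> (forall u, {for u, continuous f}) -> 0 < L ->
  (forall u, A <= u <= B -> f u <= q + L) ->
  Rint 0 1 (fun v => Num.sqrt v * Rint A B (fun u => Num.sqrt (f u - (q + L * v)))) =
  beta * Num.sqrt L / L ^+ 2 * Rint A B (fun u => Num.max 0 (f u - q) ^+ 2).
Proof.
move=> AB cf L0 fL.
pose h v u := Num.sqrt (f u - (q + L * v)).
have ch v u : ctn u (h v) by rewrite /h; cts; exact: cf.
have chi v a b : cont_itv a b (h v) by move=> z _; exact: ch.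
pose k u := beta * Num.sqrt L / L ^+ 2 * Num.max 0 (f u - q) ^+ 2.
have cm u : ctn u (fun u => Num.max 0 (f u - q)).
  by apply: (ctn_max (f := fun=> 0)); cts; exact: cf.
have ck u : ctn u k by have c0 := cm u; rewrite /k; cts.
pose a := A - 1; pose b := B + 1.
have aA : a <= A by rewrite /a; lra.
have aB : a <= B by rewrite /a; lra.
pose P y := Rint 0 1 (fun v => Num.sqrt v * Rint a y (h v)).
have kE y : A <= y <= B -> Rint 0 1 (fun v => Num.sqrt v * h v y) = k y.
  move=> yI.
  rewrite (Rint_ext (g := fun v => Num.sqrt L * (Num.sqrt v * Num.sqrt ((f y - q) / L - v)))); last first.
    move=> v vI; rewrite /h (_ : f y - _ = L * ((f y - q) / L - v)).
      by rewrite sqrtrM ?ltW//; ring.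
    by field; rewrite gt_eqF.
  rewrite Rint_Z; last by move=> z _; cts.
  rewrite beta_scale; last by rewrite ler_pdivrMr// mul1r; have := fL y yI; lra.
  have -> : Num.max 0 ((f y - q) / L) = Num.max 0 (f y - q) / L.
    have [h0|h0] := leP 0 (f y - q).
      by rewrite max_r// divr_ge0// ltW.
    by rewrite max_l ?mul0r// pmulr_lle0 ?invr_gt0// ltW.
  by rewrite /k expr_div_n; field; rewrite gt_eqF.
have ab : a <= b by rewrite /a /b; lra.
have [E E0 HE] := cont_bdd ab (fun z _ => cf z).
pose G := Num.sqrt (E + `|q| + L).
have hG v u : 0 <= v <= 1 -> a <= u <= b -> `|h v u| <= G.
  move=> vI uI; rewrite ger0_norm ?sqrtr_ge0// /h /G ler_wsqrtr//.
  have := HE u uI; have := ler_norm (f u); have := ler_norm (- q); rewrite normrN.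
  by have : 0 <= L * v by [rewrite mulr_ge0//; lra]; lra.
have cR y v : a <= y -> ctn v (fun v => Rint a y (h v)).
  move=> ay; apply/continuousP_eps => e e0.
  have cs : ctn v (fun v' => Num.sqrt `|L * v' - L * v| * (y - a)) by cts.
  have [d d0 Hd] := (continuousP_eps _ _).1 cs _ e0.
  exists d => // v' /Hd; rewrite subrr normr0 sqrtr0 mul0r subr0.
  rewrite ger0_norm; last by rewrite mulr_ge0 ?sqrtr_ge0 ?subr_ge0.
  apply: le_lt_trans; rewrite -Rint_B; [|exact: chi..].
  apply: Rint_abs => //; first by move=> z _; apply: continuousB; exact: ch.
  move=> u _; apply: (le_trans (sqrt_sub_le _ _)).
  by rewrite (_ : _ - _ - _ = - (L * v' - L * v)) ?normrN//; ring.
have dP y : A <= y <= B -> is_derive y 1 P (k y).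
  move=> yI; rewrite -kE//.
  have s1 v : 0 < v <= 1 -> `|Num.sqrt v| <= 1.
    move=> vI; rewrite ger0_norm ?sqrtr_ge0// -[leRHS]sqrtr1 ler_wsqrtr//; lra.
  have G0 : 0 <= G by exact: sqrtr_ge0.
  apply: (@Rint01_param_derive _ (fun y v => Num.sqrt v * Rint a y (h v))
    (fun y v => Num.sqrt v * h v y) (A - 1/2) (B + 1/2) y (Num.max G (G * (b - a)))).
  - by lra.
  - move=> z v zI vI; apply: (ctnM (f := fun v => Num.sqrt v)); first by cts.
    by apply: cR; rewrite /a; lra.
  - move=> z v zI vI; rewrite normrM -[leRHS]mul1r ler_pM//; first exact: s1.
    rewrite le_max; apply/orP; right.
    apply: (@le_trans _ _ (G * (z - a))).
      apply: Rint_abs => //; [by rewrite /a; lra|move=> u uI].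
      by apply: hG; move: uI; rewrite /b; lra.
    by rewrite ler_wpM2l// /b; lra.
  - move=> z v zI vI.
    have D1 : is_derive z 1 (fun z => Rint a z (h v)) (h v z).
      by apply: (@Rint_FTC1 _ a b) => //; rewrite /a /b; lra.
    by apply: (is_derive_eq (der_mul (der_cst (Num.sqrt v) z) D1)); rewrite mul0r add0r.
  - move=> z v zI vI; rewrite normrM -[leRHS]mul1r ler_pM//; first exact: s1.
    by rewrite le_max hG//; [lra|rewrite /a /b; lra].
  - by apply: cont_bdd_cont01 => v _; rewrite /h; cts.
have EP : P B - P A = Rint A B k.
  symmetry; apply: Rint_FTC2 => //.
  - by move=> z _; exact: ck.
  - by move=> z zI; apply: is_derive_continuous (dP z _); lra.
  - by move=> z zI; apply: dP; lra.
rewrite -Rint_Z; last by move=> z _; have c0 := cm z; cts.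
rewrite -/k -EP /P -Rint_B.
- apply: Rint_ext => v vI; rewrite -mulrBr (@Rint_split _ a A B) ?(ltW AB)//.
  by rewrite [_ + Rint A B _]addrC addrK.
- move=> v _; apply: (ctnM (f := fun v => Num.sqrt v) (g := fun v => Rint a B (h v))).
    by cts.
  exact: cR.
- move=> v _; apply: (ctnM (f := fun v => Num.sqrt v) (g := fun v => Rint a A (h v))).
    by cts.
  exact: cR.
Qed.

(** Second difference with step [h] of the squared positive part, an approximate
    multiple of the indicator function of [y > 0]. *)
Definition bump (h y : R) := Num.max 0 y ^+ 2 - 2 * Num.max 0 (y - h) ^+ 2
  + Num.max 0 (y - 2 * h) ^+ 2.

Lemma bump_bounds (h y : R) : 0 < h -> 0 <= bump h y <= 2 * h ^+ 2.
Proof.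
move=> h0; rewrite /bump.
by case: (leP 0 y) => h1; case: (leP 0 (y - h)) => h2; case: (leP 0 (y - 2 * h)) => h3;
  try lra; apply/andP; split; nra.
Qed.

Lemma bump_max (h y : R) : 0 < h -> 2 * h <= y -> bump h y = 2 * h ^+ 2.
Proof.
by move=> h0 hy; rewrite /bump !max_r; [ring|lra..].
Qed.

Lemma bump_0 (h y : R) : 0 < h -> y <= 0 -> bump h y = 0.
Proof.
by move=> h0 hy; rewrite /bump !max_l; [ring|lra..].
Qed.

(** By [abel_moment] the action determines the integrals of [(f - q)_+ ^2] for
    [q > P1 ^ 2], hence those of [bump h (f - q)].  If [f2 u < f1 u], choose
    [q] and [q + 2 h] between them: by monotonicity the integral is at least
    [2 h^2 (B - u')] with [u' < u] for [f1], and at most [2 h^2 (B - u)] for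
    [f2]. *)
Lemma abel_le (f1 f2 df1 df2 : R -> R) A B (M1 M2 P1 : R) :
  profile f1 df1 A B M1 -> profile f2 df2 A B M2 ->
  Num.sqrt (f1 A) <= P1 -> Num.sqrt (f2 A) <= P1 ->
  (forall p, P1 < p -> ray_action f1 A B p = ray_action f2 A B p) ->
  forall u, A <= u <= B -> P1 ^+ 2 < f1 u -> f1 u <= f2 u.
Proof.
move=> pf1 pf2 h1 h2 HI u uI Pu.
have AB := pf_AB pf1.
have P0 : 0 <= P1 by apply: le_trans h1; exact: sqrtr_ge0.
have cf1 := pf_cont pf1; have cf2 := pf_cont pf2.
pose Z := Num.max (f1 B) (f2 B).
have mom q : P1 ^+ 2 < q -> 
  Rint A B (fun u => Num.max 0 (f1 u - q) ^+ 2) = Rint A B (fun u => Num.max 0 (f2 u - q) ^+ 2).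
  move=> Pq; pose L := 1 + `|Z - q|.
  have L0 : 0 < L by rewrite ltr_wpDr.
  have fL1 v : A <= v <= B -> f1 v <= q + L.
    move=> vI; have : f1 v <= f1 B by apply: (pf_le pf1); lra.
    have : f1 B <= Z by rewrite le_max lexx.
    by have := ler_norm (Z - q); rewrite /L; lra.
  have fL2 v : A <= v <= B -> f2 v <= q + L.
    move=> vI; have : f2 v <= f2 B by apply: (pf_le pf2); lra.
    have : f2 B <= Z by rewrite le_max lexx orbT.
    by have := ler_norm (Z - q); rewrite /L; lra.
  have E1 := abel_moment AB cf1 L0 fL1; have E2 := abel_moment AB cf2 L0 fL2.
  have n0 : beta * Num.sqrt L / L ^+ 2 != 0.
    by rewrite gt_eqF// divr_gt0 ?exprn_gt0// mulr_gt0 ?beta_gt0// sqrtr_gt0.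
  apply: (mulfI n0); rewrite -E1 -E2; apply: Rint_ext => v vI; congr (_ * _).
  have Lv : 0 <= L * v by rewrite mulr_ge0 ?(ltW L0)//; case/andP: vI.
  have q00 : 0 < q by exact: le_lt_trans (sqr_ge0 P1) Pq.
  have q0 : 0 < q + L * v by rewrite ltr_wpDr.
  have p1 : P1 < Num.sqrt (q + L * v).
    by rewrite -[ltLHS](ger0_norm P0) -sqrtr_sqr ltr_sqrt// ltr_wpDr.
  have := HI _ p1; rewrite /ray_action sqr_sqrtr ?(ltW q0)//.
  have ci f : (forall u, {for u, continuous f}) -> cont_itv A B (fun u => Num.sqrt (f u - (q + L * v))).
    by move=> cf z _; cts; exact: cf.
  by rewrite !Rint_Z//; [|exact: ci..] => /mulfI; apply.
rewrite leNgt; apply/negP => lt21.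
pose q0 := Num.max (f2 u) (P1 ^+ 2).
have q0f : q0 < f1 u by rewrite gt_max lt21.
have q02 : f2 u <= q0 by rewrite le_max lexx.
have q0P : P1 ^+ 2 <= q0 by rewrite le_max lexx orbT.
pose h := (f1 u - q0) / 8; pose q := q0 + 2 * h.
have h0 : 0 < h by rewrite /h; lra.
have Bint f q' : (forall u, {for u, continuous f}) -> cont_itv A B (fun u => Num.max 0 (f u - q') ^+ 2).
  move=> cf z _.
  have c0 : ctn z (fun u => Num.max 0 (f u - q')).
    by apply: (ctn_max (f := fun=> 0)); cts; exact: cf.
  by cts.
have cb f : (forall u, {for u, continuous f}) -> forall a b, cont_itv a b (fun u => bump h (f u - q)).
  move=> cf a b z _; rewrite /bump.
  have cm s : ctn z (fun u => Num.max 0 (f u - q - s)).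
    by apply: (ctn_max (f := fun=> 0)); cts; exact: cf.
  have cm0 : ctn z (fun u => Num.max 0 (f u - q)).
    by apply: (ctn_max (f := fun=> 0)); cts; exact: cf.
  have cmh := cm h; have cm2 := cm (2 * h).
  by cts.
have EB f : (forall u, {for u, continuous f}) -> Rint A B (fun u => bump h (f u - q)) =
  Rint A B (fun u => Num.max 0 (f u - q) ^+ 2)
  + (-2) * Rint A B (fun u => Num.max 0 (f u - (q + h)) ^+ 2)
  + Rint A B (fun u => Num.max 0 (f u - (q + 2 * h)) ^+ 2).
  move=> cf.
  have c1 := Bint f q cf; have c2 := Bint f (q + h) cf; have c3 := Bint f (q + 2 * h) cf.
  have c2' := cont_itvM (k := -2) c2.
  have c12 : cont_itv A B (fun u => Num.max 0 (f u - q) ^+ 2 +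
    (-2) * Num.max 0 (f u - (q + h)) ^+ 2).
    by move=> z zI; have d1 : ctn z _ := c1 z zI; have d2 : ctn z _ := c2' z zI; cts.
  rewrite -(Rint_Z (-2) c2) -(Rint_D c1 c2') -(Rint_D c12 c3).
  by apply: Rint_ext => z _; rewrite /bump !opprD !addrA; ring.
have EE : Rint A B (fun u => bump h (f1 u - q)) = Rint A B (fun u => bump h (f2 u - q)).
  by rewrite !EB// !mom//; rewrite /q; lra.
have uA : A < u.
  have /andP[+ _] := uI; rewrite le_eqVlt => /predU1P[uA|//].
  have : f1 A <= P1 ^+ 2.
    by rewrite -(sqr_sqrtr (ltW (pf_gt0 pf1))) lerXn2r// nnegrE sqrtr_ge0.
  by rewrite uA; lra.
have [d d0 Hd] := (continuousP_eps _ _).1 (cf1 u) _ h0.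
pose u' := Num.max ((A + u) / 2) (u - d / 2).
have u'I : A < u' < u by rewrite lt_max gt_max; lra.
have u'd : u - u' < d.
  have : u - d / 2 <= u' by rewrite le_max lexx orbT.
  by lra.
have big : 2 * h ^+ 2 * (B - u') <= Rint A B (fun u => bump h (f1 u - q)).
  rewrite (@Rint_split _ A u' B); [|lra|lra|exact: cb].
  rewrite -[leLHS]add0r lerD//.
    by apply: Rint_ge0 => z _; case/andP: (bump_bounds (f1 z - q) h0).
  rewrite -Rint_cst; last lra.
  apply: Rint_le; [by move=> z _; exact: ctnC|exact: cb|].
  move=> z zI; rewrite bump_max//.
  have : f1 u' <= f1 z by apply: (pf_le pf1); lra.
  have := Hd u'; rewrite distrC ger0_norm; last lra.
  by move=> /(_ u'd); rewrite ltr_norml /q /h; lra.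
have small : Rint A B (fun u => bump h (f2 u - q)) <= 2 * h ^+ 2 * (B - u).
  rewrite (@Rint_split _ A u B); [|lra|lra|exact: cb].
  rewrite (Rint_ext (g := fun=> 0) (a := A)); last first.
    move=> z zI; rewrite bump_0//.
    have : f2 z <= f2 u by apply: (pf_le pf2); lra.
    by rewrite /q; lra.
  rewrite Rint_cst ?mul0r ?add0r; last lra.
  rewrite -Rint_cst; last lra.
  apply: Rint_le; [exact: cb|by move=> z _; exact: ctnC|].
  by move=> z _; case/andP: (bump_bounds (f2 z - q) h0).
have : 2 * h ^+ 2 * (B - u') <= 2 * h ^+ 2 * (B - u).
  by apply: (le_trans big); rewrite EE.
rewrite ler_pM2l; last by rewrite mulr_gt0// exprn_gt0.
by lra.
Qed.

End Abel.

(** * Rigidity of a family of profiles on a fixed layer *)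

Section Aux.
Context {R : realType}.
Implicit Types (g h : R -> R) (a b c p : R).

Lemma same_derive_diff g h d a b :
  (forall p, a < p < b -> is_derive p 1 g (d p)) ->
  (forall p, a < p < b -> is_derive p 1 h (d p)) ->
  forall p p', a < p < b -> a < p' < b -> g p - g p' = h p - h p'.
Proof.
move=> dg dh.
have D p : a < p < b -> is_derive p 1 (fun p => g p - h p) 0.
  by move=> pI; apply: (is_derive_eq (der_add (dg p pI) (der_opp (dh p pI)))); rewrite subrr.
have W p p' : p < p' -> a < p < b -> a < p' < b -> g p - g p' = h p - h p'.
  move=> pp' pI pI'.
  have [z zI|z|z zI] := @mvt_lin _ (fun p => g p - h p) (fun=> 0) p p' pp'.
  - by apply: is_derive_continuous (D z _); lra.
  - by move=> zI; apply: D; lra.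
  - by rewrite mul0r; lra.
move=> p p' pI pI'; case: (ltgtP p p') => [h1|h1|->]; [exact: W| |by rewrite !subrr].
by have := W _ _ h1 pI' pI; lra.
Qed.

Lemma cont_end_eq g a b c : a < b -> {for b, continuous g} ->
  (forall p, a < p < b -> g p = c) -> g b = c.
Proof.
move=> ab /continuousP_eps cg H; apply/eqP; rewrite -subr_eq0 -normr_eq0.
apply/negPn/negP => n0; have n1 : 0 < `|g b - c| by rewrite lt_def n0 normr_ge0.
have [d d0 Hd] := cg _ n1.
pose p := Num.max ((a + b) / 2) (b - d / 2).
have h1 : (a + b) / 2 <= p by rewrite le_max lexx.
have h2 : b - d / 2 <= p by rewrite le_max lexx orbT.
have h3 : p < b by rewrite gt_max; lra.
have pd : `|p - b| < d by rewrite ltr_norml; lra.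
by have := Hd p pd; rewrite (H p) ?[`|c - _|]distrC ?ltxx//; lra.
Qed.

(** The orientation puts [B], where continuity in the parameter is unknown, at
    the excluded end [0]. *)
Lemma Rint_flip A B g : A < B -> (forall u, {for u, continuous g}) ->
  Rint A B g = (B - A) * Rint 0 1 (fun v => g (B - (B - A) * v)).
Proof.
move=> AB cg.
have ci x y : cont_itv x y g by move=> z _; exact: cg.
have cgv z : ctn z (fun v => g (B - (B - A) * v)).
  by apply: (ctn_comp (g := fun v => B - (B - A) * v)); [exact: cg|cts].
pose F (v : R) := - Rint (A - 1) (B - (B - A) * v) g.
have dF (v : R) : v <= 1 -> is_derive v 1 F ((B - A) * g (B - (B - A) * v)).
  move=> v1; have h : (B - A) * v <= (B - A) * 1 by rewrite ler_pM2l//; lra.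
  have D1 : is_derive (B - (B - A) * v) 1 (fun y => Rint (A - 1) y g) (g (B - (B - A) * v)).
    by apply: (@Rint_FTC1 _ (A - 1) (B - (B - A) * v + 1)) => //; lra.
  have D2 : is_derive v 1 (fun v => B - (B - A) * v) (- (B - A)).
    by eapply is_derive_eq; [der|rewrite /=; ring].
  apply: (is_derive_eq (der_opp (der_comp (g := fun v => B - (B - A) * v) D1 D2))).
  by ring.
have E : Rint 0 1 (fun v => (B - A) * g (B - (B - A) * v)) = F 1 - F 0.
  apply: (Rint_FTC2 ltr01).
  - by move=> z _; have c0 := cgv z; cts.
  - by move=> z zI; apply: is_derive_continuous (dF z _); lra.
  - by move=> z zI; apply: dF; lra.
rewrite -Rint_Z; last by move=> z _; exact: cgv.
rewrite E /F mulr1 mulr0 subr0 (_ : B - (B - A) = A); last by ring.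
by rewrite (@Rint_split _ (A - 1) A B) ?(ltW AB)//; lra.
Qed.

Lemma dist4 (a a' b b' e : R) : `|a - b| <= e -> `|a' - b'| <= e ->
  `|(2 * a - 2 * a') - (2 * b - 2 * b')| <= 4 * e.
Proof. by rewrite !ler_norml; lra. Qed.

Lemma dist4' (a a' b b' e : R) : `|a - a'| <= e -> `|b - b'| <= e ->
  `|(2 * a - 2 * a') - (2 * b - 2 * b')| <= 4 * e.
Proof. by rewrite !ler_norml; lra. Qed.

Lemma sqr_dist (p p' e : R) : 0 <= p <= e -> 0 <= p' <= e -> `|p' ^+ 2 - p ^+ 2| <= e ^+ 2.
Proof.
move=> /andP[p0 pe] /andP[p0' pe'].
have h : p ^+ 2 <= e ^+ 2 by rewrite lerXn2r// nnegrE// (le_trans p0).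
have h' : p' ^+ 2 <= e ^+ 2 by rewrite lerXn2r// nnegrE// (le_trans p0).
by have := sqr_ge0 p; have := sqr_ge0 p'; rewrite ler_norml; lra.
Qed.

End Aux.

(** What is used of the profiles of one layer, with the top at [B] independent
    of [t]: continuity in [t] at interior points, momenta above [P1],
    countably many critical values for a dense set of slopes, and an opening
    angle that is nowhere locally constant. *)
Record rigid_family {R : realType} (tl tr : R) (f df : R -> R -> R) (A B : R)
    (M : R -> R) (P1 : R) : Prop := RigidFamily {
  rf_pf : forall t, tl < t < tr -> profile (f t) (df t) A B (M t);
  rf_cont : forall t u, tl < t < tr -> A <= u < B -> {for t, continuous (f^~ u)};
  rf_low : forall t, tl < t < tr -> Num.sqrt (f t A) <= P1;
  rf_top : forall t, tl < t < tr -> P1 < Num.sqrt (f t B);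
  rf_spec : forall x y : R, x < y -> exists2 q, x < q < y &
    exists2 S, countable S & forall t p, tl < t < tr -> P1 < p < Num.sqrt (f t B) ->
      opening (f t) (df t) A B p = q -> S (ray_action (f t) A B p + q * p);
  rf_nd : forall t a b, tl < t < tr -> P1 < a -> a < b -> b < Num.sqrt (f t B) ->
    exists2 p, a < p < b & d_opening (f t) (df t) A B p != 0 }.

Section Family.
Context {R : realType}.
Variables (tl tr : R) (f df : R -> R -> R) (A B : R) (M : R -> R) (P1 : R).
Hypothesis rf : rigid_family tl tr f df A B M P1.
Implicit Types (t p u : R).
Local Notation I t := (ray_action (f t) A B).
Local Notation W t := (Num.sqrt (f t B)).
Local Notation al t := (opening (f t) (df t) A B).
Local Notation dal t := (d_opening (f t) (df t) A B).

(** The integrands for [t'] and [t] differ by at most [4 sqrt |f t' - f t|], and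
    by at most [4 P2]; so dominated convergence gives an estimate uniform in
    [p] and [p']. *)
Lemma ray_action_tau_cont t P2 e : tl < t < tr -> 0 <= P2 -> 0 < e -> exists2 d, 0 < d &
  forall t', tl < t' < tr -> `|t' - t| < d -> forall p p', 0 <= p <= P2 -> 0 <= p' <= P2 ->
  `|(I t' p - I t' p') - (I t p - I t p')| < e.
Proof.
move=> tI P20 e0.
have AB := pf_AB (rf_pf rf tI).
have cf s u : tl < s < tr -> {for u, continuous (f s)} by move=> sI; exact: (pf_cont (rf_pf rf sI)).
pose C := 4 * P2.
pose G s u := Num.min (4 * Num.sqrt `|f s u - f t u|) C.
have cG s u : tl < s < tr -> ctn u (G s).
  move=> sI; apply: (ctn_min (g := fun=> C)); last exact: ctnC.
  by have c1 := cf s u sI; have c2 := cf t u tI; cts.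
have C0 : 0 <= C by rewrite mulr_ge0.
have G0 s u : 0 <= G s u by rewrite le_min C0 mulr_ge0 ?sqrtr_ge0.
have cR : {for t, continuous (fun s => Rint 0 1 (fun v => G s (B - (B - A) * v)))}.
  apply: (@Rint01_param_cont _ (fun s v => G s (B - (B - A) * v)) tl tr t C) => //.
  - move=> s v sI vI.
    by apply: (ctn_comp (g := fun v => B - (B - A) * v)); [exact: cG|cts].
  - move=> s v sI vI.
    apply: (ctn_min (f := fun s => 4 * Num.sqrt `|f s (B - (B - A) * v) - f t (B - (B - A) * v)|)
      (g := fun=> C)); last exact: ctnC.
    have uI : A <= B - (B - A) * v < B.
      have h1 : (B - A) * v <= (B - A) * 1 by rewrite ler_pM2l//; lra.
      have h2 : 0 < (B - A) * v by rewrite mulr_gt0//; lra.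
      by lra.
    by have c1 := rf_cont rf sI uI; cts.
  - by move=> s v sI vI; rewrite ger0_norm// ge_min lexx orbT.
have BA : 0 < B - A by lra.
have [d d0 Hd] := (continuousP_eps _ _).1 cR _ (divr_gt0 e0 BA).
exists d => // s sI sd p p' pI p'I.
have : (B - A) * Rint 0 1 (fun v => G s (B - (B - A) * v)) < e.
  have := Hd s sd.
  have -> : Rint 0 1 (fun v => G t (B - (B - A) * v)) = 0.
    rewrite (Rint_ext (g := fun=> 0)) ?Rint_cst ?mul0r// => v _.
    by rewrite /G subrr normr0 sqrtr0 mulr0 min_l.
  rewrite subr0 => h; rewrite mulrC -ltr_pdivlMr//.
  exact: le_lt_trans (ler_norm _) h.
rewrite -Rint_flip//; last by move=> u; exact: cG.
apply: le_lt_trans.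
have ci s' p'' : tl < s' < tr -> cont_itv A B (fun u => 2 * Num.sqrt (f s' u - p'' ^+ 2)).
  by move=> sI' z _; have c1 := cf s' z sI'; cts.
have ci2 s' : tl < s' < tr -> cont_itv A B
    (fun u => 2 * Num.sqrt (f s' u - p ^+ 2) - 2 * Num.sqrt (f s' u - p' ^+ 2)).
  by move=> sI' z _; have c1 := cf s' z sI'; cts.
have ci3 : cont_itv A B (fun u =>
  (2 * Num.sqrt (f s u - p ^+ 2) - 2 * Num.sqrt (f s u - p' ^+ 2)) -
  (2 * Num.sqrt (f t u - p ^+ 2) - 2 * Num.sqrt (f t u - p' ^+ 2))).
  by move=> z zI; have c1 : ctn z _ := ci2 s sI z zI; have c2 : ctn z _ := ci2 t tI z zI; cts.
rewrite /ray_action -(Rint_B (ci s p sI) (ci s p' sI)) -(Rint_B (ci t p tI) (ci t p' tI)).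
rewrite -(Rint_B (ci2 s sI) (ci2 t tI)).
have cGi : cont_itv A B (G s) by move=> z _; exact: cG.
have bnd u : `|(2 * Num.sqrt (f s u - p ^+ 2) - 2 * Num.sqrt (f s u - p' ^+ 2)) -
  (2 * Num.sqrt (f t u - p ^+ 2) - 2 * Num.sqrt (f t u - p' ^+ 2))| <= G s u.
  rewrite le_min; apply/andP; split.
    have h1 := sqrt_sub_le (f s u - p ^+ 2) (f t u - p ^+ 2).
    have h2 := sqrt_sub_le (f s u - p' ^+ 2) (f t u - p' ^+ 2).
    rewrite (_ : f s u - p ^+ 2 - _ = f s u - f t u) in h1; last by ring.
    rewrite (_ : f s u - p' ^+ 2 - _ = f s u - f t u) in h2; last by ring.
    exact: dist4 h1 h2.
  have H z : `|Num.sqrt (z - p ^+ 2) - Num.sqrt (z - p' ^+ 2)| <= P2.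
    apply: (le_trans (sqrt_sub_le _ _)).
    rewrite -[leRHS](ger0_norm P20) -(sqrtr_sqr P2) ler_wsqrtr// (_ : _ - _ - _ = p' ^+ 2 - p ^+ 2); last by ring.
    exact: sqr_dist.
  exact: dist4' (H _) (H _).
rewrite ler_norml; apply/andP; split.
  rewrite lerNl -[leLHS]mulN1r -Rint_Z//; apply: Rint_le => //.
    exact: cont_itvM.
  by move=> u _; rewrite mulN1r; have := bnd u; rewrite ler_norml lerNl => /andP[].
by apply: Rint_le => // u _; apply: le_trans (ler_norm _) (bnd u).
Qed.

Let AB t : tl < t < tr -> A < B. Proof. by move=> /(rf_pf rf)/pf_AB. Qed.

Lemma low_in t p : tl < t < tr -> P1 < p < W t -> Num.sqrt (f t A) < p < W t.
Proof. by move=> tI pI; have := rf_low rf tI; lra. Qed.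

Lemma P1_ge0 t : tl < t < tr -> 0 <= P1.
Proof. by move=> tI; apply: le_trans (rf_low rf tI); exact: sqrtr_ge0. Qed.

Lemma family_slope (T : set R) P2 : (forall t, T t -> tl < t < tr) ->
  (forall t, T t -> P2 <= W t) ->
  slope_family T P1 P2 (fun t => I t) (fun t => al t) (fun t => dal t).
Proof.
move=> TI TW.
have inW t p : T t -> P1 < p < P2 -> P1 < p < W t by move=> /TW; lra.
split.
- by move=> t p Tt pI; apply: (der_ray_action (rf_pf rf (TI t Tt))); exact: low_in (TI t Tt) (inW _ _ Tt pI).
- by move=> t p Tt pI; apply: (der_opening (rf_pf rf (TI t Tt))); exact: low_in (TI t Tt) (inW _ _ Tt pI).
- by move=> t p Tt pI; apply: (d_opening_cont (rf_pf rf (TI t Tt))); exact: low_in (TI t Tt) (inW _ _ Tt pI).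
- move=> t Tt e e0; have P10 := P1_ge0 (TI t Tt).
  have [d d0 Hd] := ray_action_tau_cont (TI t Tt) (normr_ge0 P2) e0.
  exists d => // t' Tt' td p p' pI pI'.
  have h := ler_norm P2.
  by apply: Hd => //; [exact: TI|lra|lra].
- move=> x y xy; have [q qI [S cS HS]] := rf_spec rf xy.
  exists q => //; exists S => // t p Tt pI E.
  by apply: HS => //; [exact: TI|exact: inW].
Qed.

Lemma family_opening (T : set R) P2 : is_interval T -> (forall t, T t -> tl < t < tr) ->
  (forall t, T t -> P2 <= W t) ->
  forall t t' p, T t -> T t' -> P1 < p < P2 -> al t p = al t' p.
Proof.
move=> iT TI TW.
apply: (slope_rigidity iT (family_slope TI TW)).
by move=> t a b Tt Pa ab bP; apply: (rf_nd rf) => //; [exact: TI|have := TW t Tt; lra].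
Qed.

Lemma family_ray_action (T : set R) P2 : is_interval T -> (forall t, T t -> tl < t < tr) ->
  (forall t, T t -> P2 <= W t) ->
  forall t t' p p', T t -> T t' -> P1 < p < P2 -> P1 < p' < P2 ->
  I t p - I t p' = I t' p - I t' p'.
Proof.
move=> iT TI TW t t' p p' Tt Tt'.
have dact s x : T s -> P1 < x < P2 -> is_derive x 1 (I s) (- al s x).
  move=> Ts xI; apply: (der_ray_action (rf_pf rf (TI s Ts))); apply: low_in; first exact: TI.
  by have := TW s Ts; lra.
apply: (@same_derive_diff _ _ _ (fun p => - al t p)); first by move=> x; exact: dact.
by move=> x xI; rewrite (family_opening iT TI TW Tt Tt' xI); exact: dact.
Qed.

(** If [f t B > p^2], then [f t u > p^2] at some [u < B], where [f] is
    continuous in [t]. *)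
Lemma top_momentum_lsc t p : tl < t < tr -> 0 <= p -> p < W t ->
  exists2 d, 0 < d & forall t', tl < t' < tr -> `|t' - t| < d -> p < W t'.
Proof.
move=> tI p0 pW; have pf := rf_pf rf tI; have AB' := AB tI.
have p2 : p ^+ 2 < f t B.
  by rewrite -ltr_sqrt ?sqrtr_sqr ?ger0_norm//; apply: (pf_pos pf); lra.
have e0 : 0 < f t B - p ^+ 2 by lra.
have cB : {for B, continuous (f t)} by exact: (pf_cont pf).
have [d d0 Hd] := (continuousP_eps _ _).1 cB _ e0.
pose u := Num.max A (B - d / 2).
have uI : A <= u < B by rewrite le_max lexx gt_max; lra.
have fu : p ^+ 2 < f t u.
  have h : B - d / 2 <= u by rewrite le_max lexx orbT.
  by have := Hd u; rewrite !ltr_norml => /(_ ltac:(lra)); lra.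
have e1 : 0 < f t u - p ^+ 2 by lra.
have [d1 d10 Hd1] := (continuousP_eps _ _).1 (rf_cont rf tI uI) _ e1.
exists d1 => // t' t'I td; have pf' := rf_pf rf t'I.
have fu' : p ^+ 2 < f t' u by have := Hd1 t' td; rewrite ltr_norml; lra.
have fB : f t' u <= f t' B by apply: (pf_le pf'); lra.
rewrite -[ltLHS]ger0_norm// -sqrtr_sqr ltr_sqrt; first lra.
by apply: (pf_pos pf'); lra.
Qed.

(** The supremum of the times at which the top momentum is at most [p2]; lower
    semicontinuity puts it in this set. *)
Lemma last_time t1 t2 p2 : tl < t1 -> t1 < t2 -> t2 < tr -> W t1 < p2 -> p2 < W t2 ->
  exists t3, [/\ t1 <= t3 < t2, W t3 <= p2 & forall t, t3 < t <= t2 -> p2 < W t].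
Proof.
move=> h1 h12 h2 p2l p2r.
have p20 : 0 <= p2 by apply: le_trans (ltW p2l); exact: sqrtr_ge0.
pose E := [set t | t1 <= t <= t2 /\ W t <= p2].
have E1 : E t1 by split; [rewrite lexx ltW|exact: ltW].
have ubE : ubound E t2 by move=> t [/andP[_ +] _].
have hsE : has_sup E by split; [exists t1|exists t2].
pose t3 := sup E.
have t13 : t1 <= t3 by exact: sup_ubound (proj2 hsE) _ E1.
have t32 : t3 <= t2 by exact: sup_le_ub (ex_intro _ _ E1) ubE.
have W3 : W t3 <= p2.
  rewrite leNgt; apply/negP => pW.
  have t3I : tl < t3 < tr by lra.
  have [d d0 Hd] := top_momentum_lsc t3I p20 pW.
  have [t [tI Wt] tt] := sup_adherent d0 hsE.
  have tt3 : t <= t3 by apply: sup_ubound (proj2 hsE) _ _.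
  have := Hd t ltac:(lra); rewrite ltr_norml -/t3 in tt * => /(_ ltac:(lra)).
  by lra.
exists t3; split => //.
  by rewrite t13 lt_neqAle t32 andbT; apply/eqP => e; move: W3; rewrite e; lra.
move=> t tI; rewrite ltNge; apply/negP => Wt.
have Et : E t by split; [lra|].
by have := sup_ubound (proj2 hsE) Et; rewrite -/t3; lra.
Qed.

(** Between [t3] and [t2] the top momentum exceeds [p2], so the action is
    static up to a constant on momenta below [p2]; by continuity this holds at
    [t3], where the action vanishes at [p2].  As the action at [t2] is strictly
    decreasing, the top momentum at [t3] cannot be smaller than [p2]. *)
Lemma top_momentum_crossing t1 t2 p2 : tl < t1 -> t1 < t2 -> t2 < tr -> W t1 < p2 -> p2 < W t2 ->
  exists t3, [/\ tl < t3 < tr, W t3 = p2 &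
    forall p, P1 < p < p2 -> I t3 p = I t2 p - I t2 p2 /\ al t3 p = al t2 p].
Proof.
have mark := Logic.I.
move=> h1 h12 h2 p2l p2r.
have [t3 [t3I W3 H]] := last_time h1 h12 h2 p2l p2r.
have tI1 : tl < t1 < tr by lra.
have tI2 : tl < t2 < tr by lra.
have tI3 : tl < t3 < tr by lra.
have P1W := rf_top rf tI1; have P10 := P1_ge0 tI1.
have P1W3 := rf_top rf tI3.
have p20 : 0 <= p2 by lra.
pose T := [set t | t3 < t <= t2].
have iT : is_interval T.
  by move=> x y Tx Ty z; move: Tx Ty; rewrite /T /=; lra.
have TI t : T t -> tl < t < tr by rewrite /T /=; lra.
have TW t : T t -> p2 <= W t by move=> /H; lra.
have T2 : T t2 by rewrite /T /=; lra.
have E0 p p' : P1 < p < p2 -> P1 < p' < p2 -> I t3 p - I t3 p' = I t2 p - I t2 p'.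
  move=> pI p'I; apply/eqP; rewrite -subr_eq0 -normr_eq0; apply/negPn/negP => n0.
  have n1 : 0 < `|(I t3 p - I t3 p') - (I t2 p - I t2 p')| by rewrite lt_def n0 normr_ge0.
  have [d d0 Hd] := ray_action_tau_cont tI3 p20 n1.
  pose t := Num.min t2 (t3 + d / 2).
  have tA : t <= t3 + d / 2 by rewrite ge_min lexx orbT.
  have tB : t <= t2 by rewrite ge_min lexx.
  have tC : t3 < t by rewrite lt_min; lra.
  have Tt : T t by rewrite /T /= tC.
  have td : `|t - t3| < d by rewrite ltr_norml; lra.
  have := Hd t (TI _ Tt) td p p' ltac:(lra) ltac:(lra).
  by rewrite (family_ray_action iT TI TW Tt T2 pI p'I) distrC ltxx.
have P1p2 : P1 < p2 by lra.
have c3 : {for p2, continuous (I t3)} by exact: (ray_action_cont (rf_pf rf tI3)).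
have c2 : {for p2, continuous (I t2)} by exact: (ray_action_cont (rf_pf rf tI2)).
have I3 : I t3 p2 = 0.
  apply: (ray_action_eq0 (rf_pf rf tI3)).
  have fB0 : 0 <= f t3 B by apply/ltW/(pf_pos (rf_pf rf tI3))/ltW/(AB tI3).
  by rewrite -(sqr_sqrtr fB0) lerXn2r ?nnegrE ?sqrtr_ge0.
have E p : P1 < p < p2 -> I t3 p = I t2 p - I t2 p2.
  move=> pI; have : I t3 p2 - I t2 p2 = I t3 p - I t2 p.
    apply: (@cont_end_eq _ (fun x => I t3 x - I t2 x) P1) => //.
      exact: ctnD c3 (ctnN c2).
    by move=> x xI; have := E0 x p xI pI; keep0; lra.
  by rewrite I3; keep0; lra.
have W3E : W t3 = p2.
  apply/eqP; rewrite eq_le W3 leNgt; apply/negP => h.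
  pose p := (W t3 + p2) / 2.
  have pI : P1 < p < p2 by rewrite /p; lra.
  have := E p pI; rewrite (ray_action_eq0 (rf_pf rf tI3)); last first.
    have fB0 : 0 <= f t3 B by apply/ltW/(pf_pos (rf_pf rf tI3))/ltW/(AB tI3).
    by rewrite -(sqr_sqrtr fB0) lerXn2r ?nnegrE ?sqrtr_ge0//; rewrite /p; lra.
  have := @ray_action_lt _ _ _ _ _ _ (rf_pf rf tI2) p p2.
  have low2 := rf_low rf tI2; rewrite /p => /(_ ltac:(keep low2 P1W3 h P1p2; lra) ltac:(keep h; lra) ltac:(keep p2r; lra)).
  by keep0; lra.
exists t3; split; [exact: tI3|exact: W3E|].
move=> p pI; split; first exact: (E p pI).
have D3 : is_derive p 1 (I t3) (- al t3 p).
  by apply: (der_ray_action (rf_pf rf tI3)); apply: low_in => //; rewrite W3E.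
have D2 : is_derive p 1 (I t2) (- al t2 p).
  by apply: (der_ray_action (rf_pf rf tI2)); apply: low_in => //; lra.
have D2' : is_derive p 1 (fun x => I t2 x + - I t2 p2) (- al t2 p).
  by apply: (is_derive_eq (der_add D2 (der_cst (- I t2 p2) p))); rewrite addr0.
have D3' : is_derive p 1 (I t3) (- al t2 p).
  apply: (is_derive_near (d := Num.min (p - P1) (p2 - p))) D2'; first by rewrite lt_min; lra.
  by move=> y; rewrite lt_min !ltr_norml => yI; rewrite E//; keep yI; lra.
exact: (oppr_inj (is_derive_unique D3 D3')).
Qed.

(** For a momentum [pq] at which the opening angle is a good slope [q], all the
    numbers [I t2 pq - I t2 p2 + q pq], for [p2] in an interval, are critical
    values at the crossing times; but they vary continuously and strictly
    monotonically with [p2]. *)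
Lemma top_momentum_noninc t1 t2 : tl < t1 -> t1 < t2 -> t2 < tr -> W t2 <= W t1.
Proof.
have mark := Logic.I.
move=> h1 h12 h2; rewrite leNgt; apply/negP => W12.
have tI1 : tl < t1 < tr by lra.
have tI2 : tl < t2 < tr by lra.
have P1W := rf_top rf tI1; have P10 := P1_ge0 tI1.
have dal2 p : P1 < p < W t1 -> is_derive p 1 (al t2) (dal t2 p).
  by move=> pI; apply: (der_opening (rf_pf rf tI2)); apply: low_in => //; lra.
have cal a b : P1 < a -> b < W t1 -> cont_itv a b (al t2).
  by move=> Pa bW z zI; apply: is_derive_continuous (dal2 z _); lra.
pose a := P1 + (W t1 - P1) / 3; pose b := P1 + 2 * (W t1 - P1) / 3.
have [Pa ab bW] : [/\ P1 < a, a < b & b < W t1] by rewrite /a /b; split; lra.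
have [pa [pb [paI pbI alab]]] : exists pa pb, [/\ a <= pa <= b, a <= pb <= b & al t2 pa < al t2 pb].
  have [p0 p0I n0] := rf_nd rf tI2 Pa ab (lt_trans bW W12).
  apply: contrapT => H.
  have cst p : a <= p <= b -> al t2 p = al t2 a.
    have aI : a <= a <= b by keep ab; lra.
    move=> pI; case: (ltgtP (al t2 p) (al t2 a)) => [h|h|//]; exfalso; apply: H.
      by exists p, a; split.
    by exists a, p; split.
  have D := dal2 p0 ltac:(keep p0I Pa bW; lra).
  have D0 : is_derive p0 1 (al t2) 0.
    apply: (is_derive_near (d := Num.min (p0 - a) (b - p0))) (der_cst (al t2 a) p0).
      by rewrite lt_min; keep p0I; lra.
    by move=> y; rewrite lt_min !ltr_norml => yI; rewrite cst//; keep yI; lra.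
  by have := is_derive_unique D D0 => e0; rewrite e0 eqxx in n0.
have [q qI [S cS HS]] := rf_spec rf alab.
have [pq pqI Epq] : exists2 pq, a <= pq <= b & al t2 pq = q.
  have [le|/ltW le] := leP pa pb.
    have c : cont_itv pa pb (al t2) by apply: cal; keep Pa paI pbI bW; lra.
    have qI' : al t2 pa <= q <= al t2 pb by keep qI; lra.
    have [z zI E] := ivt_lt le c qI'.
    by exists z => //; keep zI paI pbI; lra.
  have c : cont_itv pb pa (fun z => - al t2 z).
    by move=> z zI; apply: ctnN; apply: (cal pb pa) => //; keep Pa paI pbI bW; lra.
  have qI' : - al t2 pb <= - q <= - al t2 pa by keep qI; lra.
  have [z zI E] := ivt_lt le c qI'.
  exists z; first by keep zI paI pbI; lra.
  by keep E; lra.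
pose T := [set p2 | W t1 < p2 < W t2].
pose g p2 := I t2 pq - I t2 p2 + q * pq.
have gS p2 : T p2 -> S (g p2).
  move=> /andP[p2l p2r].
  have [t3 [t3I W3 H]] := top_momentum_crossing h1 h12 h2 p2l p2r.
  have [E1 E2] := H pq ltac:(keep pqI Pa bW p2l; lra).
  have pqW : P1 < pq < W t3 by rewrite W3; keep pqI Pa bW p2l; lra.
  have := HS t3 pq t3I pqW (etrans E2 Epq).
  by rewrite E1.
have iT : is_interval T.
  by move=> x y Tx Ty z; move: Tx Ty; rewrite /T /=; keep0; lra.
have cg : rel_cont T g.
  move=> x _ e e0.
  have c : ctn x (I t2) by exact: (ray_action_cont (rf_pf rf tI2)).
  have c' : ctn x g by rewrite /g; cts.
  have [d d0 Hd] := (continuousP_eps _ _).1 c' _ e0.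
  by exists d => // y _; exact: Hd.
pose x := W t1 + (W t2 - W t1) / 3; pose y := W t1 + 2 * (W t2 - W t1) / 3.
have Tx : T x by rewrite /T /= /x; keep W12; lra.
have Ty : T y by rewrite /T /= /y; keep W12; lra.
have := countable_cont_const cS iT cg gS Tx Ty; rewrite /g.
have := @ray_action_lt _ _ _ _ _ _ (rf_pf rf tI2) x y.
have low2 := rf_low rf tI2; rewrite /x /y => /(_ ltac:(keep low2 P1W W12; lra) ltac:(keep W12; lra) ltac:(keep W12; lra)).
by keep0; lra.
Qed.

End Family.

(** Reversal of time turns [top_momentum_noninc] into the opposite inequality. *)
Lemma rigid_familyN (R : realType) (tl tr : R) f df A B M P1 :
  rigid_family tl tr f df A B M P1 ->
  rigid_family (- tr) (- tl) (fun t => f (- t)) (fun t => df (- t)) A B (fun t => M (- t)) P1.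
Proof.
move=> [h1 h2 h3 h4 h5 h6].
have N t : - tr < t < - tl -> tl < - t < tr by lra.
split.
- by move=> t /N; exact: h1.
- move=> t u /N tI uI.
  apply: (ctn_comp (f := fun t => f t u) (g := fun t => - t)); first exact: h2.
  by cts.
- by move=> t /N; exact: h3.
- by move=> t /N; exact: h4.
- move=> x y /h5[q qI [S cS H]]; exists q => //; exists S => // t p /N.
  exact: H.
- by move=> t a b /N; exact: h6.
Qed.

(** The top momentum is static, so the actions agree up to a constant below it;
    they vanish above it, hence agree, and Abel inversion applies. *)
Lemma rigid_family_static (R : realType) (tl tr : R) f df A B M P1 :
  rigid_family tl tr f df A B M P1 ->
  forall t t', tl < t < tr -> tl < t' < tr ->
  forall u, A <= u <= B -> P1 ^+ 2 < f t u -> f t' u = f t u.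
Proof.
move=> rf.
have Wlt t1 t2 : tl < t1 -> t1 < t2 -> t2 < tr -> Num.sqrt (f t1 B) = Num.sqrt (f t2 B).
  move=> h1 h12 h2; apply/eqP; rewrite eq_le (top_momentum_noninc rf h1 h12 h2) andbT.
  have := @top_momentum_noninc _ _ _ _ _ _ _ _ _ (rigid_familyN rf) (- t2) (- t1).
  by rewrite !opprK; apply; rewrite ltrN2.
have WE t1 t2 : tl < t1 < tr -> tl < t2 < tr -> Num.sqrt (f t1 B) = Num.sqrt (f t2 B).
  move=> /andP[a1 b1] /andP[a2 b2]; case: (ltgtP t1 t2) => [h|h|->//]; first exact: Wlt.
  by symmetry; exact: Wlt.
have IE t t' : tl < t < tr -> tl < t' < tr -> forall p, P1 < p ->
    ray_action (f t) A B p = ray_action (f t') A B p.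
  move=> tI t'I p Pp; pose W := Num.sqrt (f t B).
  have W' : Num.sqrt (f t' B) = W by exact: WE.
  have PW := rf_top rf tI; have P10 := P1_ge0 rf tI.
  have pf := rf_pf rf tI; have pf' := rf_pf rf t'I.
  have AB := pf_AB pf.
  have fB : f t B = W ^+ 2 by rewrite sqr_sqrtr//; apply/ltW/(pf_pos pf)/ltW.
  have fB' : f t' B = W ^+ 2 by rewrite -W' sqr_sqrtr//; apply/ltW/(pf_pos pf')/ltW.
  have W0 : 0 <= W by exact: sqrtr_ge0.
  have [pW|Wp] := ltP p W; last first.
    rewrite (ray_action_eq0 pf) ?(ray_action_eq0 pf')// ?fB ?fB' lerXn2r ?nnegrE//; lra.
  pose T := [set t | tl < t < tr].
  have iT : is_interval T.
    by move=> x y Tx Ty z; move: Tx Ty; rewrite /T /=; lra.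
  have TW s : T s -> W <= Num.sqrt (f s B) by move=> Ts; rewrite (WE s t).
  have TI s : T s -> tl < s < tr by [].
  have : ray_action (f t) A B W - ray_action (f t') A B W = ray_action (f t) A B p - ray_action (f t') A B p.
    apply: (@cont_end_eq _ (fun x => ray_action (f t) A B x - ray_action (f t') A B x) P1) => //.
      by apply: ctnD; [exact: (ray_action_cont pf)|apply: ctnN; exact: (ray_action_cont pf')].
    move=> x xI.
    have := family_ray_action rf iT TI TW (t := t) (t' := t') (p := x) (p' := p) tI t'I xI ltac:(lra).
    lra.
  by rewrite (ray_action_eq0 pf) ?fB// (ray_action_eq0 pf') ?fB'//; lra.
move=> t t' tI t'I u uI Pu.
have l1 := rf_low rf tI; have l2 := rf_low rf t'I.
have pf := rf_pf rf tI; have pf' := rf_pf rf t'I.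
have h1 : f t u <= f t' u by apply: (abel_le pf pf' l1 l2 (IE t t' tI t'I)).
apply/eqP; rewrite eq_le h1 andbT.
apply: (abel_le pf' pf l2 l1 (IE t' t t'I tI)) => //.
exact: lt_le_trans Pu h1.
Qed.

(** * Profiles of a layer in logarithmic coordinates *)

Section Within.
Context {R : realType}.
Implicit Types (D : set R) (c f : R -> R) (s x l : R).

Lemma hdw_eps D f x l : has_derive_within D f x l ->
  forall e, 0 < e -> exists2 d, 0 < d & forall y, D y -> `|y - x| < d ->
    `|f y - f x - l * (y - x)| <= e * `|y - x|.
Proof.
move=> /cvgrPdist_lt H e e0; have := H e e0.
rewrite /within /= => /nbhs_ballP[d /= d0 Hd].
exists d => // y Dy yd.
have [->|yx] := eqVneq y x; first by rewrite !subrr mulr0 subrr normr0 mulr0.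
have := Hd y; rewrite /ball/= distrC => /(_ yd) h.
have := h yx Dy => h1.
have n0 : y - x != 0 by rewrite subr_eq0.
have -> : f y - f x - l * (y - x) = - (l - (f y - f x) / (y - x)) * (y - x) by field.
by rewrite normrM normrN ler_wpM2r// ltW.
Qed.

Lemma hdw_is_derive D f x l d : 0 < d -> (forall y, `|y - x| < d -> D y) ->
  has_derive_within D f x l -> is_derive x 1 f l.
Proof.
move=> d0 HD H; apply/is_deriveP_eps => e e0.
have [d' d'0 Hd'] := hdw_eps H e0.
exists (Num.min d d') => [|y]; first by rewrite lt_min d0.
by rewrite lt_min => /andP[/HD Dy]; exact: Hd'.
Qed.

Lemma hdw_cont D f x l : has_derive_within D f x l ->
  forall e, 0 < e -> exists2 d, 0 < d & forall y, D y -> `|y - x| < d -> `|f y - f x| < e.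
Proof.
move=> H e e0; have [d d0 Hd] := hdw_eps H (@ltr01 R).
exists (Num.min d (e / (2 + `|l|))).
  by rewrite lt_min d0 divr_gt0// ltr_wpDr.
move=> y Dy; rewrite lt_min => /andP[yd ye].
have h := Hd y Dy yd.
have -> : f y - f x = (f y - f x - l * (y - x)) + l * (y - x) by ring.
apply: (le_lt_trans (ler_normD _ _)); rewrite normrM.
have l2 : 0 < 2 + `|l| by rewrite ltr_wpDr.
move: ye; rewrite ltr_pdivlMr// mulrDr => ye.
rewrite mul1r in h; have := normr_ge0 (y - x).
by move: h ye; rewrite [`|l| * _]mulrC; lra.
Qed.

End Within.

Section Glue.
Context {R : realType}.
Implicit Types u y : R.
Variables (A B : R) (g dg : R -> R) (M : R).
Hypothesis AB : A < B.
Hypothesis g_cont : forall u, {for u, continuous (fun u => g (clamp A B u))}.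
Hypothesis g_derive : forall u, A < u < B -> is_derive u 1 g (dg u).
Hypothesis dg_lip : forall u v, `|dg (clamp A B u) - dg (clamp A B v)| <= M * `|u - v|.

(** Extension of [g] from [[A, B]] to the line by its tangents at the ends. *)
Definition glue u := g (clamp A B u) + dg (clamp A B u) * (u - clamp A B u).
Definition dglue u := dg (clamp A B u).

Lemma clamp_lo u : u <= A -> clamp A B u = A.
Proof. by move=> uA; rewrite /clamp min_l ?max_l//; have := AB; lra. Qed.

Lemma clamp_hi u : B <= u -> clamp A B u = B.
Proof. by move=> uB; rewrite /clamp min_r ?max_r//; have := AB; lra. Qed.

Lemma glueE u : A <= u <= B -> glue u = g u.
Proof. by move=> uI; rewrite /glue clampE// subrr mulr0 addr0. Qed.

Lemma dglue_cont u : ctn u dglue.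
Proof.
apply/continuousP_eps => e e0.
have M0 : 0 <= M by have := dg_lip 1 0; rewrite subr0 normr1 mulr1; apply: le_trans.
exists (e / (M + 1)) => [|y yu]; first by rewrite divr_gt0//; lra.
apply: (le_lt_trans (dg_lip y u)).
move: yu; rewrite ltr_pdivlMr; last lra.
by have := normr_ge0 (y - u); lra.
Qed.

Lemma clamp_cont u : ctn u (clamp A B).
Proof.
apply: (ctn_max (f := fun=> A)); first exact: ctnC.
by apply: (ctn_min (g := fun=> B)); [exact: ctnI|exact: ctnC].
Qed.

Lemma glue_cont u : ctn u glue.
Proof.
have c1 : ctn u dglue by exact: dglue_cont.
have c2 : ctn u (clamp A B) by exact: clamp_cont.
have c3 : ctn u (fun u => g (clamp A B u)) by exact: g_cont.
apply: (ctnD (f := fun u => g (clamp A B u)) (g := fun u => dglue u * (u - clamp A B u))) => //.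
by cts.
Qed.

Lemma der_glue u : is_derive u 1 glue (dglue u).
Proof.
have out (u0 : R) : u0 != A -> u0 != B -> is_derive u0 1 glue (dglue u0).
  move=> nA nB; case: (ltgtP u0 A) => [uA|Au|/eqP]; last by rewrite (negPf nA).
    apply: (is_derive_near (f := fun u => g A + dg A * (u - A)) (d := A - u0)); first lra.
      move=> y; rewrite ltr_norml => yI; rewrite /glue clamp_lo//; lra.
    rewrite /dglue clamp_lo ?ltW//.
    by eapply is_derive_eq; [der|rewrite /=; ring].
  case: (ltgtP u0 B) => [uB|Bu|/eqP]; last by rewrite (negPf nB).
    apply: (is_derive_near (f := g) (d := Num.min (u0 - A) (B - u0))).
    - by rewrite lt_min; lra.
    - by move=> y; rewrite lt_min !ltr_norml => yI; rewrite glueE//; lra.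
    - by rewrite /dglue clampE; [apply: g_derive; lra|lra].
  apply: (is_derive_near (f := fun u => g B + dg B * (u - B)) (d := u0 - B)); first lra.
    move=> y; rewrite ltr_norml => yI; rewrite /glue clamp_hi//; lra.
  rewrite /dglue clamp_hi ?ltW//.
  by eapply is_derive_eq; [der|rewrite /=; ring].
have AB' := AB.
have [uA|nA] := eqVneq u A.
  apply: (@is_derive_extend _ _ _ _ (B - A)); [lra|exact: glue_cont|exact: dglue_cont|].
  move=> y /andP[y1 y2]; apply: out; first by rewrite -uA -subr_eq0 -normr_gt0.
  by apply/eqP => yB; move: y2; rewrite yB uA ltr_norml; lra.
have [uB|nB] := eqVneq u B; last exact: out.
apply: (@is_derive_extend _ _ _ _ (B - A)); [lra|exact: glue_cont|exact: dglue_cont|].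
move=> y /andP[y1 y2]; apply: out; last by rewrite -uB -subr_eq0 -normr_gt0.
by apply/eqP => yA; move: y2; rewrite yA uB ltr_norml; lra.
Qed.

End Glue.

Section Extract.
Context {R : realType}.
Implicit Types (D : set R) (c dc : R -> R) (a b s u v A B : R).

Lemma lipV a b (g : R -> R) k : 0 < k -> (forall z, a <= z <= b -> k <= g z) ->
  lip a b g -> lip a b (fun z => (g z)^-1).
Proof.
move=> k0 gk [C C0 HC]; exists (C / k ^+ 2) => [|u v au uv vb].
  by rewrite divr_ge0// sqr_ge0.
have gu : k <= g u by apply: gk; lra.
have gv : k <= g v by apply: gk; lra.
have u0 : 0 < g u by exact: lt_le_trans gu.
have v0 : 0 < g v by exact: lt_le_trans gv.
have -> : (g v)^-1 - (g u)^-1 = - (g v - g u) / (g u * g v) by field; rewrite !gt_eqF.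
rewrite normrM normrN normfV (gtr0_norm (mulr_gt0 u0 v0)) ler_pdivrMr ?mulr_gt0//.
apply: (le_trans (HC u v au uv vb)).
have k2 : 0 < k ^+ 2 by rewrite exprn_gt0.
rewrite (_ : C / k ^+ 2 * (v - u) * (g u * g v) = C * (v - u) * (g u * g v / k ^+ 2)); last by field; rewrite gt_eqF.
rewrite ler_peMr ?mulr_ge0 ?subr_ge0//.
by rewrite ler_pdivlMr// mul1r expr2 ler_pM// ltW.
Qed.

Lemma lip_exp a b : lip a b (@expR R).
Proof.
have [ab|ba] := leP a b; last by exists 0 => // u v au uv vb; exfalso; lra.
have D z : a <= z <= b -> is_derive z 1 (@expR R) (expR z) by move=> _; exact: is_derive_expR.
apply: (lip_derive D).
have ce : cont_itv a b (@expR R) by move=> z _; exact: continuous_expR.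
by have [C _ HC] := cont_bdd ab ce; exists C.
Qed.

Definition rho2 c u := (expR u / c (expR u)) ^+ 2.

(** [A] is an interior point of the layer, and at [B] the Lipschitz bound gives
    a [C^{1,1}] extension beyond [B]. *)
Lemma layer_profile c D a b A : a < expR A -> expR A < b ->
  (forall s, a < s <= b -> D s) -> C11_on D c ->
  (forall s, a < s <= b -> 0 < c s) ->
  (forall s, a < s < b -> exists2 l, 0 < l & is_derive s 1 (fun y => y / c y) l) ->
  exists f df M, [/\ profile f df A (ln b) M, adapted f df A (ln b) c &
    forall u, A <= u <= ln b -> f u = rho2 c u].
Proof.
move=> aA Ab HD [dc [Hdc [M HM]]] c0 herg.
set B := ln b.
have b0 : 0 < b by apply: lt_trans Ab; exact: expR_gt0.
have eB : expR B = b by rewrite lnK// posrE.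
have AB : A < B by rewrite -ltr_expR eB.
have AB' := ltW AB.
have sI u : A <= u <= B -> a < expR u <= b.
  move=> /andP[Au uB]; rewrite -eB ler_expR uB andbT.
  by apply: lt_le_trans aA _; rewrite ler_expR.
have sI' u : A < u < B -> a < expR u < b.
  move=> /andP[Au uB]; rewrite -eB ltr_expR uB andbT.
  by apply: lt_trans aA _; rewrite ltr_expR.
have dcP s : a < s < b -> is_derive s 1 c (dc s).
  move=> sab; apply: (hdw_is_derive (D := D) (d := Num.min (s - a) (b - s))).
  - by rewrite lt_min; lra.
  - by move=> y; rewrite lt_min !ltr_norml => yI; apply: HD; lra.
  - by apply: Hdc; apply: HD; lra.
pose ga u := c (expR u).
pose de u := dc (expR u).
have cga u : ctn u (fun u => ga (clamp A B u)).
  apply/continuousP_eps => e e0.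
  have Ds : D (expR (clamp A B u)) by apply/HD/sI/clamp_itv.
  have [d d0 Hd] := hdw_cont (Hdc _ Ds) e0.
  have cc : ctn u (fun u => expR (clamp A B u)).
    apply: ctn_comp; [exact: continuous_expR|exact: clamp_cont].
  have [d' d'0 Hd'] := (continuousP_eps _ _).1 cc _ d0.
  exists d' => // y yd; apply: Hd; last exact: Hd'.
  by apply/HD/sI/clamp_itv.
have dga u : A < u < B -> is_derive u 1 ga (de u * expR u).
  move=> uI; apply: (is_derive_eq (der_comp (g := @expR R) (dcP _ (sI' u uI)) (der_expR (der_id u)))).
  by rewrite /de; ring.
have lde : lip A B de.
  have M0 : 0 <= M.
    have hA : a < expR A <= b by apply: sI; rewrite lexx.
    have hB : a < expR B <= b by apply: sI; rewrite lexx andbT.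
    have h := le_trans (normr_ge0 _) (HM _ _ (HD _ hA) (HD _ hB)).
    have n0 : 0 < `|expR A - expR B| by rewrite normr_gt0 subr_eq0 lt_eqF// ltr_expR.
    by rewrite -(pmulr_lge0 _ n0).
  have [C C0 HC] := lip_exp A B.
  exists (M * C) => [|u v Au uv vB]; first exact: mulr_ge0.
  have hu : a < expR u <= b by apply: sI; lra.
  have hv : a < expR v <= b by apply: sI; lra.
  apply: (le_trans (HM _ _ (HD _ hv) (HD _ hu))).
  by rewrite -mulrA ler_wpM2l// HC.
have lE := lip_exp A B.
have lga : lip A B ga.
  have [E E0 HE] := lip_bdd AB' (lipM AB' lde lE).
  exists E => [|u v Au]; first exact: ltW.
  rewrite le_eqVlt => /predU1P[->|uv] vB; first by rewrite !subrr normr0 mulr0.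
  have [z zI|z|z zI] := @mvt_lin _ (fun u => ga (clamp A B u)) (fun u => de u * expR u) u v uv.
  - exact: cga.
  - move=> zI; apply: (is_derive_near (f := ga) (d := Num.min (z - A) (B - z))).
    + by rewrite lt_min; lra.
    + by move=> y; rewrite lt_min !ltr_norml => yI; rewrite clampE//; lra.
    + by apply: dga; lra.
  - rewrite !clampE; [|lra|lra] => ->.
    rewrite normrM (ger0_norm (x := v - u)) ?subr_ge0 ?(ltW uv)//.
    apply: ler_wpM2r; first by rewrite subr_ge0 ltW.
    by apply: HE; lra.
have ga0 u : A <= u <= B -> 0 < ga u by move=> /sI; exact: c0.
have [k k0 Hk] : exists2 k, 0 < k & forall u, A <= u <= B -> k <= ga u.
  have [] := @cont_low _ A B (fun u => ga (clamp A B u)) AB' (fun z _ => cga z).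
    by move=> z _; apply: ga0; exact: clamp_itv.
  by move=> k k0 Hk; exists k => // u uI; have := Hk u uI; rewrite clampE.
have liga := lipV k0 Hk lga.
pose dg u := 2 * (expR u * (ga u)^-1 * (expR u * (ga u)^-1)) * (1 + (-1) * (expR u * de u * (ga u)^-1)).
have lcst (w : R) : lip A B (fun=> w).
  by exists 0 => // u v _ _ _; rewrite subrr normr0 mul0r.
have lq := lipM AB' lE liga.
have ldg : lip A B dg.
  apply: (lipM AB'); first exact: lipM AB' (lcst 2) (lipM AB' lq lq).
  by apply: lipD (lcst 1) (lipM AB' (lcst (-1)) (lipM AB' (lipM AB' lE lde) liga)).
have [N N0 HN] := lip_clamp AB' ldg.
have crho u : {for u, continuous (fun u => rho2 c (clamp A B u))}.
  have c1 := cga u.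
  have c2 : ctn u (fun u => (ga (clamp A B u))^-1).
    by apply: ctnV c1; rewrite gt_eqF// ga0// clamp_itv.
  have c3 : ctn u (fun u => expR (clamp A B u)).
    apply: ctn_comp; [exact: continuous_expR|exact: clamp_cont].
  by rewrite /rho2; cts.
have drho u : A < u < B -> is_derive u 1 (rho2 c) (dg u).
  move=> uI; have g0 : 0 < ga u by apply: ga0; lra.
  have n0 : ga u != 0 by rewrite gt_eqF.
  have D1 := der_mul (der_expR (der_id u)) (der_inv n0 (dga u uI)).
  apply: (is_derive_eq (der_pow 2 D1)); rewrite /dg /= expr1.
  by field.
have dgE u : dg u = 2 * rho2 c u * (1 - expR u * de u / ga u).
  by rewrite /dg /rho2 -/(ga u); ring.
have dgpos u : A <= u < B -> 0 < dg u.
  move=> uI; have uI' : a < expR u < b.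
    have : a < expR u <= b by apply: sI; lra.
    have : expR u < b by rewrite -eB ltr_expR; lra.
    by lra.
  have g0 : 0 < ga u by apply: ga0; lra.
  have [l l0 Dl] := herg _ uI'.
  have n0 : c (expR u) != 0 by rewrite gt_eqF.
  have D1 := der_mul (der_id (expR u)) (der_inv n0 (dcP _ uI')).
  have El := is_derive_unique Dl D1.
  have e0 := expR_gt0 u.
  rewrite dgE.
  have -> : 1 - expR u * de u / ga u = l * ga u.
    by rewrite El /de /ga; field.
  have r0 : 0 < rho2 c u by rewrite /rho2 exprn_gt0// divr_gt0.
  by apply: mulr_gt0; [exact: mulr_gt0|exact: mulr_gt0].
have dgB : 0 <= dg B.
  rewrite leNgt; apply/negP => neg.
  have cd : ctn B (dglue A B dg) by exact: (dglue_cont HN).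
  have e1 : 0 < - dg B by lra.
  have [d d0 Hd] := (continuousP_eps _ _).1 cd _ e1.
  pose u := Num.max A (B - d / 2).
  have uI : A <= u < B by rewrite le_max lexx gt_max; lra.
  have h : B - d / 2 <= u by rewrite le_max lexx orbT.
  have := Hd u; rewrite /dglue !clampE; [|lra|lra].
  rewrite !ltr_norml => /(_ ltac:(lra)).
  by have := dgpos u uI; lra.
exists (glue A B (rho2 c) dg), (dglue A B dg), N; split.
- split => //.
  + exact: (der_glue AB crho drho HN).
  + by move=> u uI; rewrite /dglue clampE; [exact: dgpos|lra].
  + move=> u Au; rewrite /dglue; have [uB|Bu] := ltP u B.
      by rewrite clampE; [apply/ltW/dgpos; lra|lra].
    by rewrite clamp_hi.
  + rewrite glueE ?lexx// /rho2 exprn_gt0// divr_gt0 ?expR_gt0//.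
    by apply: ga0; rewrite lexx.
- move=> u uI; have uI' : A <= u <= B by lra.
  have g0 := ga0 u uI'.
  split => //; first by rewrite glueE.
  exists (dc (expR u)); first by apply: dcP; exact: sI'.
  by rewrite glueE// /dglue clampE// dgE.
- by move=> u uI; rewrite glueE.
Qed.

End Extract.

(** * Periodic diving rays *)

Section Radii.
Context {R : realType}.
Variables (K : nat) (rk : nat -> R).
Hypothesis rad_lt : forall k, (k <= K)%N -> Defs.rad K rk k.+1 < Defs.rad K rk k.

Lemma rad_le j k : (j <= k)%N -> (k <= K.+1)%N -> Defs.rad K rk k <= Defs.rad K rk j.
Proof.
elim: k => [|k ih]; first by rewrite leqn0 => /eqP->.
rewrite leq_eqVlt => /predU1P[->//|]; rewrite ltnS => jk kK.
exact: le_trans (ltW (rad_lt kK)) (ih jk (ltnW kK)).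
Qed.

Lemma rad_le1 k : (k <= K.+1)%N -> Defs.rad K rk k <= 1.
Proof. exact: (@rad_le 0). Qed.

Lemma rad_ge0 k : (k <= K.+1)%N -> 0 <= Defs.rad K rk k.
Proof.
move=> kK; have := rad_le kK (leqnn _).
by rewrite {1}/Defs.rad /= ltnn.
Qed.

Lemma not_Gamma k s : (k <= K)%N -> Defs.rad K rk k.+1 < s -> s < Defs.rad K rk k ->
  ~ Gamma_radii K rk s.
Proof.
move=> kK h1 h2 [j jK sE]; have [jk|kj] := leqP j k.
  by have := rad_le jk (leqW kK); rewrite -sE leNgt h2.
by have := rad_le kj (leqW jK); rewrite -sE leNgt h1.
Qed.

Lemma not_jump k s : (k <= K)%N -> Defs.rad K rk k.+1 < s -> s < Defs.rad K rk k ->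
  ~ jump_radii K rk s.
Proof.
move=> kK h1 h2 [j /andP[j1 jK] sE]; apply: (not_Gamma kK h1 h2).
by exists j => //; rewrite sE /Defs.rad jK; case: j j1 {jK sE}.
Qed.

End Radii.

Section DiveSpectrum.
Context {R : realType}.
Variables (K : nat) (rk : nat -> R) (c : 'I_2 -> R -> R) (i : 'I_2) (k : nat).
Hypothesis rad_lt : forall k, (k <= K)%N -> Defs.rad K rk k.+1 < Defs.rad K rk k.
Hypothesis kK : (k <= K)%N.
Variables (f df : R -> R) (A B M : R).
Hypothesis pf : profile f df A B M.
Hypothesis ad : adapted f df A B (c i).
Hypothesis eB : expR B = Defs.rad K rk k.
Hypothesis eA : Defs.rad K rk k.+1 < expR A.
Variable x : R.
Hypothesis xI : A < x < B.

Lemma dive_geodesic_leg phi0 : geodesic_leg K rk c (dive_leg pf xI phi0).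
Proof.
split.
- by exists i; exact: dive_geodesic.
- by rewrite dive_radius0 eB; exists k.
- by rewrite dive_radius_end eB; exists k.
- move=> t tI; have /andP[h1 h2] := dive_radius_inner tI.
  have h3 : Defs.rad K rk k.+1 < Defs.radius (dive_leg pf xI phi0) t.
    apply: lt_trans eA (lt_le_trans _ h1).
    by rewrite ltr_expR; case/andP: xI.
  rewrite eB in h2; split; last exact: (not_Gamma rad_lt kK).
  exact: lt_le_trans h2 (rad_le1 rad_lt (leqW kK)).
Qed.

Lemma cos_turns (m : nat) : cos (2 * pi * m%:R : R) = 1 /\ sin (2 * pi * m%:R : R) = 0.
Proof.
elim: m => [|m [ihc ihs]]; first by rewrite mulr0 cos0 sin0.
have -> : 2 * pi * m.+1%:R = 2 * pi * m%:R + (pi + pi) :> R by rewrite -addn1 natrD; ring.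
have e1 : cos (pi + pi) = 1 :> R by rewrite cosD cospi sinpi; ring.
have e2 : sin (pi + pi) = 0 :> R by rewrite sinD cospi sinpi; ring.
by rewrite (cosD (2 * pi * m%:R)) (sinD (2 * pi * m%:R)) ihc ihs e1 e2; split; ring.
Qed.

(** Leg [j] is the diving ray rotated by [j] times its opening angle. *)
Lemma dive_in_lsp (n m : nat) : n.+1%:R * opening_angle f df B x = 2 * pi * m%:R ->
  length_spectrum K rk c (n.+1%:R * (radial_action f df B x + dive_momentum f x * opening_angle f df B x)).
Proof.
move=> closing.
exists n, (fun j => dive_leg pf xI ((j : nat)%:R * opening_angle f df B x)); split; last first.
  under eq_bigr do rewrite dive_dur.
  by rewrite sumr_const card_ord mulr_natl.
move=> j; split; last by left; exact: dive_geodesic_leg.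
have [e1 e2] := dive_stop pf xI (j%:R * opening_angle f df B x).
have [s1 s2] := dive_start pf xI ((ordS j)%:R * opening_angle f df B x).
have E : cos (j%:R * opening_angle f df B x + opening_angle f df B x) = cos ((ordS j)%:R * opening_angle f df B x) /\
         sin (j%:R * opening_angle f df B x + opening_angle f df B x) = sin ((ordS j)%:R * opening_angle f df B x).
  have -> : j%:R * opening_angle f df B x + opening_angle f df B x = j.+1%:R * opening_angle f df B x.
    by rewrite -[in RHS]addn1 natrD mulrDl mul1r.
  have := ltn_ord j; rewrite ltnS leq_eqVlt => /predU1P[jn|jn].
    have -> : (ordS j : nat) = 0%N by rewrite /= jn modnn.
    have [h1 h2] := cos_turns m.
    by rewrite jn closing h1 h2 mul0r cos0 sin0.
  by have -> : (ordS j : nat) = j.+1 by rewrite /= modn_small.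
case: E => E1 E2; split.
- by rewrite e1 s1 E1.
- by rewrite e2 s2 E2.
- by rewrite !dive_angular.
Qed.

End DiveSpectrum.

Section Slopes.
Context {R : realType}.

(** Rational multiples of [2 pi] are dense; the factor [n] is absorbed by
    dividing [S] by it. *)
Lemma spectrum_slopes (S : set R) : countable S -> forall x y : R, x < y ->
  exists2 q, x < q < y & exists2 S', countable S' &
    forall z, (forall n m : nat, n.+1%:R * q = 2 * pi * m%:R -> S (n.+1%:R * z)) ->
      0 < q -> S' z.
Proof.
move=> cS x y xy; have p0 : 0 < 2 * pi :> R by rewrite mulr_gt0// pi_gt0.
have xy' : x / (2 * pi) < y / (2 * pi) by rewrite ltr_pM2r// invr_gt0.
have [r] := rat_in_itvoo xy'; rewrite in_itv/= => /andP[].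
rewrite ltr_pdivrMr// ltr_pdivlMr// => h1 h2.
exists (ratr r * (2 * pi)); first by rewrite h1.
pose d := `|denq r|%N.
exists ((fun s => s / d%:R) @` S); first exact: sub_countable (card_image_le _ _) cS.
have d0 : (0 < d)%N by rewrite absz_gt0 denq_neq0.
have dn : d%:R != 0 :> R by rewrite pnatr_eq0 -lt0n.
move=> z Hz q0; exists (d%:R * z); last by rewrite mulrC mulKf.
have dE : d = d.-1.+1 by rewrite prednK.
rewrite dE; apply: (Hz _ `|numq r|%N); rewrite -dE.
have r0 : 0 < r by move: q0; rewrite pmulr_lgt0// ltr0q.
have nE : (`|numq r|%N)%:R = (numq r)%:~R :> R.
  by rewrite -[in RHS](gez0_abs (_ : 0 <= numq r))// numq_ge0 ltW.
have dE' : d%:R = (denq r)%:~R :> R.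
  by rewrite -[in RHS](gez0_abs (_ : 0 <= denq r))// ltW ?denq_gt0.
have dn' : (denq r)%:~R != 0 :> R by rewrite intr_eq0 denq_neq0.
by rewrite nE dE' /ratr; field.
Qed.

Variables (f df : R -> R) (A B M : R).
Hypothesis pf : profile f df A B M.

Lemma opening_dive p : Num.sqrt (f A) < p < Num.sqrt (f B) ->
  [/\ A < turning_point f A B p < B, opening_angle f df B (turning_point f A B p) = opening f df A B p,
   radial_action f df B (turning_point f A B p) + dive_momentum f (turning_point f A B p) * opening_angle f df B (turning_point f A B p) =
   ray_action f A B p + opening f df A B p * p & 0 < opening f df A B p].
Proof.
move=> pI; have [xI E] := turning_pointP pf pI.
have p0 : 0 < p by have := sqrtr_ge0 (f A); lra.
have aE : opening_angle f df B (turning_point f A B p) = opening f df A B p by rewrite /opening_angle /opening /dive_momentum E.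
split => //.
  rewrite aE /dive_momentum E mulrC; congr (_ + _).
  by rewrite -(ray_action_turning_point pf xI) E.
by rewrite /opening; apply: mulr_gt0; [exact: mulr_gt0|exact: (half_angle_time_gt0 pf)].
Qed.

(** Otherwise all diving geodesics with turning points in an interval would
    have conjugate endpoints. *)
Lemma d_opening_neq0 (c : R -> R) a p1 p2 : adapted f df A B c ->
  countable_conjugacy c a (expR B) -> a < expR A ->
  Num.sqrt (f A) <= p1 -> p1 < p2 -> p2 < Num.sqrt (f B) ->
  exists2 p, p1 < p < p2 & d_opening f df A B p != 0.
Proof.
move=> ad cc aA Ap p12 pB; apply: contrapT => H.
have Z p : p1 < p < p2 -> d_opening f df A B p = 0.
  by move=> pI; apply/eqP/negPn/negP => n0; apply: H; exists p.
pose q1 := p1 + (p2 - p1) / 3; pose q2 := p1 + 2 * (p2 - p1) / 3.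
have [q1I q2I q12] : [/\ p1 < q1 < p2, p1 < q2 < p2 & q1 < q2].
  by rewrite /q1 /q2; split; lra.
have [x1I E1] := turning_pointP pf (p := q1) ltac:(lra).
have [x2I E2] := turning_pointP pf (p := q2) ltac:(lra).
set x1 := turning_point f A B q1 in x1I E1; set x2 := turning_point f A B q2 in x2I E2.
have x12 : x1 < x2.
  rewrite ltNge; apply/negP => le.
  have : f x2 <= f x1 by apply: (pf_le pf) => //; case/andP: x2I => /ltW.
  by move=> /ler_wsqrtr; rewrite E1 E2 leNgt q12.
have e12 : expR x1 < expR x2 by rewrite ltr_expR.
apply: (countable_itv_false cc e12) => s /=; rewrite in_itv/= => /andP[s1 s2].
have s0 : 0 < s by apply: lt_le_trans s1; exact: expR_gt0.
pose x := ln s; have sE : expR x = s by rewrite lnK.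
rewrite -sE !ler_expR in s1 s2.
have xI : A < x < B.
  move: x1I x2I => /andP[Ax1 _] /andP[_ x2B].
  by rewrite (lt_le_trans Ax1 s1) (le_lt_trans s2 x2B).
have Ax := andP xI; case: Ax => Ax xB.
pose p := Num.sqrt (f x).
have pI : q1 <= p <= q2.
  rewrite -E1 -E2; apply/andP; split; apply: ler_wsqrtr; apply: (pf_le pf) => //.
    by case/andP: x1I => /ltW.
  exact: ltW.
have pI' : p1 < p < p2 by lra.
have := Z p pI'; rewrite /d_opening (turning_pointK pf xI) => /eqP.
have fx0 : 0 < f x by apply: (pf_pos pf); exact: ltW.
have p0 : 0 < p by rewrite sqrtr_gt0.
have d0 : 0 < df x by apply: (pf_df_gt0 pf); rewrite (ltW Ax).
rewrite mulf_eq0 mulf_eq0 invr_eq0 (gt_eqF d0) orbF mulf_eq0 expf_eq0/= (gt_eqF p0) orbF.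
rewrite pnatr_eq0/= => /eqP J0.
split.
  by rewrite -sE (lt_trans aA) ?ltr_expR//= .
exists (dive_leg pf xI 0); first by rewrite -sE; exact: dive_maximal.
exact: dive_conjugate.
Qed.

End Slopes.

(** * A layer is locally static below its top *)

Section LocalStatic.
Context {R : realType}.
Variables (eps : R) (K : nat) (r : nat -> R -> R) (c : 'I_2 -> R -> R -> R).
Hypothesis c_adm : forall i, admissible_family eps K r (c i).
Hypothesis lsp_countable : forall tau, - eps < tau < eps -> countable (lsp K r c tau).
Hypothesis lsp_const : forall tau, - eps < tau < eps -> lsp K r c tau = lsp K r c 0.
Implicit Types (i : 'I_2) (k : nat) (tau t s u : R).
Local Notation rho t k := (Defs.rad K (r^~ t) k).

Lemma rad_cont k t : (k <= K)%N -> - eps < t < eps ->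
  {for t, continuous (fun t => rho t k.+1)}.
Proof.
move=> kK tI; have [k1|k1] := boolP (k < K)%N.
  have -> : (fun t => rho t k.+1) = r k.+1 by apply/funext => t'; rewrite /Defs.rad /= k1.
  have [d _] := @adm_radii_C1 _ _ _ _ _ (c_adm ord0) k.+1 t k1 tI.
  exact: is_derive_continuous (derivable_is_derive1 d).
have -> : (fun t => rho t k.+1) = fun=> 0 by apply/funext => t'; rewrite /Defs.rad /= (negbTE k1).
exact: cvg_cst.
Qed.

Lemma layer_domain k t s : (k <= K)%N -> rho t k.+1 < s <= rho t k -> layer K (r^~ t) k s.
Proof.
move=> kK; rewrite /layer; case: ifPn => [//|]; rewrite -leqNgt => Kk.
have -> : k = K by apply/eqP; rewrite eqn_leq kK.
by rewrite {1}/Defs.rad /= ltnn => /andP[/ltW -> ->].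
Qed.

Let radlt t (tI : - eps < t < eps) k : (k <= K)%N -> rho t k.+1 < rho t k.
Proof. by move=> kK; exact: (adm_radii_lt (c_adm ord0) kK tI). Qed.

Lemma rho_01 k t s : (k <= K)%N -> - eps < t < eps -> rho t k.+1 < s <= rho t k -> 0 < s <= 1.
Proof.
move=> kK tI /andP[s1 s2].
have h1 := rad_ge0 (radlt tI) (kK : (k.+1 <= K.+1)%N).
have h2 := rad_le1 (radlt tI) (leqW kK).
by rewrite (le_lt_trans h1)//= (le_trans s2).
Qed.

Lemma c_tau_cont i k t s : (k <= K)%N -> - eps < t < eps -> rho t k.+1 < s -> s < rho t k ->
  {for t, continuous ((c i)^~ s)}.
Proof.
move=> kK tI s1 s2.
have [ds [dt [_ H _ _]]] := adm_C1 (c_adm i).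
have sI : 0 < s <= 1 by apply: (rho_01 kK tI); rewrite s1 ltW.
apply: (is_derive_continuous (l := dt (s, t))); apply: (H (s, t)); split => //=.
- by case/andP: sI => /ltW -> ->.
- exact: (not_jump (radlt tI) kK).
Qed.

Lemma c_herglotz i k t s : (k <= K)%N -> - eps < t < eps -> rho t k.+1 < s < rho t k ->
  exists2 l, 0 < l & is_derive s 1 (fun u => u / c i t u) l.
Proof.
move=> kK tI /andP[s1 s2].
have sI : 0 < s <= 1 by apply: (rho_01 kK tI); rewrite s1 ltW.
have [l l0 D] := adm_herglotz (c_adm i) tI (s := s) ltac:(lra) (not_jump (radlt tI) kK s1 s2).
exists l => //.
have h2 := rad_le1 (radlt tI) (leqW kK).
apply: (hdw_is_derive (d := Num.min s (rho t k - s))) D; first by rewrite lt_min; lra.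
by move=> y; rewrite lt_min !ltr_norml => yI; rewrite /=; lra.
Qed.

Lemma local_profile i k t A : (k <= K)%N -> - eps < t < eps ->
  rho t k.+1 < expR A -> expR A < rho t k ->
  exists f df M, [/\ profile f df A (ln (rho t k)) M,
    adapted f df A (ln (rho t k)) (c i t) &
    forall u, A <= u <= ln (rho t k) -> f u = rho2 (c i t) u].
Proof.
move=> kK tI h1 h2.
apply: (@layer_profile _ (c i t) (layer K (r^~ t) k) (rho t k.+1)) => //.
- by move=> s sI; exact: layer_domain.
- exact: (adm_C11 (c_adm i) kK tI).
- move=> s sI; apply: (adm_pos (c_adm i) tI).
  by have := rho_01 kK tI sI; lra.
- by move=> s sI; exact: (c_herglotz i kK tI).
Qed.

(** The lower end [e^A] of the profile is chosen between the lower interface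
    and [s0], and [P1] between the values of the slowness [sqrt f] there and at
    [s0]; both choices persist for [t] near [t0], by continuity in [t] at these
    two interior radii. *)
Lemma local_static i k t0 s0 : (k <= K)%N ->
  (forall t, - eps < t < eps -> rho t k = rho 0 k) -> - eps < t0 < eps ->
  rho t0 k.+1 < s0 -> s0 < rho 0 k ->
  exists2 d, 0 < d & forall t, - eps < t < eps -> `|t - t0| < d ->
    forall s, s0 <= s <= rho 0 k -> c i t s = c i t0 s.
Proof.
have mark := Logic.I.
move=> kK rhoE t0I s0l s0r.
set b := rho 0 k in s0r *; pose B := ln b.
have rho0 t : - eps < t < eps -> 0 <= rho t k.+1 by move=> tI; exact: (rad_ge0 (radlt tI)).
have r0 := rho0 t0 t0I.
have b0 : 0 < b by keep r0 s0l s0r; lra.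
have eB : expR B = b by rewrite lnK ?posrE.
pose sA := (rho t0 k.+1 + s0) / 2; pose A := ln sA.
have sA1 : rho t0 k.+1 < sA by rewrite /sA; keep s0l; lra.
have sA2 : sA < s0 by rewrite /sA; keep s0l; lra.
have sA0 : 0 < sA by keep r0 sA1; lra.
have s00 : 0 < s0 by keep sA0 sA2; lra.
have eA : expR A = sA by rewrite lnK ?posrE.
pose u0 := ln s0; have eu : expR u0 = s0 by rewrite lnK ?posrE.
have Au : A < u0 by rewrite -ltr_expR eA eu.
have uB : u0 < B by rewrite -ltr_expR eB eu.
have sAb : sA < b by exact: lt_trans sA2 s0r.
have ex t : - eps < t < eps -> rho t k.+1 < sA -> exists f df M, [/\ profile f df A B M,
    adapted f df A B (c i t) & forall u, A <= u <= B -> f u = rho2 (c i t) u].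
  move=> tI h; have := @local_profile i k t A kK tI; rewrite eA rhoE// => H.
  exact: H.
have grow : rho2 (c i t0) A < rho2 (c i t0) u0.
  have [f [df [M [pf _ fE]]]] := ex t0 t0I sA1.
  have iA : A <= A <= B by rewrite lexx (ltW (lt_trans Au uB)).
  have iu : A <= u0 <= B by rewrite (ltW Au) (ltW uB).
  by rewrite -(fE A iA) -(fE u0 iu); exact: (pf_lt pf (lexx A) Au (lt_trans Au uB)).
have gA0 : 0 <= rho2 (c i t0) A by exact: sqr_ge0.
pose W t u := Num.sqrt (rho2 (c i t) u).
have W12 : W t0 A < W t0 u0 by rewrite /W ltr_sqrt//; exact: le_lt_trans grow.
pose P1 := (W t0 A + W t0 u0) / 2.
have [WA WU] : W t0 A < P1 /\ P1 < W t0 u0 by rewrite /P1; keep W12; split; lra.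
have P10 : 0 < P1 by apply: le_lt_trans WA; exact: sqrtr_ge0.
have rcont t s : - eps < t < eps -> rho t k.+1 < s -> s < b -> 0 < s ->
    ctn t (fun t' => rho2 (c i t') (ln s)).
  move=> tI h1 h2 h3; have h4 : s < rho t k by rewrite rhoE.
  have cc : ctn t (fun t' => c i t' s) := @c_tau_cont i k t s kK tI h1 h4.
  have cp : 0 < c i t s.
    apply: (adm_pos (c_adm i) tI).
    have : 0 < s <= 1 by apply: (rho_01 kK tI); rewrite h1 (ltW h4).
    by move=> /andP[/ltW -> ->].
  have cv : ctn t (fun t' => (c i t' s)^-1) by apply: ctnV => //; rewrite gt_eqF.
  by rewrite /rho2 lnK//; cts.
have cA : ctn t0 (fun t => W t A) by apply: ctn_sqrt; exact: rcont.
have cU : ctn t0 (fun t => W t u0).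
  by apply: ctn_sqrt; apply: rcont => //; exact: lt_trans sA2.
have [d1 d10 H1] := (continuousP_eps _ _).1 (rad_cont kK t0I) _ (ltac:(by rewrite subr_gt0) : 0 < sA - rho t0 k.+1).
have [d2 d20 H2] := (continuousP_eps _ _).1 cA _ (ltac:(by rewrite subr_gt0) : 0 < P1 - W t0 A).
have [d3 d30 H3] := (continuousP_eps _ _).1 cU _ (ltac:(by rewrite subr_gt0) : 0 < W t0 u0 - P1).
pose d := Num.min (Num.min d1 d2) (Num.min d3 (Num.min (t0 + eps) (eps - t0))).
have d0 : 0 < d by rewrite !lt_min d10 d20 d30; keep t0I; lra.
have near t : t0 - d < t < t0 + d -> [/\ - eps < t < eps, rho t k.+1 < sA, W t A < P1 & P1 < W t u0].
  move=> tI; have td : `|t - t0| < d by rewrite ltr_norml; keep tI; lra.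
  move: td; rewrite /d !lt_min => /andP[/andP[/H1 h1 /H2 h2] /andP[/H3 h3 /andP[h4 h5]]].
  move: h1 h2 h3 h4 h5; rewrite !ltr_norml => h1 h2 h3 h4 h5.
  by split; [keep h4 h5; lra|keep h1; lra|keep h2; lra|keep h3; lra].
have /choice[z Hz] : forall t, exists z : (R -> R) * (R -> R) * R,
    t0 - d < t < t0 + d -> [/\ profile z.1.1 z.1.2 A B z.2,
    adapted z.1.1 z.1.2 A B (c i t) & forall u, A <= u <= B -> z.1.1 u = rho2 (c i t) u].
  move=> t; have [tI|] := boolP (t0 - d < t < t0 + d); last by exists (id, id, 0).
  have [h1 h2 _ _] := near t tI.
  by have [f [df [M H]]] := ex t h1 h2; exists (f, df, M).
have iA : A <= A <= B by rewrite lexx (ltW (lt_trans Au uB)).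
have iu : A <= u0 <= B by rewrite (ltW Au) (ltW uB).
have cS : countable (lsp K r c 0).
  by apply: lsp_countable; keep t0I; lra.
have rf : rigid_family (t0 - d) (t0 + d) (fun t => (z t).1.1) (fun t => (z t).1.2) A B
    (fun t => (z t).2) P1.
  split.
  - by move=> t /Hz[].
  - move=> t u tI uI; have [h1 h2 _ _] := near t tI.
    have eu0 : 0 < expR u by exact: expR_gt0.
    have su : sA <= expR u by rewrite -eA ler_expR; case/andP: uI.
    have ub : expR u < b by rewrite -eB ltr_expR; case/andP: uI.
    have cr := rcont t (expR u) h1 (lt_le_trans h2 su) ub eu0.
    rewrite expRK in cr.
    apply/continuousP_eps => e e0.
    have [d' d'0 Hd'] := (continuousP_eps _ _).1 cr _ e0.
    exists (Num.min d' (Num.min (t - (t0 - d)) (t0 + d - t))).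
      by rewrite !lt_min d'0; keep tI; lra.
    move=> y; rewrite !lt_min => /andP[/Hd' hy /andP[h3 h4]].
    have yI : t0 - d < y < t0 + d by move: h3 h4; rewrite !ltr_norml; keep0; lra.
    have uI' : A <= u <= B by case/andP: uI => -> /ltW ->.
    have [_ _ E1] := Hz y yI; have [_ _ E2] := Hz t tI.
    by rewrite E1// E2.
  - move=> t tI; have [_ _ h _] := near t tI; have [_ _ E] := Hz t tI.
    by rewrite E//; exact: ltW.
  - move=> t tI; have [_ _ _ h] := near t tI; have [pf _ E] := Hz t tI.
    apply: (lt_le_trans h); rewrite /W -(E u0 iu) ler_wsqrtr//.
    by apply: (pf_le pf); exact: ltW.
  - move=> x y xy; have [q qI [S' cS' HS]] := spectrum_slopes cS xy.
    exists q => //; exists S' => // t p tI pI Eq.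
    have [h1 h2 h3 h4] := near t tI; have [pf ad E] := Hz t tI.
    have pI' : Num.sqrt ((z t).1.1 A) < p < Num.sqrt ((z t).1.1 B).
      rewrite (E A iA); move: h3; rewrite /W => h3.
      by case/andP: pI => pl pr; rewrite (lt_trans h3 pl) pr.
    have [xI aE IE a0] := opening_dive pf pI'.
    apply: HS; last by rewrite -Eq.
    move=> n m Hnm; rewrite -(lsp_const h1) -Eq -IE.
    apply: (dive_in_lsp (k := k) (i := i) (M := (z t).2) (radlt h1) kK pf ad) => //.
    + by rewrite rhoE.
    + by rewrite eA.
    + rewrite aE Eq; exact: Hnm.
  - move=> t a1 b1 tI Pa ab bB.
    have [h1 h2 h3 h4] := near t tI; have [pf ad E] := Hz t tI.
    have cc := adm_conj (c_adm i) kK h1; rewrite rhoE// -/b -eB in cc.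
    apply: (d_opening_neq0 pf ad cc) => //; first by rewrite eA.
    by rewrite (E A iA); exact: ltW (lt_trans h3 Pa).
exists d => // t tI td s /andP[s1 s2].
have tT : t0 - d < t < t0 + d by move: td; rewrite ltr_norml; keep0; lra.
have tT0 : t0 - d < t0 < t0 + d by keep d0; lra.
have s0' : 0 < s by exact: lt_le_trans s00 s1.
pose u := ln s; have es : expR u = s by rewrite lnK.
have uI : A <= u <= B.
  apply/andP; split; rewrite -ler_expR es; last by rewrite eB.
  by rewrite eA (le_trans _ s1)// ltW.
have u0u : u0 <= u by rewrite -ler_expR eu es.
have [pf0 _ E0] := Hz t0 tT0; have [pf1 _ E1] := Hz t tT.
have big : P1 ^+ 2 < (z t0).1.1 u.
  have h : (z t0).1.1 u0 <= (z t0).1.1 u by apply: (pf_le pf0) => //; exact: ltW.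
  apply: (lt_le_trans _ h); rewrite E0//.
  have r20 : 0 <= rho2 (c i t0) u0 by exact: sqr_ge0.
  by rewrite -(sqr_sqrtr r20) ltrXn2r ?nnegrE ?sqrtr_ge0 ?(ltW P10).
have := rigid_family_static rf tT0 tT uI big; rewrite E0// E1// /rho2 es.
have c0 t' : - eps < t' < eps -> 0 < c i t' s.
  move=> t'I; apply: (adm_pos (c_adm i) t'I).
  have := rad_le1 (radlt t'I) (leqW kK); rewrite (rhoE t' t'I) -/b => b1.
  by rewrite (ltW s0') (le_trans s2 b1).
move/eqP; rewrite eqrXn2 ?divr_ge0 ?ltW ?c0// => /eqP E.
have := congr1 (fun y => (y / s)^-1) E => /=.
have n0 : s != 0 by rewrite gt_eqF.
by rewrite ![s / _]mulrC !mulfK// !invrK.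
Qed.

End LocalStatic.

(** * Radial rays *)

Section Radial.
Context {R : realType}.
Variables (K : nat) (rk : nat -> R) (c : 'I_2 -> R -> R) (i : 'I_2) (k : nat).
Hypothesis rad_lt : forall k, (k <= K)%N -> Defs.rad K rk k.+1 < Defs.rad K rk k.
Hypothesis kK : (k < K)%N.
Local Notation a := (Defs.rad K rk k.+1).
Local Notation b := (Defs.rad K rk k).
Variable w : R -> R.
Hypothesis w_cont : forall s, {for s, continuous w}.
Hypothesis w_gt0 : forall s, 0 < w s.
Hypothesis c_gt0 : forall s, a < s < b -> 0 < c i s.
Hypothesis c_derive : forall s, a < s < b -> exists l, is_derive s 1 (c i) l.
Hypothesis wE : forall s, a < s < b -> w s = (c i s)^-1.

Let kK' : (k <= K)%N. Proof. exact: ltnW. Qed.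
Let ab : a < b. Proof. exact: rad_lt kK'. Qed.
Let a0 : 0 <= a. Proof. exact: (rad_ge0 rad_lt). Qed.

Definition slowtime s := Rint (a - 2) s w.
Local Notation F := slowtime.

Lemma der_slowtime s : a - 2 < s -> is_derive s 1 F (w s).
Proof.
move=> s1; apply: (@Rint_FTC1 _ (a - 2) (s + 1)) => //. lra.
Qed.

(** The interval is larger than [[a, b]], so that the inverse is differentiable
    at both ends of the leg. *)
Lemma slowradius_exists : exists G : R -> R, [/\
  forall v, a - 1 <= v <= b + 1 -> G (F v) = v,
  forall v, a - 1 < v < b + 1 -> is_derive (F v) 1 G (w v)^-1,
  forall t, F (a - 1) <= t <= F (b + 1) -> a - 1 <= G t <= b + 1 /\ F (G t) = t &
  forall u v, a - 1 <= u -> u < v -> v <= b + 1 -> F u < F v].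
Proof.
have ab1 : a - 1 < b + 1 by have := ab; lra.
have D v : a - 1 <= v <= b + 1 -> is_derive v 1 F (w v) by move=> vI; apply: der_slowtime; lra.
exact: (inverse_fun ab1 D (fun v _ => w_gt0 v)).
Qed.

Definition slowradius : R -> R := projT1 (cid slowradius_exists).
Local Notation G := slowradius.

(** The radius at slow time [F s0 + e t]: outward from [s0 = a] for [e = 1],
    inward from [s0 = b] for [e = -1]. *)
Definition radial_leg (s0 e : R) : phase_curve R := PhaseCurve (F b - F a)
  (fun t => G (F s0 + e * t)) (fun=> 0) (fun t => e * w (G (F s0 + e * t))) (fun=> 0).

Lemma slowradius_range y : F a <= y <= F b -> a <= G y <= b /\ is_derive y 1 G (w (G y))^-1.
Proof.
have ab' := ab; have [a1 b1] : a - 1 <= a /\ b <= b + 1 by lra.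
rewrite /slowradius; case: (cid slowradius_exists) => g /= [h1 h2 h3 h4] yI.
have [H _] := inverse_range a1 ab' b1 h3 h4.
have [gI E] := H y yI.
by split => //; have := h2 (g y) ltac:(lra); rewrite E.
Qed.

Lemma slowradius_range_lt y : F a < y < F b -> a < G y < b.
Proof.
have ab' := ab; have [a1 b1] : a - 1 <= a /\ b <= b + 1 by lra.
rewrite /slowradius; case: (cid slowradius_exists) => g /= [h1 h2 h3 h4] yI.
have [_ H] := inverse_range a1 ab' b1 h3 h4.
exact: H.
Qed.

Lemma slowradiusK s : a <= s <= b -> G (F s) = s.
Proof.
by rewrite /slowradius; case: (cid slowradius_exists) => g /= [h1 _ _ _] sI; apply: h1; lra.
Qed.

Lemma slowtime_lt : F a < F b.
Proof.
have ab' := ab; have [g [_ _ _ h4]] := slowradius_exists.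
by apply: h4; lra.
Qed.

Lemma slowtimeB : F b - F a = Rint a b w.
Proof.
have ab' := ab; rewrite /slowtime (@Rint_split _ (a - 2) a b); [|lra|lra|].
  by rewrite [_ + Rint a b w]addrC addrK.
by move=> z _; exact: w_cont.
Qed.

Lemma radial_range s0 e t : s0 = a /\ e = 1 \/ s0 = b /\ e = -1 ->
  0 <= t <= F b - F a -> F a <= F s0 + e * t <= F b.
Proof. by move=> [[-> ->]|[-> ->]]; lra. Qed.

Lemma radial_range_lt s0 e t : s0 = a /\ e = 1 \/ s0 = b /\ e = -1 ->
  0 < t < F b - F a -> F a < F s0 + e * t < F b.
Proof. by move=> [[-> ->]|[-> ->]]; lra. Qed.

Lemma radial_radius s0 e t : s0 = a /\ e = 1 \/ s0 = b /\ e = -1 ->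
  0 <= t <= F b - F a -> Defs.radius (radial_leg s0 e) t = G (F s0 + e * t).
Proof.
move=> se tI; have [/andP[gI _] _] := slowradius_range (radial_range se tI).
by rewrite /Defs.radius /= expr0n addr0 sqrtr_sqr ger0_norm// (le_trans a0).
Qed.

Lemma radial_geodesic s0 e : s0 = a /\ e = 1 \/ s0 = b /\ e = -1 ->
  unit_geodesic (c i) (radial_leg s0 e).
Proof.
move=> se; have Fl := slowtime_lt.
have e2 : e * e = 1 by case: se => [[_ ->]|[_ ->]]; ring.
have en : `|e| = 1 by case: se => [[_ ->]|[_ ->]]; rewrite ?normrN normr1.
have dG t : 0 <= t <= F b - F a -> is_derive t 1 (fun t => G (F s0 + e * t)) ((w (G (F s0 + e * t)))^-1 * e).
  move=> tI; have [_ D] := slowradius_range (radial_range se tI).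
  have D2 : is_derive t 1 (fun t => F s0 + e * t) e.
    by eapply is_derive_eq; [der|rewrite /=; ring].
  exact: (der_comp (g := fun t => F s0 + e * t) D D2).
split; first by rewrite /= subr_gt0.
  have c0 : cont_itv 0 (F b - F a) (fun=> 0 : R) by move=> z _; exact: cvg_cst.
  have c1 : cont_itv 0 (F b - F a) (fun t => G (F s0 + e * t)).
    by move=> t tI; exact: is_derive_continuous (dG t tI).
  have c2 : cont_itv 0 (F b - F a) (fun t => e * w (G (F s0 + e * t))).
    move=> t tI; have cw : ctn t (fun t => w (G (F s0 + e * t))).
      by apply: (ctn_comp (f := w)); [exact: w_cont|exact: c1].
    by cts.
  by split; exact: cont_itv_within.
move=> t /= tI; have tI' : 0 <= t <= F b - F a by lra.
set y := G (F s0 + e * t).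
have yI : a < y < b by exact: slowradius_range_lt (radial_range_lt se tI).
have y0 : 0 < y by have := a0; lra.
have cy := c_gt0 yI; have [l Dl] := c_derive yI.
have wy := wE yI.
have nE : conorm (radial_leg s0 e) t = (c i y)^-1.
  rewrite /conorm /= expr0n addr0 sqrtr_sqr -/y normrM en mul1r wy ger0_norm//.
  by rewrite invr_ge0 ltW.
have D := dG t tI'; rewrite -/y wy invrK in D.
rewrite nE (radial_radius se tI') -/y; split.
- by rewrite divff// gt_eqF.
- split; last by rewrite /= mulr0; exact: der_cst.
  by apply: (is_derive_eq D); rewrite /= -/y wy; field; rewrite gt_eqF.
- move=> _ /=; split; last by rewrite /= mulr0; exact: der_cst.
  have Dw : is_derive y 1 w (- l / c i y ^+ 2).
    have n0 : c i y != 0 by rewrite gt_eqF.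
    apply: (is_derive_near (f := fun s => (c i s)^-1) (d := Num.min (y - a) (b - y))).
    + by rewrite lt_min; lra.
    + by move=> z; rewrite lt_min !ltr_norml => zI; rewrite wE//; lra.
    + exact: (der_inv n0 Dl).
  have D3 := der_mul (der_cst e t) (der_comp (g := fun t => G (F s0 + e * t)) Dw D).
  apply: (is_derive_eq D3).
  rewrite mul0r add0r (is_derive1E Dl) /= -/y.
  transitivity (- l / c i y * (e * e)); first by field; rewrite gt_eqF.
  by rewrite e2; field; rewrite !gt_eqF.
Qed.

Lemma radial_geodesic_leg s0 e : s0 = a /\ e = 1 \/ s0 = b /\ e = -1 ->
  geodesic_leg K rk c (radial_leg s0 e).
Proof.
move=> se; have Fl := slowtime_lt; have ab' := ab.
have Ga : Gamma_radii K rk a by exists k.+1.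
have Gb : Gamma_radii K rk b by exists k.
split.
- by exists i; exact: radial_geodesic.
- rewrite (radial_radius se); last by rewrite lexx/=; lra.
  by rewrite mulr0 addr0; case: se => [[-> _]|[-> _]]; rewrite slowradiusK//; lra.
- rewrite (radial_radius se) /=; last by rewrite lexx andbT; lra.
  case: se => [[-> ->]|[-> ->]].
    by rewrite mul1r addrC subrK slowradiusK//; lra.
  by rewrite (_ : _ + _ = F a); [rewrite slowradiusK//; lra|ring].
- move=> t /= tI; rewrite (radial_radius se); last lra.
  have /andP[h1 h2] := slowradius_range_lt (radial_range_lt se tI).
  split; last exact: (not_Gamma rad_lt kK').
  exact: lt_le_trans h2 (rad_le1 rad_lt (leqW kK')).
Qed.

Lemma radial_in_lsp : length_spectrum K rk c (2 * Rint a b w).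
Proof.
have ab' := ab.
have inn : b = a /\ (-1 : R) = 1 \/ b = b /\ (-1 : R) = -1 by right.
have out : a = a /\ (1 : R) = 1 \/ a = b /\ (1 : R) = -1 by left.
pose leg (j : 'I_2) := if j == ord0 then radial_leg b (-1) else radial_leg a 1.
exists 1%N, leg; split; last first.
  by rewrite big_ord_recl big_ord1 /= /leg /= -slowtimeB; ring.
move=> j; split; last first.
  by left; rewrite /leg; case: ifP => _; exact: radial_geodesic_leg.
have E1 : F b + -1 * (F b - F a) = F a by ring.
have E2 : F a + 1 * (F b - F a) = F b by ring.
case: j => -[|[|//]] j2; rewrite /leg /=; split => /=;
  rewrite /angular_momentum /= ?mulr0 ?mul0r ?subrr ?addr0//.
- by rewrite E1.
- by rewrite E2.
Qed.

End Radial.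

(** * Interfaces and profiles do not move *)

Section SlownessExtension.
Context {R : realType}.
Implicit Types (c : R -> R) (a b s l : R).

Lemma cvg_right_eps c a l : c x @[x --> a^'+] --> l ->
  forall e, 0 < e -> exists2 d, 0 < d & forall y, a < y -> y - a < d -> `|c y - l| < e.
Proof.
move=> /cvgrPdist_lt H e e0; have := H e e0.
rewrite /at_right /within /= => /nbhs_ballP[d /= d0 Hd].
exists d => // y ay yd; rewrite distrC; apply: Hd => //.
by rewrite /ball/= distrC ger0_norm//; lra.
Qed.

(** The slowness is continued to a continuous positive function on the line, by
    its one-sided limits at the two ends of the layer. *)
Lemma slowness_ext c a b l : a < b -> c x @[x --> a^'+] --> l -> 0 < l ->
  (forall s, a < s <= b -> 0 < c s) ->
  (forall s, a < s <= b -> forall e, 0 < e -> exists2 d, 0 < d &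
     forall y, a < y <= b -> `|y - s| < d -> `|c y - c s| < e) ->
  exists w : R -> R, [/\ forall u, {for u, continuous w}, forall u, 0 < w u &
    forall s, a < s <= b -> w s = (c s)^-1].
Proof.
move=> ab cl l0 c0 cc.
pose e s := if s <= a then l else c (Num.min s b).
have mI s : a < s -> a < Num.min s b <= b by move=> as_; rewrite lt_min as_ ab ge_min lexx orbT.
have e0 s : 0 < e s.
  by rewrite /e; have [//|/mI] := leP s a; exact: c0.
have ce s : ctn s e.
  apply/continuousP_eps => h h0; case: (ltgtP s a) => [sa|as_|->].
  - exists (a - s) => [|y]; first lra.
    move=> yI; rewrite ltr_norml in yI.
    by rewrite /e (ltW sa) ifT ?subrr ?normr0//; lra.
  - have [d d0 Hd] := cc _ (mI s as_) _ h0.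
    exists (Num.min d (s - a)) => [|y]; first by rewrite lt_min; lra.
    rewrite lt_min => /andP[yd ya].
    have ay : a < y by move: ya; rewrite ltr_norml; lra.
    rewrite /e !ifF; [|by apply/negbTE; rewrite -ltNge..].
    apply: Hd; first exact: mI.
    apply: le_lt_trans yd; rewrite !minEle.
    have n1 := ler_norm (y - s); have n2 := ler_norm (s - y); rewrite distrC in n2.
    by case: ifPn; rewrite -?ltNge => h1; case: ifPn; rewrite -?ltNge => h2;
      rewrite ler_norml; lra.
  - have [d d0 Hd] := cvg_right_eps cl h0.
    exists (Num.min d (b - a)) => [|y]; first by rewrite lt_min; lra.
    rewrite lt_min => /andP[y1 y2].
    rewrite ltr_norml in y1; rewrite ltr_norml in y2.
    rewrite {2}/e lexx /e; case: ifPn => [_|]; first by rewrite subrr normr0.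
    rewrite -ltNge => ay; rewrite min_l; last lra.
    by apply: Hd => //; lra.
exists (fun s => (e s)^-1); split.
- by move=> u; apply: ctnV => //; rewrite gt_eqF.
- by move=> u; rewrite invr_gt0.
- move=> s /andP[as_ sb]; rewrite /e ifF; last by apply/negbTE; rewrite -ltNge.
  by rewrite min_l.
Qed.

End SlownessExtension.

Section Rigid.
Context {R : realType}.
Variables (eps : R) (K : nat) (r : nat -> R -> R) (c : 'I_2 -> R -> R -> R).
Hypothesis eps_gt0 : 0 < eps.
Hypothesis c_adm : forall i, admissible_family eps K r (c i).
Hypothesis lsp_countable : forall tau, - eps < tau < eps -> countable (lsp K r c tau).
Hypothesis lsp_const : forall tau, - eps < tau < eps -> lsp K r c tau = lsp K r c 0.
Implicit Types (i : 'I_2) (k : nat) (tau t s u : R).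
Local Notation rho t k := (Defs.rad K (r^~ t) k).

Let radlt t (tI : - eps < t < eps) k : (k <= K)%N -> rho t k.+1 < rho t k.
Proof. by move=> kK; exact: (adm_radii_lt (c_adm ord0) kK tI). Qed.

(** The set of [t] with [rho t k.+1 < s] may be disconnected, so the comparison
    is along an interval on which the radius [s] stays in the layer. *)
Lemma static_between i k t1 t2 s : (k <= K)%N ->
  (forall t, - eps < t < eps -> rho t k = rho 0 k) ->
  - eps < t1 -> t1 <= t2 -> t2 < eps ->
  (forall t, t1 <= t <= t2 -> rho t k.+1 < s) -> s <= rho 0 k ->
  c i t1 s = c i t2 s.
Proof.
have mark := Logic.I.
move=> kK rhoE h1 h12 h2 as_ sb.
move: h12; rewrite le_eqVlt => /predU1P[->//|h12].
have D t : t1 <= t <= t2 -> is_derive t 1 (fun t => c i t s) 0.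
  move=> tI; have tI' : - eps < t < eps by keep tI h1 h2; lra.
  have ta := as_ t tI.
  pose s0 := (rho t k.+1 + s) / 2.
  have s0l : rho t k.+1 < s0 by rewrite /s0; keep ta; lra.
  have s0s : s0 < s by rewrite /s0; keep ta; lra.
  have [d d0 Hd] := local_static c_adm lsp_countable lsp_const i kK rhoE tI' s0l (lt_le_trans s0s sb).
  apply: (is_derive_near (f := fun=> c i t s) (d := Num.min d (Num.min (t + eps) (eps - t)))).
  - by rewrite !lt_min d0; keep tI'; lra.
  - move=> y; rewrite !lt_min => /andP[yd /andP[y1 y2]].
    rewrite (Hd y) ?(ltW s0s)//.
    by move: y1 y2; rewrite !ltr_norml; keep0; lra.
have [z zI|z|z zI E] := @mvt_lin _ (fun t => c i t s) (fun=> 0) t1 t2 h12.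
- exact: is_derive_continuous (D z zI).
- by move=> zI; apply: D; keep zI; lra.
- by apply/eqP; rewrite eq_sym -subr_eq0 E mul0r.
Qed.

(** The limit of [c] at the lower interface exists by the definition of a jump,
    and it is positive because [s / c s] is increasing. *)
Lemma travel_time k t : (k < K)%N -> - eps < t < eps ->
  exists w : R -> R, [/\ forall u, {for u, continuous w}, forall u, 0 < w u,
    forall s, rho t k.+1 < s <= rho t k -> w s = (c ord0 t s)^-1 &
    lsp K r c t (2 * Rint (rho t k.+1) (rho t k) w)].
Proof.
move=> kK tI; have kK' := ltnW kK; have adm := c_adm ord0.
set a := rho t k.+1; set b := rho t k.
have ab : a < b by exact: (radlt tI kK').
have a0 : 0 < a.
  have := radlt tI (kK : (k.+1 <= K)%N); have := rad_ge0 (radlt tI) (k := k.+2) kK.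
  by rewrite -/a; lra.
have c0 s : a < s <= b -> 0 < c ord0 t s.
  move=> sI; apply: (adm_pos adm tI).
  by have := rho_01 c_adm kK' tI sI; lra.
have [l' [l [_ cl _]]] : has_jump (c ord0 t) a.
  have := @adm_jump _ _ _ _ _ adm k.+1 t kK tI.
  by rewrite /a /Defs.rad /= kK.
have low s : a < s < b -> a * c ord0 t b / b <= c ord0 t s.
  move=> sI; have s0 : 0 < s by lra.
  have es : expR (ln s) = s by rewrite lnK.
  have as1 : rho t k.+1 < expR (ln s) by rewrite es; case/andP: sI.
  have as2 : expR (ln s) < rho t k by rewrite es; case/andP: sI.
  have [f [df [M [pf _ fE]]]] := @local_profile _ _ _ _ _ c_adm ord0 k t (ln s) kK' tI
    as1 as2.
  have b0 : 0 < b by lra.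
  have AB := pf_AB pf.
  have := pf_le pf (lexx (ln s)) (ltW AB).
  rewrite (fE (ln s)) ?lexx ?(ltW AB)// (fE (ln (rho t k))) ?lexx ?(ltW AB)//.
  have cs0 : 0 < c ord0 t s by apply: c0; lra.
  have cb0 : 0 < c ord0 t b by apply: c0; lra.
  rewrite /rho2 es lnK ?posrE// -/b ler_sqr ?nnegrE ?divr_ge0 ?(ltW s0) ?(ltW b0) ?(ltW cs0) ?(ltW cb0)//.
  rewrite ler_pdivrMr// mulrAC ler_pdivlMr// => h.
  rewrite ler_pdivrMr// [c ord0 t s * b]mulrC; apply: le_trans h.
  by apply: ler_wpM2r; [exact: ltW|case/andP: sI => /ltW].
have b0 : 0 < b by lra.
have cb0 : 0 < c ord0 t b by apply: c0; rewrite ab lexx.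
have m0 : 0 < a * c ord0 t b / b by rewrite divr_gt0// mulr_gt0.
have l0 : 0 < l.
  apply: (lt_le_trans m0); rewrite leNgt; apply/negP => lm.
  have e0 : 0 < a * c ord0 t b / b - l by rewrite subr_gt0.
  have [d d0 Hd] := cvg_right_eps cl e0.
  pose y := Num.min (a + d / 2) ((a + b) / 2).
  have y1 : a < y by rewrite lt_min; lra.
  have y2 : y <= a + d / 2 by rewrite ge_min lexx.
  have y3 : y <= (a + b) / 2 by rewrite ge_min lexx orbT.
  have := low y ltac:(lra); have := Hd y y1 ltac:(lra).
  by rewrite ltr_norml => /andP[_ +]; rewrite ltrD2r => /lt_le_trans h /h; rewrite ltxx.
have cc s : a < s <= b -> forall e, 0 < e -> exists2 d, 0 < d &
     forall y, a < y <= b -> `|y - s| < d -> `|c ord0 t y - c ord0 t s| < e.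
  move=> sI e e0; have [dc [Hdc _]] := adm_C11 adm kK' tI.
  have [d d0 Hd] := hdw_cont (Hdc s (layer_domain kK' sI)) e0.
  by exists d => // y yI; apply: Hd; exact: (layer_domain kK').
have [w [w1 w2 w3]] := slowness_ext ab cl l0 c0 cc.
exists w; split => //.
apply: (@radial_in_lsp _ K (r^~ t) (fun i => c i t) ord0 k (radlt tI) kK w w1 w2).
- by move=> s sI; apply: c0; rewrite -/a -/b in sI; lra.
- move=> s sI; have [dc [Hdc _]] := adm_C11 adm kK' tI.
  exists (dc s); apply: (hdw_is_derive (D := layer K (r^~ t) k) (d := Num.min (s - a) (b - s))).
  + by rewrite lt_min; move: sI; rewrite -/a -/b; lra.
  + by move=> y; rewrite lt_min !ltr_norml => yI; apply: (layer_domain kK'); rewrite -/a -/b; lra.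
  + by apply: Hdc; apply: (layer_domain kK'); rewrite -/a -/b in sI *; lra.
- by move=> s sI; apply: w3; rewrite -/a -/b in sI; lra.
Qed.

(** Both profiles agree above the larger of the two lower radii; the other layer
    has an additional part to be crossed. *)
Lemma time_lt k t1 t2 (w1 w2 : R -> R) : (k < K)%N ->
  (forall t, - eps < t < eps -> rho t k = rho 0 k) ->
  - eps < t1 < eps -> - eps < t2 < eps -> rho t1 k.+1 < rho t2 k.+1 ->
  (forall t, Num.min t1 t2 <= t <= Num.max t1 t2 -> rho t k.+1 <= rho t2 k.+1) ->
  (forall u, {for u, continuous w1}) -> (forall u, {for u, continuous w2}) ->
  (forall u, 0 < w1 u) ->
  (forall s, rho t1 k.+1 < s <= rho t1 k -> w1 s = (c ord0 t1 s)^-1) ->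
  (forall s, rho t2 k.+1 < s <= rho t2 k -> w2 s = (c ord0 t2 s)^-1) ->
  Rint (rho t2 k.+1) (rho t2 k) w2 < Rint (rho t1 k.+1) (rho t1 k) w1.
Proof.
move=> kK rhoE t1I t2I a12 mon cw1 cw2 w10 E1 E2; have kK' := ltnW kK.
have ab2 := radlt t2I kK'.
rewrite (rhoE t1 t1I) in E1 *; rewrite (rhoE t2 t2I) in E2 ab2 *.
set a1 := rho t1 k.+1 in a12 E1 *; set a2 := rho t2 k.+1 in a12 mon E2 ab2 *.
set b := rho 0 k in E1 E2 ab2 *.
have cE s : a2 < s <= b -> c ord0 t1 s = c ord0 t2 s.
  move=> /andP[as_ sb]; have [le|/ltW le] := leP t1 t2.
    apply: (static_between ord0 kK' rhoE) => //; [by case/andP: t1I|by case/andP: t2I|].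
    move=> t tI; apply: le_lt_trans as_; apply: mon.
    by rewrite min_l// max_r.
  symmetry; apply: (static_between ord0 kK' rhoE) => //; [by case/andP: t2I|by case/andP: t1I|].
  move=> t tI; apply: le_lt_trans as_; apply: mon.
  by rewrite min_r// max_l.
have wE s : a2 < s <= b -> w1 s = w2 s.
  move=> sI; rewrite E1 ?E2 ?cE//.
  by case/andP: sI => h ->; rewrite (lt_trans a12 h).
have wa : w1 a2 = w2 a2.
  have cN : {for - a2, continuous (fun s => w1 (- s) - w2 (- s))}.
    have n1 : ctn (- a2) (fun s => w1 (- s)).
      by apply: (ctn_comp (f := w1) (g := fun s => - s)); [exact: cw1|cts].
    have n2 : ctn (- a2) (fun s => w2 (- s)).
      by apply: (ctn_comp (f := w2) (g := fun s => - s)); [exact: cw2|cts].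
    by cts.
  have := @cont_end_eq _ (fun s => w1 (- s) - w2 (- s)) (- b) (- a2) 0 _ cN _.
  rewrite opprK => /(_ ltac:(by rewrite ltrN2)) H.
  apply/eqP; rewrite -subr_eq0; apply/eqP; apply: H => s sI.
  by rewrite wE ?subrr//; lra.
have ci p q : cont_itv p q w1 by move=> z _; exact: cw1.
rewrite (@Rint_split _ a1 a2 b w1); [|exact: ltW|exact: ltW|exact: ci].
have -> : Rint a2 b w1 = Rint a2 b w2.
  apply: Rint_ext => s /andP[]; rewrite le_eqVlt => /predU1P[<-//|as_] sb.
  by apply: wE; rewrite as_.
by rewrite ltrDr; apply: Rint_gt0.
Qed.

Lemma countable_inj (S : set R) (T : R -> R) a b : countable S -> a < b ->
  (forall t, a <= t <= b -> S (T t)) ->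
  (forall t t', a <= t <= b -> a <= t' <= b -> T t = T t' -> t = t') -> False.
Proof.
move=> cS ab TS inj.
have cI : countable (T @` `[a, b]).
  by apply: sub_countable cS; apply: subset_card_le => _ [t tI <-]; apply: TS; move: tI; rewrite /= in_itv.
have E : (T @` `[a, b] #= `[a, b]%classic)%card.
  by apply: inj_card_eq => x y; rewrite !inE/= !in_itv/=; exact: inj.
have cJ : countable (`[a, b]%classic : set R).
  by rewrite -(eq_countable E).
exact: (countable_itv_false cJ ab).
Qed.

(** Where the radius has nonzero speed it is strictly monotone, and by [time_lt]
    the travel time is injective there, with values in a countable set. *)
Lemma radius_static k : (k < K)%N ->
  (forall t, - eps < t < eps -> rho t k = rho 0 k) ->
  forall t, - eps < t < eps -> rho t k.+1 = rho 0 k.+1.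
Proof.
have mark := Logic.I.
move=> kK rhoE; pose a := r k.+1; have kK' := ltnW kK.
have aE t : rho t k.+1 = a t by rewrite /Defs.rad /= kK.
have C1 t (tI : - eps < t < eps) : derivable a t 1 /\ {for t, continuous (derive1 a)}.
  exact: (@adm_radii_C1 _ _ _ _ _ (c_adm ord0) k.+1 t kK tI).
have Da t : - eps < t < eps -> is_derive t 1 a (derive1 a t).
  by move=> tI; apply: derivable_is_derive1; exact: (proj1 (C1 t tI)).
have Tt t : exists w : R -> R, - eps < t < eps ->
    [/\ forall u, {for u, continuous w}, forall u, 0 < w u,
    forall s, rho t k.+1 < s <= rho t k -> w s = (c ord0 t s)^-1 &
    lsp K r c t (2 * Rint (rho t k.+1) (rho t k) w)].
  have [tI|] := boolP (- eps < t < eps); last by exists id.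
  by have [w H] := travel_time kK tI; exists w.
have [w Hw] := choice Tt.
pose T t := 2 * Rint (rho t k.+1) (rho t k) (w t).
have z0 : - eps < 0 < eps by rewrite oppr_lt0 eps_gt0.
have TS t : - eps < t < eps -> lsp K r c 0 (T t).
  by move=> tI; rewrite -(lsp_const tI); have [_ _ _] := Hw t tI.
have Tlt t1 t2 : - eps < t1 < eps -> - eps < t2 < eps -> a t1 < a t2 ->
    (forall t, Num.min t1 t2 <= t <= Num.max t1 t2 -> a t <= a t2) -> T t2 < T t1.
  move=> t1I t2I a12 mon.
  have [v1 v2 v3 _] := Hw t1 t1I; have [v1' _ v3' _] := Hw t2 t2I.
  rewrite ltr_pM2l//; apply: time_lt => //; first by rewrite !aE.
  by move=> t tI; rewrite !aE; exact: mon.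
have noslope t0 : - eps < t0 < eps -> derive1 a t0 = 0.
  move=> t0I; apply/eqP/negPn/negP => n0.
  have cd := proj2 (C1 t0 t0I).
  have n1 : 0 < `|derive1 a t0| by rewrite normr_gt0.
  have [d d0 Hd] := (continuousP_eps _ _).1 cd _ n1.
  pose h := Num.min (d / 2) (Num.min ((t0 + eps) / 2) ((eps - t0) / 2)).
  have h0 : 0 < h by rewrite !lt_min; keep d0 t0I; lra.
  have [h1 h2 h3] : [/\ h <= d / 2, h <= (t0 + eps) / 2 & h <= (eps - t0) / 2].
    by rewrite /h !ge_min !lexx !orbT.
  have inI t : t0 - h <= t <= t0 + h -> - eps < t < eps by keep h2 h3 t0I h0; lra.
  have log_slope t : t0 - h <= t <= t0 + h -> 0 < derive1 a t * derive1 a t0.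
    move=> tI; have td : `|t - t0| < d by rewrite ltr_norml; keep tI h1 d0; lra.
    have := Hd t td; case: (ltgtP (derive1 a t0) 0) => [neg|pos|/eqP]; last by rewrite (negPf n0).
      by rewrite (ltr0_norm neg) ltr_norml => angle_density; rewrite nmulr_lgt0//; keep angle_density; lra.
    by rewrite (gtr0_norm pos) ltr_norml => angle_density; rewrite mulr_gt0//; keep angle_density; lra.
  have mono t t' : t0 - h <= t -> t < t' -> t' <= t0 + h -> 0 < (a t' - a t) * derive1 a t0.
    move=> l1 l2 l3.
    have [z zI|z|z zI ->] := @mvt_lin _ a (derive1 a) t t' l2.
    - by apply: is_derive_continuous (Da z _); apply: inI; keep zI l1 l3; lra.
    - by move=> zI; apply: Da; apply: inI; keep zI l1 l3; lra.
    - rewrite mulrAC mulr_gt0 ?subr_gt0//; apply: log_slope; keep zI l1 l3; lra.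
  have ineq t t' : t0 - h <= t -> t < t' -> t' <= t0 + h -> T t != T t'.
    move=> l1 l2 l3; have m := mono t t' l1 l2 l3.
    have tI : - eps < t < eps by apply: inI; rewrite l1 (le_trans (ltW l2)).
    have t'I : - eps < t' < eps by apply: inI; rewrite l3 (le_trans l1 (ltW l2)).
    case: (ltgtP (derive1 a t0) 0) => [neg|pos|/eqP]; last by rewrite (negPf n0).
      rewrite lt_eqF//; apply: Tlt => //.
        by move: m; rewrite nmulr_lgt0// subr_lt0.
      move=> s; rewrite (max_l (ltW l2)) (min_r (ltW l2)) => /andP[].
      rewrite le_eqVlt => /predU1P[<-//|ts] st'.
      have := mono t s l1 ts (le_trans st' l3).
      by rewrite nmulr_lgt0// subr_lt0 => /ltW.
    rewrite gt_eqF//; apply: Tlt => //.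
      by move: m; rewrite pmulr_lgt0// subr_gt0.
    move=> s; rewrite (max_r (ltW l2)) (min_l (ltW l2)) => /andP[ts].
    rewrite le_eqVlt => /predU1P[->//|st'].
    have := mono s t' (le_trans l1 ts) st' l3.
    by rewrite pmulr_lgt0// subr_gt0 => /ltW.
  have angle_density : t0 - h < t0 + h by keep h0; lra.
  apply: (@countable_inj (lsp K r c 0) T _ _ (lsp_countable z0) angle_density).
    by move=> t /inI; exact: TS.
  move=> t t' /andP[p1 p2] /andP[p1' p2'] E; case: (ltgtP t t') => // l.
    by have := ineq t t' p1 l p2'; rewrite E eqxx.
  by have := ineq t' t p1' l p2; rewrite E eqxx.
have D t : - eps < t < eps -> is_derive t 1 a 0.
  by move=> tI; have d := Da t tI; rewrite (noslope t tI) in d.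
move=> t tI; rewrite !aE.
have cst := @same_derive_diff _ a (fun=> 0) (fun=> 0) (- eps) eps D (fun p _ => der_cst 0 p) t 0 tI z0.
by apply/eqP; rewrite -subr_eq0 cst subrr.
Qed.

Lemma all_radii_static k t : (k <= K.+1)%N -> - eps < t < eps -> rho t k = rho 0 k.
Proof.
move=> + tI; elim: k t tI => [//|k ih] t tI; rewrite ltnS leq_eqVlt => /predU1P[->|kK].
  by rewrite /Defs.rad /= ltnn.
by apply: (radius_static kK _ tI) => t' t'I; apply: ih => //; exact: leqW (ltnW kK).
Qed.

Lemma static_off_origin i t s : - eps < t < eps -> 0 < s <= 1 -> c i t s = c i 0 s.
Proof.
move=> tI /andP[s0 s1].
have z0 : - eps < 0 < eps by have := eps_gt0; lra.
have [k kK sI] : exists2 k, (k <= K)%N & rho 0 k.+1 < s <= rho 0 k.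
  have : exists k, rho 0 k.+1 < s.
    by exists K; rewrite /Defs.rad /= ltnn.
  move=> ex; case: (ex_minnP ex) => k ks kmin.
  exists k.
    by apply: kmin; rewrite /Defs.rad /= ltnn.
  rewrite ks /=; case: k ks kmin => [//|k] ks kmin.
  by rewrite leNgt; apply/negP => /kmin; rewrite ltnn.
have rhoE t' : - eps < t' < eps -> rho t' k = rho 0 k.
  by move=> t'I; apply: all_radii_static => //; exact: leqW.
have asE t' : - eps < t' < eps -> rho t' k.+1 < s.
  by move=> t'I; rewrite all_radii_static//; case/andP: sI.
case/andP: sI => _ sb.
have [tl tr] : - eps < t /\ t < eps by case/andP: tI.
have [zl zr] : - eps < 0 /\ 0 < eps by case/andP: z0.
have [le|/ltW le] := leP t 0.
  apply: (static_between i kK rhoE tl le zr _ sb) => t' /andP[h1 h2]; apply: asE.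
  by rewrite (lt_le_trans tl h1) (le_lt_trans h2 zr).
symmetry; apply: (static_between i kK rhoE zl le tr _ sb) => t' /andP[h1 h2]; apply: asE.
by rewrite (lt_le_trans zl h1) (le_lt_trans h2 tr).
Qed.

(** The origin is a limit of positive radii of the innermost layer. *)
Lemma static_origin i t : - eps < t < eps -> c i t 0 = c i 0 0.
Proof.
move=> tI; have z0 : - eps < 0 < eps by have := eps_gt0; lra.
have L s : 0 <= s <= rho 0 K -> layer K (r^~ t) K s /\ layer K (r^~ 0) K s.
  by move=> sI; rewrite /layer ltnn /= all_radii_static.
have b0 : 0 < rho 0 K.
  by have := radlt z0 (leqnn K); rewrite {1}/Defs.rad /= ltnn.
have b1 : rho 0 K <= 1 by exact: (rad_le1 (radlt z0)).
have [L1 L2] := L 0 ltac:(lra).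
have [d1 [H1 _]] := adm_C11 (c_adm i) (leqnn K) tI.
have [d2 [H2 _]] := adm_C11 (c_adm i) (leqnn K) z0.
apply/eqP; rewrite -subr_eq0 -normr_eq0; apply/negPn/negP => n0.
have n1 : 0 < `|c i t 0 - c i 0 0| / 2 by rewrite divr_gt0// lt_def n0 normr_ge0.
have [e1 e10 E1] := hdw_cont (H1 0 L1) n1.
have [e2 e20 E2] := hdw_cont (H2 0 L2) n1.
pose s := Num.min (rho 0 K) (Num.min (e1 / 2) (e2 / 2)).
have s0 : 0 < s by rewrite !lt_min b0; lra.
have [s1 s2 s3] : [/\ s <= rho 0 K, s <= e1 / 2 & s <= e2 / 2].
  by rewrite /s !ge_min !lexx !orbT.
have [M1 M2] := L s ltac:(lra).
have h1 := E1 s M1 ltac:(rewrite subr0 ger0_norm; lra).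
have h2 := E2 s M2 ltac:(rewrite subr0 ger0_norm; lra).
have sE : c i t s = c i 0 s by apply: static_off_origin => //; lra.
rewrite sE in h1; move: h1 h2.
set x := c i 0 s; set y := c i t 0; set z := c i 0 0 => h1 h2.
have : `|y - z| <= `|x - z| + `|x - y|.
  by rewrite (_ : y - z = (x - z) - (x - y)) ?ler_normB//; ring.
by rewrite -/y -/z in h1 h2 *; lra.
Qed.

End Rigid.

Theorem corollary1p4 (R : realType) (eps : R) (K : nat)
    (r : nat -> R -> R) (c : 'I_2 -> R -> R -> R)
    (eps_gt0 : 0 < eps)
    (c_adm : forall i, admissible_family eps K r (c i))
    (lsp_countable : forall tau, - eps < tau < eps -> countable (lsp K r c tau))
    (lsp_const : forall tau, - eps < tau < eps -> lsp K r c tau = lsp K r c 0) :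
  forall tau, - eps < tau < eps ->
    (forall i s, 0 <= s <= 1 -> c i tau s = c i 0 s) /\
    (forall k, (1 <= k <= K)%N -> r k tau = r k 0).
Proof.
move=> tau tauI; split => [i s /andP[s0 s1]|k /andP[k1 kK]].
  move: s0; rewrite le_eqVlt => /predU1P[<-|s0].
    exact: (static_origin eps_gt0 c_adm lsp_countable lsp_const).
  by apply: (static_off_origin eps_gt0 c_adm lsp_countable lsp_const) => //; rewrite s0.
have := all_radii_static eps_gt0 c_adm lsp_countable lsp_const (leqW kK) tauI.
by rewrite /Defs.rad kK; case: k k1 kK.
Qed.
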